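(* Let $\mathcal{C}=(\mathcal{V},\mathcal{S},\mathcal{L},\mathrm{pl})$ be a planar $(3,m)$-configuration, and let $(\mathcal{A}^{\mathcal{C}},\xi,\gamma)$ be its associated triangular inner-cyclic arrangement. The chamber weight of $\mathcal{C}$ and the $\mathcal{I}$-invariant of $(\mathcal{A}^{\mathcal{C}},\xi,\gamma)$ are related by $$\mathcal{I}(\mathcal{A}^{\mathcal{C}},\xi,\gamma)=\exp\left(\frac{-2\pi i}{m}\,\tau(\mathcal{C})\right).$$
   Context: For distinct points $P,Q\in\mathbb{RP}^2$, $(P,Q)$ denotes the line through them. A $(t,m)$-configuration $\mathcal{C}=(\mathcal{V},\mathcal{S},\mathcal{L},\mathrm{pl})$ consists of two finite sets of points $\mathcal{V}=\{V_1,\dots,V_t\}$ and $\mathcal{S}=\{S_1,\dots,S_n\}$ of $\mathbb{RP}^2$, the finite set of lines $\mathcal{L}=\{(S,V)\mid S\in\mathcal{S},V\in\mathcal{V}\}$, and a map $\mathrm{pl}:\mathcal{V}\sqcup\mathcal{S}\to\mathbb{Z}/m\mathbb{Z}$ with $\mathcal{V}=\mathrm{pl}^{-1}(0)$, such that: (1) for any $V_i\neq V_j$ in $\mathcal{V}$, $\mathcal{S}\cap(V_i,V_j)=\emptyset$; (2) for any $L\in\mathcal{L}$, $\sum_{S\in L\cap\mathcal{S}}\mathrm{pl}(S)=0$. It is planar if the points of $\mathcal{V}$ span $\mathbb{RP}^2$. Chamber weight: for a planar $(3,m)$-configuration, the lines $(V_1,V_2),(V_2,V_3),(V_3,V_1)$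 divide $\mathbb{RP}^2$ into 4 chambers $\mathrm{ch}_1,\dots,\mathrm{ch}_4$. The chamber weight is $\tau(\mathcal{C})=\sum_{S\in\mathcal{S}\cap\mathrm{ch}_i}\mathrm{pl}(S)\in\mathbb{Z}/m\mathbb{Z}$; this value does not depend on $i$. Triangular inner-cyclic arrangements and $\mathcal{I}$: let $\mathcal{A}=\{D_1,\dots,D_n\}$ be a line arrangement in $\mathbb{CP}^2$ such that $D_1,D_2,D_3$ are in generic position and each $D_i\cap D_j$ ($i\ne j\in\{1,2,3\}$) is a point of multiplicity 2 in $\mathcal{A}$. Let $\gamma$ be an embedded oriented circle contained in $D_1\cup D_2\cup D_3$, passing exactly once through each of the three points $D_i\cap D_j$, through no other singular point of $\mathcal{A}$, and running through $D_1,D_2,D_3$ in this cyclic order. Let $\xi:H_1(\mathbb{CP}^2\setminus\mathcal{A};\mathbb{Z})\to\mathbb{C}^*$ be a character such that $\xi(\mathfrak{m}_{D_i})=1$ if and only if $i\in\{1,2,3\}$, where $\mathfrak{m}_D$ is the homology class of a meridian of $D$. The triple $(\mathcal{A},\xi,\gamma)$ is a triangular inner-cyclic arrangement if $\prod_{D\ni P}\xi(\mathfrak{m}_D)=1$ for every singular point $P$ of $\mathcal{A}$ lying on $D_1\cup D_2\cup D_3$. Put $\mathcal{A}_\gamma^c=\{D_4,\dots,D_n\}$; $\gamma$ lies in $\mathbb{CP}^2\setminus\mathcal{A}_\gamma^c$, and $\xi$ induces a character $\tilde\xi$ of $H_1(\mathbb{CP}^2\setminus\mathcal{A}_\gamma^c;\mathbb{Z})$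 (as $\xi(\mathfrak{m}_{D_i})=1$ for $i\le3$). Then $\mathcal{I}(\mathcal{A},\xi,\gamma)=\tilde\xi([\gamma])$. Arrangement associated to $\mathcal{C}$: for $P=(a:b:c)\in\mathbb{RP}^2$, $P^\bullet=\{ax+by+cz=0\}\subset\mathbb{CP}^2$. Then $\mathcal{A}^{\mathcal{C}}=\{P^\bullet\mid P\in\mathcal{V}\sqcup\mathcal{S}\}$, with $D_i=V_i^\bullet$ for $i=1,2,3$; the character $\xi$ is given by $\xi(\mathfrak{m}_{V_i^\bullet})=1$ and $\xi(\mathfrak{m}_{S^\bullet})=\exp(2\pi i\,\mathrm{pl}(S)/m)$ for $S\in\mathcal{S}$; and $\gamma$ is an embedded oriented circle contained in $V_1^\bullet\cup V_2^\bullet\cup V_3^\bullet$, passing exactly once through each of the three points $V_i^\bullet\cap V_j^\bullet$ ($i\neq j\in\{1,2,3\}$), through no other singular point of $\mathcal{A}^{\mathcal{C}}$, and running through $V_1^\bullet,V_2^\bullet,V_3^\bullet$ in this cyclic order. The triple $(\mathcal{A}^{\mathcal{C}},\xi,\gamma)$ is a triangular inner-cyclic arrangement. *)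

(* Defs.v *)
From HB Require Import structures.
From mathcomp Require Import all_boot all_order all_algebra.
From mathcomp Require Import generic_quotient ring_quotient complex freeg.
From mathcomp Require Import all_classical reals topology normedtype trigo.

Set Implicit Arguments.
Unset Strict Implicit.
Unset Printing Implicit Defensive.

Import Order.TTheory GRing.Theory Num.Theory.
Import numFieldNormedType.Exports.

Local Open Scope classical_set_scope.
Local Open Scope ring_scope.
Local Open Scope quotient_scope.

Definition nonzero3 (K : numFieldType) : set 'rV[K]_3 := [set v | v != 0].
Arguments nonzero3 : clear implicits.

Definition proportional (K : numFieldType) : rel (nonzero3 K) :=
  fun u v => `[< exists2 c : K, c != 0 & val u = c *: val v >].

Lemma proportional_equiv (K : numFieldType) :
  equiv_class_of (@proportional K).
Proof.
split=> [u|u v|v u w].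
- by apply/asboolP; exists 1; rewrite ?oner_neq0 ?scale1r.
- by apply/asboolP/asboolP => -[c c0 e]; exists c^-1; rewrite ?invr_eq0 //;
    rewrite e scalerA mulVf // scale1r.
- move=> /asboolP[c c0 e] /asboolP[d d0 f]; apply/asboolP.
  by exists (c * d); rewrite ?mulf_neq0 // e f scalerA.
Qed.

Canonical proportional_equivRel (K : numFieldType) :=
  EquivRelPack (@proportional_equiv K).

(* KP^2 = (K^3 \ {0}) / K^*, with the quotient topology. *)
Definition P2 (K : numFieldType) : topologicalType :=
  quotient_topology {eq_quot (@proportional K)}.

Definition hcoord (K : numFieldType) (x : P2 K) : 'rV[K]_3 :=
  val (repr (x : {eq_quot (@proportional K)})).

(* x = (v_1 : v_2 : v_3); in particular v != 0. *)
Definition has_hcoord (K : numFieldType) (x : P2 K) (v : 'rV[K]_3) :=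
  exists2 c : K, c != 0 & v = c *: hcoord x.

Definition zero_line (K : numFieldType) (a : 'rV[K]_3) : set (P2 K) :=
  [set x | \sum_i a 0 i * hcoord x 0 i = 0].

Definition line_through (K : numFieldType) (x y : P2 K) : set (P2 K) :=
  [set z | (hcoord z <= hcoord x + hcoord y)%MS].

Definition std_simplex (R : realType) (n : nat) : set 'rV[R]_n.+1 :=
  [set x | (forall i, 0 <= x 0 i) /\ \sum_i x 0 i = 1].
Arguments std_simplex : clear implicits.

Definition face_row (R : realType) n (i : 'I_n.+2) (x : 'rV[R]_n.+1) :
  'rV[R]_n.+2 := \row_j (if unlift i j is Some k then x 0 k else 0).

Lemma face_row_simplex (R : realType) n (i : 'I_n.+2) (x : std_simplex R n) :
  face_row i (val x) \in std_simplex R n.+1.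
Proof.
case: x => x /= /set_mem[x0 x1]; apply/mem_set; split=> [j|].
  by rewrite mxE; case: unliftP.
rewrite (bigD1_ord i) //= mxE unlift_none add0r -[RHS]x1.
by apply: eq_bigr => j _; rewrite mxE liftK.
Qed.

Definition face (R : realType) n (i : 'I_n.+2) (x : std_simplex R n) :
  std_simplex R n.+1 := SigSub (face_row_simplex i x).

Lemma continuous_set_type (X Y : topologicalType) (A : set Y) (f : X -> A) :
  continuous (fun x => val (f x)) -> continuous f.
Proof. exact: (@continuous_comp_initial _ _ _ (@set_val _ A)). Qed.

Lemma continuous_row (R : realType) (X : topologicalType) n
    (f : X -> 'rV[R]_n) :
  (forall j, continuous (fun x => f x 0 j)) -> continuous f.
Proof.
move=> cf x A [P Px PA].
apply: (@filterS _ (nbhs x) _ [set y | forall j, P 0 j (f y 0 j)]).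
  by move=> y Py; apply: PA => k j; rewrite (ord1 k); exact: Py.
by apply: filter_forall => j; exact: (cf j x _ (Px 0 j)).
Qed.

Lemma continuous_face (R : realType) n (i : 'I_n.+2) :
  continuous (@face R n i).
Proof.
apply: continuous_set_type; apply: continuous_row => j.
have -> : (fun x : std_simplex R n => val (face i x) 0 j) =
    (fun x => if unlift i j is Some k then val x 0 k else 0).
  by apply/funext => x; rewrite /= mxE.
case: (unlift i j) => [k|]; last exact: cst_continuous.
move=> x; apply: (@continuous_comp _ _ _ (@set_val _ (std_simplex R n))
  (fun y : 'rV[R]_n.+1 => y 0 k)); last exact: coord_continuous.
exact: initial_continuous.
Qed.

HB.instance Definition _ (R : realType) n (i : 'I_n.+2) :=
  @isContinuous.Build _ _ (@face R n i) (@continuous_face R n i).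

Definition comp_cts (W X Y : topologicalType) (g : continuousType X Y)
  (f : continuousType W X) : continuousType W Y := g \o f.

Definition sing_simplex (R : realType) (X : topologicalType) (n : nat) :=
  continuousType (std_simplex R n) X.
HB.instance Definition _ R X n := Choice.on (@sing_simplex R X n).
Arguments sing_simplex : clear implicits.

Notation chain R X n := {freeg (sing_simplex R X n)}.

Definition bdry_simplex (R : realType) (X : topologicalType) n
    (s : sing_simplex R X n.+1) : chain R X n :=
  \sum_(i < n.+2) (-1) ^+ i *: << (comp_cts s (face i) : sing_simplex R X n) >>.

Definition bdry (R : realType) (X : topologicalType) n :
  chain R X n.+1 -> chain R X n := fglift (@bdry_simplex R X n).

Definition push (R : realType) (X Y : topologicalType) n
    (f : continuousType X Y) : chain R X n -> chain R Y n :=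
  fglift (fun s : sing_simplex R X n =>
    << (comp_cts f s : sing_simplex R Y n) >>).

HB.instance Definition _ (R : realType) (X : topologicalType) n :=
  GRing.isZmodMorphism.Build _ _ (@bdry R X n) (lift_is_additive _).
HB.instance Definition _ (R : realType) (X Y : topologicalType) n
    (f : continuousType X Y) :=
  GRing.isZmodMorphism.Build _ _ (@push R X Y n f) (lift_is_additive _).


Lemma bdryU (R : realType) (X : topologicalType) n k
    (s : sing_simplex R X n.+1) :
  bdry << k *g s >> = k *: bdry_simplex s.
Proof. exact: liftU. Qed.

Lemma pushU (R : realType) (X Y : topologicalType) n
    (f : continuousType X Y) k (s : sing_simplex R X n) :
  push f << k *g s >> = << k *g (comp_cts f s : sing_simplex R Y n) >>.
Proof.
rewrite /push liftU; apply/eqP/freeg_eqP => t.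
by rewrite coeffZ !coeffU mul1r.
Qed.

Lemma bdry_push (R : realType) (X Y : topologicalType) n
    (f : continuousType X Y) (c : chain R X n.+1) :
  bdry (push f c) = push f (bdry c).
Proof.
have pushZ k (d : chain R X n) : push f (k *: d) = k *: push f d.
  by rewrite -[k]intz !scaler_int raddfMz.
rewrite -[c]freeg_sumE !raddf_sum /=; apply: eq_bigr => s _.
rewrite pushU !bdryU pushZ; congr (_ *: _).
rewrite /bdry_simplex raddf_sum /=; apply: eq_bigr => i _.
rewrite pushZ pushU; congr (_ *: << _ >>).
by apply/continuousEP.
Qed.

Definition is_cycle (R : realType) (X : topologicalType) (c : chain R X 1) :
  bool := bdry c == 0.

Lemma is_cycle_zmod_closed (R : realType) (X : topologicalType) :
  zmod_closed (@is_cycle R X).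
Proof.
split=> [|c d]; rewrite -!topredE /= /is_cycle ?raddf0 //.
by move=> /eqP c0 /eqP d0; rewrite raddfB /= c0 d0 subr0.
Qed.
HB.instance Definition _ R X :=
  GRing.isZmodClosed.Build _ (@is_cycle R X) (@is_cycle_zmod_closed R X).

Definition cycle1 (R : realType) (X : topologicalType) :=
  {c : chain R X 1 | is_cycle c}.
Arguments cycle1 : clear implicits.
HB.instance Definition _ R X := SubType.on (cycle1 R X).
HB.instance Definition _ R X := Choice.on (cycle1 R X).
HB.instance Definition _ R X := [SubChoice_isSubZmodule of cycle1 R X by <:].

Definition is_boundary (R : realType) (X : topologicalType)
  (z : cycle1 R X) : bool := `[< exists d : chain R X 2, bdry d = val z >].

Lemma is_boundary_zmod_closed (R : realType) (X : topologicalType) :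
  zmod_closed (@is_boundary R X).
Proof.
split=> [|y z]; rewrite -!topredE /= /is_boundary.
  by apply/asboolP; exists 0; rewrite raddf0.
move=> /asboolP[c yc] /asboolP[d zd]; apply/asboolP; exists (c - d).
by rewrite !raddfB /= yc zd.
Qed.
HB.instance Definition _ R X :=
  GRing.isZmodClosed.Build _ (@is_boundary R X) (@is_boundary_zmod_closed R X).

(* The quotient Z_1 / B_1 of singular homology; the parameter R is only the  *)
(* field in which the standard simplices live.                               *)
Definition H1 (R : realType) (X : topologicalType) : zmodType :=
  Quotient.quot (GRing.ZmodClosed.clone _ (@is_boundary R X) _).
Arguments H1 : clear implicits.

Definition hclass (R : realType) (X : topologicalType) (z : cycle1 R X) :
  H1 R X := \pi z.

Lemma hclass_eq (R : realType) (X : topologicalType) (y z : cycle1 R X) :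
  hclass y = hclass z <-> exists d : chain R X 2, bdry d = val y - val z.
Proof.
have e := @Quotient.idealrBE _ (GRing.ZmodClosed.clone _ (@is_boundary R X) _).
split=> [/eqP|]; last first.
  move=> d; apply/eqP; rewrite /hclass -e -topredE /= /is_boundary raddfB.
  exact/asboolP.
by rewrite /hclass -e -topredE /= /is_boundary raddfB => /asboolP.
Qed.

Lemma push_cycle (R : realType) (X Y : topologicalType)
  (f : continuousType X Y) (z : cycle1 R X) : is_cycle (push f (val z)).
Proof. by rewrite /is_cycle bdry_push (eqP (valP z)) raddf0. Qed.

Definition cycle_map (R : realType) (X Y : topologicalType)
  (f : continuousType X Y) (z : cycle1 R X) : cycle1 R Y :=
  Sub (push f (val z)) (push_cycle f z).

(* The homomorphism induced by f; it does not depend on the representing     *)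
(* cycle chosen by repr, see H1_mapE.                                        *)
Definition H1_map (R : realType) (X Y : topologicalType)
  (f : continuousType X Y) (h : H1 R X) : H1 R Y :=
  hclass (cycle_map f (repr h)).

Lemma H1_mapE (R : realType) (X Y : topologicalType)
    (f : continuousType X Y) (z : cycle1 R X) :
  H1_map f (hclass z) = hclass (cycle_map f z).
Proof.
have /hclass_eq[d e] : hclass (repr (hclass z)) = hclass z by exact: reprK.
by apply/hclass_eq; exists (push f d); rewrite bdry_push e raddfB.
Qed.

(* Closed curves, parametrised by R/Z. *)
Record loop (R : realType) (X : topologicalType) := Loop {
  loop_fun :> continuousType R X;
  loop_periodic : forall t, loop_fun (t + 1) = loop_fun t }.
Arguments loop : clear implicits.

Definition simplex_param (R : realType) (x : std_simplex R 1) : R :=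
  val x 0 ord_max.

Lemma continuous_simplex_param (R : realType) :
  continuous (@simplex_param R).
Proof.
move=> x; apply: (@continuous_comp _ _ _ (@set_val _ (std_simplex R 1))
  (fun y : 'rV[R]_2 => y 0 ord_max)); last exact: coord_continuous.
exact: initial_continuous.
Qed.
HB.instance Definition _ (R : realType) :=
  @isContinuous.Build _ _ (@simplex_param R) (@continuous_simplex_param R).

(* Delta^1 is identified with [0, 1] by its second barycentric coordinate. *)
Definition loop_simplex (R : realType) (X : topologicalType) (l : loop R X) :
  sing_simplex R X 1 := comp_cts l (@simplex_param R).

Lemma loop_cycle (R : realType) (X : topologicalType) (l : loop R X) :
  is_cycle (<< loop_simplex l >> : chain R X 1).
Proof.
rewrite /is_cycle bdryU scale1r /bdry_simplex !big_ord_recl big_ord0 /=.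
rewrite addr0 expr0 expr1 scale1r scaleN1r subr_eq0; apply/eqP.
congr (<< _ >>); apply/continuousEP => x.
rewrite /comp_cts /= /loop_simplex /comp_cts /=.
have -> : simplex_param (face ord0 x) = 0 + 1.
  rewrite /simplex_param /= mxE.
  have -> : ord_max = fintype.lift ord0 ord0 :> 'I_2 by exact: val_inj.
  rewrite liftK add0r; case: x => x /= /set_mem[_].
  by rewrite big_ord1.
rewrite loop_periodic; congr (l _).
rewrite /simplex_param /= mxE.
have -> : fintype.lift ord0 ord0 = ord_max :> 'I_2 by exact: val_inj.
by rewrite unlift_none.
Qed.

Definition loop_class (R : realType) (X : topologicalType) (l : loop R X) :
  H1 R X := hclass (Sub (_ : chain R X 1) (loop_cycle l)).

Lemma set_incl_subproof (X : topologicalType) (A B : set X) :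
  A `<=` B -> forall x : A, val x \in B.
Proof. by move=> AB x; apply/mem_set/AB/set_mem/(valP x). Qed.

Definition set_incl_fun (X : topologicalType) (A B : set X) (AB : A `<=` B)
  (x : A) : B := SigSub (set_incl_subproof AB x).

Lemma continuous_set_incl (X : topologicalType) (A B : set X) (AB : A `<=` B) :
  continuous (set_incl_fun AB).
Proof. by apply: continuous_set_type; exact: initial_continuous. Qed.

Definition set_incl (X : topologicalType) (A B : set X) (AB : A `<=` B) :
  continuousType A B := mkcts (@continuous_set_incl X A B AB).

Definition loop_corestr_fun (R : realType) (X : topologicalType) (A : set X)
  (l : loop R X) (lA : forall t, A (l t)) (t : R) : A :=
  SigSub (mem_set (lA t)).

Lemma continuous_loop_corestr (R : realType) (X : topologicalType) (A : set X)
    (l : loop R X) (lA : forall t, A (l t)) :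
  continuous (loop_corestr_fun lA).
Proof. by apply: continuous_set_type; exact: cts_fun. Qed.

Lemma loop_corestr_periodic (R : realType) (X : topologicalType) (A : set X)
    (l : loop R X) (lA : forall t, A (l t)) t :
  mkcts (@continuous_loop_corestr R X A l lA) (t + 1) =
  mkcts (@continuous_loop_corestr R X A l lA) t.
Proof. by apply: val_inj; rewrite /= loop_periodic. Qed.

Definition loop_corestr (R : realType) (X : topologicalType) (A : set X)
  (l : loop R X) (lA : forall t, A (l t)) : loop R A :=
  Loop (loop_corestr_periodic lA).

(* Homomorphisms H_1(X; Z) -> C^*; C^* is not a zmodType. *)
Record character (R : realType) (X : topologicalType) := Character {
  character_fun :> H1 R X -> R[i];
  character_neq0 : forall h, character_fun h != 0;
  characterD : forall g h,
    character_fun (g + h) = character_fun g * character_fun h }.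
Arguments character : clear implicits.

Definition expi (R : realType) (x : R) : R[i] := (cos x +i* sin x)%C.

Definition arr_compl (I T : Type) (A : I -> set T) : set T :=
  ~` \bigcup_k A k.

Definition arr_singular (I : eqType) (T : Type) (A : I -> set T) : set T :=
  [set x | exists k l, [/\ k != l, A k x & A l x]].

(* l is the positively oriented boundary of a disc t |-> p + t v, |t| <= r,  *)
(* of a projective line, which meets the arrangement only at its centre p, a *)
(* point of A_k.  When the A_j are lines this forces the disc to be          *)
(* transverse to A_k, and all such l have the same class in H_1.             *)
Definition is_meridian (R : realType) (I : Type) (A : I -> set (P2 R[i]))
    (k : I) (l : loop R (arr_compl A)) : Prop :=
  exists (p v : 'rV[R[i]]_3) (r : R),
  [/\ 0 < r,
      exists2 x, has_hcoord x p & A k x,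
      forall (t : R[i]) x j, `|t| <= r%:C%C -> has_hcoord x (p + t *: v) ->
        A j x -> j = k /\ t = 0 &
      forall s : R,
        has_hcoord (val (l s)) (p + (r%:C%C * expi (2 * pi * s)) *: v)].

(* Triangular inner-cyclic arrangements with n + 3 lines.  The lines D_1,    *)
(* D_2, D_3 are indexed by 'I_3, the remaining ones by 'I_n.  By ic_embedded *)
(* the circle passes at most once through each of the points D_i `&` D_j.    *)
Record inner_cyclic (R : realType) (n : nat) := InnerCyclic {
  ic_line : 'I_3 + 'I_n -> set (P2 R[i]);
  ic_lineP : forall k, exists2 a, a != 0 & ic_line k = zero_line a;
  ic_line_inj : injective ic_line;
  ic_generic : ~ exists x, forall i : 'I_3, ic_line (inl i) x;
  ic_double : forall (i j : 'I_3) k x, i != j ->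
    ic_line (inl i) x -> ic_line (inl j) x -> ic_line k x ->
    k = inl i \/ k = inl j;
  ic_circle : loop R (P2 R[i]);
  ic_embedded : forall s t, ic_circle s = ic_circle t ->
    exists z : int, s - t = z%:~R;
  ic_contained : forall t, exists i : 'I_3, ic_line (inl i) (ic_circle t);
  ic_vertices : forall i j : 'I_3, i != j ->
    exists t, ic_line (inl i) (ic_circle t) /\ ic_line (inl j) (ic_circle t);
  ic_singular : forall t, arr_singular ic_line (ic_circle t) ->
    exists i j : 'I_3, [/\ i != j, ic_line (inl i) (ic_circle t) &
      ic_line (inl j) (ic_circle t)];
  ic_cyclic : exists t : 'I_3 -> R,
    [/\ t 0 < t 1, t 1 < t 2, t 2 < t 0 + 1 &
     [/\ forall s, t 0 <= s <= t 1 -> ic_line (inl 0) (ic_circle s),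
         forall s, t 1 <= s <= t 2 -> ic_line (inl 1) (ic_circle s) &
         forall s, t 2 <= s <= t 0 + 1 -> ic_line (inl 2) (ic_circle s)]];
  ic_char : character R (arr_compl ic_line);
  (* ic_mer k is the value of the character on the meridian class of line k *)
  ic_mer : 'I_3 + 'I_n -> R[i];
  ic_merP : forall k (l : loop R (arr_compl ic_line)),
    is_meridian k l -> ic_char (loop_class l) = ic_mer k;
  ic_mer_eq1 : forall k, ic_mer k = 1 <-> exists i : 'I_3, k = inl i;
  ic_prod : forall x, arr_singular ic_line x ->
    (exists i : 'I_3, ic_line (inl i) x) ->
    \prod_(k | x \in ic_line k) ic_mer k = 1 }.

Definition ic_rest (R : realType) n (T : inner_cyclic R n) (j : 'I_n) :
  set (P2 R[i]) := ic_line T (inr j).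

Lemma ic_compl_sub (R : realType) n (T : inner_cyclic R n) :
  arr_compl (ic_line T) `<=` arr_compl (ic_rest T).
Proof. by move=> x nx [j _ Aj]; apply: nx; exists (inr j). Qed.

Lemma ic_circle_compl (R : realType) n (T : inner_cyclic R n) t :
  arr_compl (ic_rest T) (ic_circle T t).
Proof.
case=> j _ Aj; have [i Ai] := ic_contained T t.
have [|i1 [i2 [ne A1 A2]]] := @ic_singular _ _ T t.
  by exists (inl i), (inr j).
by have [] := ic_double ne A1 A2 Aj.
Qed.

(* xt is the character of H_1(CP^2 \ A_gamma^c) induced by that of T. *)
Definition induced_character (R : realType) n (T : inner_cyclic R n)
    (xt : character R (arr_compl (ic_rest T))) : Prop :=
  forall h, xt (H1_map (set_incl (@ic_compl_sub _ _ T)) h) = ic_char T h.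

Definition I_invariant (R : realType) n (T : inner_cyclic R n)
    (xt : character R (arr_compl (ic_rest T))) : R[i] :=
  xt (loop_class (loop_corestr (@ic_circle_compl _ _ T))).

(* (t, m + 1)-configurations; 'I_m.+1 is the additive group Z/(m + 1)Z. *)
Record configuration (R : realType) (t m : nat) := Configuration {
  conf_size : nat;
  conf_V : 'I_t -> P2 R;
  conf_S : 'I_conf_size -> P2 R;
  conf_pl : 'I_t + 'I_conf_size -> 'I_m.+1;
  conf_V_inj : injective conf_V;
  conf_S_inj : injective conf_S;
  conf_SV : forall i j, conf_S j <> conf_V i;
  conf_plV : forall k, conf_pl k = 0 <-> exists i, k = inl i;
  conf_line_V : forall i j k, i != j ->
    ~ line_through (conf_V i) (conf_V j) (conf_S k);
  conf_sum : forall j i,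
    \sum_(k | conf_S k \in line_through (conf_S j) (conf_V i))
      conf_pl (inr k) = 0 }.

Arguments conf_V {R t m}.
Arguments conf_S {R t m}.
Arguments conf_pl {R t m}.

Definition planar (R : realType) t m (C : configuration R t m) : Prop :=
  row_full (\matrix_(i < t) hcoord (conf_V C i)).

Definition is_chamber (R : realType) m (C : configuration R 3 m)
    (ch : set (P2 R)) : Prop :=
  let U := ~` [set x | exists i j : 'I_3, i != j /\
                 line_through (conf_V C i) (conf_V C j) x] in
  exists2 x, U x & ch = connected_component U x.

Definition chamber_weight (R : realType) m (C : configuration R 3 m)
    (ch : set (P2 R)) : 'I_m.+1 :=
  \sum_(k | conf_S C k \in ch) conf_pl C (inr k).

Definition dual_line (R : realType) (P : P2 R) : set (P2 R[i]) :=
  zero_line (map_mx (real_complex R) (hcoord P)).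

Definition associated (R : realType) m (C : configuration R 3 m)
    (T : inner_cyclic R (conf_size C)) : Prop :=
  [/\ forall i, ic_line T (inl i) = dual_line (conf_V C i),
      forall j, ic_line T (inr j) = dual_line (conf_S C j),
      forall i, ic_mer T (inl i) = 1 &
      forall j, ic_mer T (inr j) =
        expi (2 * pi * (conf_pl C (inr j))%:R / m.+1%:R)].

(* Main.v *)
(* A character of H_1(X), X the complement of the lines S_k^*, extends to a
   multiplicative function on 1-chains which is trivial on boundaries, hence
   defines a transport along all paths of X. For real vectors x, y off the lines
   let E(x, y) be the transport along the projected segment from x to iy. The
   "diamond" E(x, y) E(x', y') / (E(x', y) E(x, y')) is the holonomy of the
   polygon x, iy, x', iy'; deforming x to x' one wall at a time, it is the
   product of the meridian values (to a power 1 or -1) of the lines that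
   separate both x from x' and y from y'.

   Let (e_1, e_2, e_3) be dual to the vectors of V_1, V_2, V_3. On the side
   spanned by e_i and e_j, the transport to e_i along rays parallel to the
   imaginary axis is well defined: at a real point the two possible rays agree,
   by the diamond formula and because the meridian values of the lines through a
   real point of the side multiply to 1. It is a potential for the transport
   along the side, so that any arc of the side from e_i to e_j has transport
   1 / E(e_j, e_i). The three arcs of gamma make up a diamond, whose value is the
   inverse of the product of the meridian values of the S_k with
   S_k(e_1), S_k(e_2), S_k(e_3) of the same sign, i.e. in one of the chambers.
   By the line conditions this product does not depend on the chamber. *)
From HB Require Import structures.
Require Import Defs.
From mathcomp Require Import all_boot all_order all_algebra.
From mathcomp Require Import generic_quotient ring_quotient complex freeg.
From mathcomp Require Import all_classical reals topology normedtype derive trigo.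
From mathcomp Require Import ring lra zify.

Set Implicit Arguments.
Unset Strict Implicit.
Unset Printing Implicit Defensive.

Import Order.TTheory GRing.Theory Num.Theory.
Import numFieldNormedType.Exports.
Local Open Scope classical_set_scope.
Local Open Scope ring_scope.
Local Open Scope quotient_scope.

(** * Extension of characters to chains *)

(** Neither the fundamental group nor the homology of the complement is computed, and gamma is
    merely a continuous circle on three complex lines, so no explicit deformation of it is at hand.
    Almost every homotopy below is therefore convex: a triangle of vectors of C^3 whose image under
    each S_k misses 0. The segment from x to iy always qualifies, for S_k takes the values (1 - t)
    S_k(x) + i t S_k(y) on it; two real vectors separated by a wall are joined by no such segment,
    which is why the edges mix real and imaginary endpoints.

    Meridian values are prescribed only in the complement of all the lines, D_1, D_2, D_3 included.
    The disc that realises a wall crossing is therefore shifted by an imaginary vector of the wall,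
    far enough to miss the D_i.

    Signs live on vectors, not on points. In the final diamond e_3, -i e_1, -e_2, i e_2 they are
    chosen so that the edge from -e_2 to i e_2 is projectively constant and the other three match
    the three sides. *)

Section Extension.
Variables (R : realType) (X : topologicalType).
Local Notation C n := (chain R X n).

Definition simplex_face n (i : 'I_n.+2) (s : sing_simplex R X n.+1) :
  sing_simplex R X n := comp_cts s (face i).

Lemma bdry1E (s : sing_simplex R X 1) :
  bdry << s >> = << simplex_face 0 s >> - << simplex_face 1 s >> :> C 0.
Proof.
rewrite bdryU scale1r /bdry_simplex !big_ord_recl big_ord0 addr0.
rewrite expr0 expr1 scale1r scaleN1r; congr (_ - << simplex_face _ s >>).
exact: val_inj.
Qed.

Lemma bdry2E (s : sing_simplex R X 2) :
  bdry << s >> = << simplex_face 0 s >> - << simplex_face 1 s >>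
   + << simplex_face 2 s >> :> C 1.
Proof.
rewrite bdryU scale1r /bdry_simplex !big_ord_recl big_ord0 addr0.
rewrite expr0 expr1 expr2 mulrNN mulr1 !scale1r scaleN1r addrA.
by congr (_ - << simplex_face _ s >> + << simplex_face _ s >>); exact: val_inj.
Qed.

Lemma chain_ind n (P : C n -> Prop) :
  P 0 -> (forall s : sing_simplex R X n, P << s >>) ->
  (forall a b, P a -> P b -> P (a - b)) -> forall c, P c.
Proof.
move=> P0 Ps PB c.
have PD a b : P a -> P b -> P (a + b).
  move=> Pa Pb; rewrite -[b]opprK; apply: (PB _ _ Pa).
  by rewrite -sub0r; exact: PB.
rewrite -[c]freeg_sumE; elim/big_ind: _ => // s _.
case: (coeff s c) => k.
  elim: k => [|k IH]; first by rewrite freegU0.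
  by rewrite -addn1 PoszD -freegUD; exact: PD.
rewrite NegzE; elim: k => [|k IH].
  by rewrite -freegUN -sub0r; exact: PB.
by rewrite -[k.+2]addn1 PoszD opprD -freegUB; exact: PB.
Qed.

Lemma std_simplex0E (x : std_simplex R 0) : val x = const_mx 1.
Proof.
case: x => x /= /set_mem[_]; rewrite big_ord1 => x1.
by apply/rowP => j; rewrite !mxE (ord1 j).
Qed.

(** Both composites are vertices of the 2-simplex, and [lift i (lift k ord0)] is the index of the
    vertex; comparing indices replaces the simplicial identities. *)
Lemma face_face (i j : 'I_3) (k l : 'I_2) :
  fintype.lift i (fintype.lift k ord0) = fintype.lift j (fintype.lift l ord0) ->
  forall s : sing_simplex R X 2,
  simplex_face k (simplex_face i s) = simplex_face l (simplex_face j s).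
Proof.
move=> e s; apply/continuousEP => x; rewrite /simplex_face /comp_cts /=.
congr (s _); apply/val_inj/rowP => h.
have aux (i' : 'I_3) (k' : 'I_2) : val (face i' (face k' x)) 0 h =
    (h == fintype.lift i' (fintype.lift k' ord0))%:R.
  rewrite !mxE; case: unliftP => [h1 ->|->]; last first.
    by rewrite (negbTE (neq_lift _ _)).
  rewrite (inj_eq lift_inj) mxE; case: unliftP => [h2 ->|->]; last first.
    by rewrite (negbTE (neq_lift _ _)).
  by rewrite (inj_eq lift_inj) (ord1 h2) eqxx std_simplex0E mxE.
by rewrite !aux e.
Qed.

Lemma bdry_bdry (d : C 2) : bdry (bdry d) = 0.
Proof.
elim/chain_ind: d => [|s|a b a0 b0]; first by rewrite !raddf0.
  rewrite bdry2E raddfD raddfB /= !bdry1E.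
  rewrite (@face_face 0 1 0 0) 1?(@face_face 0 2 1 0) 1?(@face_face 1 2 1 1).
  - rewrite opprB addrA [X in X + _ - _]addrC addrA subrK subrK subrr //.
  - exact: ord_inj.
  - exact: ord_inj.
  - exact: ord_inj.
by rewrite !raddfB /= a0 b0 subrr.
Qed.

(* A character of H_1 extends to all 1-chains: fix for every 0-simplex s a   *)
(* representative r s of its class in C_0 / B_0 and a chain b s bounding     *)
(* s - r s; then c - b (bdry c) is a cycle, since r kills boundaries.        *)
Definition homologous0 (s : sing_simplex R X 0) : set (sing_simplex R X 0) :=
  [set s' | exists c : C 1, bdry c = << s >> - << s' >>].

Lemma homologous0_eq s s' : homologous0 s s' -> homologous0 s = homologous0 s'.
Proof.
move=> [c bc]; apply/seteqP; split => t [d bd].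
- exists (d - c); rewrite raddfB /= bc bd opprB addrC addrA subrK //.
- by exists (c + d); rewrite raddfD /= bc bd addrA subrK.
Qed.

Definition rep0 (s : sing_simplex R X 0) : sing_simplex R X 0 :=
  xget s (homologous0 s).

Lemma rep0P s : homologous0 s (rep0 s).
Proof.
have : exists t, homologous0 s t by exists s, 0; rewrite raddf0 subrr.
exact: xgetPex.
Qed.

Lemma rep0_eq s s' : homologous0 s s' -> rep0 s = rep0 s'.
Proof.
move=> ss'; rewrite /rep0 (homologous0_eq ss').
(* The defaults [s] and [s'] of the two [xget] differ, but neither is reached: the class contains
   [s']. *)
rewrite /xget; case: pselect => // -[]; exists s'; apply/asboolP; exists 0.
by rewrite raddf0 subrr.
Qed.

Definition bounding0 (s : sing_simplex R X 0) : C 1 :=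
  projT1 (cid (rep0P s)).

Definition cone0 : C 0 -> C 1 := fglift bounding0.
HB.instance Definition _ :=
  GRing.isZmodMorphism.Build _ _ cone0 (lift_is_additive _).

Definition collapse0 : C 0 -> C 0 := fglift (fun s => << rep0 s >>).
HB.instance Definition _ :=
  GRing.isZmodMorphism.Build _ _ collapse0 (lift_is_additive _).

Lemma bdry_cone0 c : bdry (cone0 c) = c - collapse0 c.
Proof.
elim/chain_ind: c => [|s|a b ea eb]; first by rewrite !raddf0 addr0.
  rewrite /cone0 /collapse0 !liftU !scale1r.
  by rewrite /bounding0; case: cid.
by rewrite !raddfB /= ea eb; rewrite !opprD opprK addrACA.
Qed.

Lemma collapse0_bdry (c : C 1) : collapse0 (bdry c) = 0.
Proof.
elim/chain_ind: c => [|s|a b ea eb]; first by rewrite !raddf0.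
  rewrite bdry1E raddfB /= /collapse0 !liftU !scale1r.
  rewrite (@rep0_eq (simplex_face 0 s) (simplex_face 1 s)) ?subrr //.
  by exists << s >>; rewrite bdry1E.
by rewrite !raddfB /= ea eb subrr.
Qed.

Lemma close_up_cycle (c : C 1) : is_cycle (c - cone0 (bdry c)).
Proof. by rewrite /is_cycle raddfB /= bdry_cone0 collapse0_bdry subr0 subrr. Qed.

Definition close_up (c : C 1) : cycle1 R X := Sub _ (close_up_cycle c).

Lemma hclassD (y z : cycle1 R X) : hclass (y + z) = hclass y + hclass z.
Proof. by rewrite /hclass raddfD. Qed.

(** The extension depends on the chosen representatives and bounding chains; [chi] determines it on
    cycles, hence on closed paths. *)
Lemma character_extend (chi : character R X) : exists E : C 1 -> R[i],
  [/\ forall c, E c != 0,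
      forall a b, E (a + b) = E a * E b,
      forall d : C 2, E (bdry d) = 1 &
      forall z : cycle1 R X, E (val z) = chi (hclass z)].
Proof.
have chi0 : chi 0 = 1.
  apply: (mulfI (character_neq0 chi 0)).
  by rewrite -characterD addr0 mulr1.
exists (fun c => chi (hclass (close_up c))); split=> [c|a b|d|z].
- exact: character_neq0.
- rewrite -characterD -hclassD; congr (chi (hclass _)); apply: val_inj.
  by rewrite /= !raddfD /= addrACA.
- have -> : hclass (close_up (bdry d)) = hclass 0; last by rewrite /hclass raddf0.
  by apply/hclass_eq; exists d; rewrite /= bdry_bdry !raddf0 !addr0.
- congr (chi (hclass _)); apply: val_inj.
  by rewrite /= (eqP (valP z)) raddf0 subr0.
Qed.

End Extension.

(** * Continuity of maps built by pointwise operations *)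

Section Continuity.
Variables (T U W : topologicalType) (K : numFieldType) (V : normedModType K).

Lemma cts_cst (y : U) : continuous (fun _ : T => y).
Proof. by move=> t; exact: cvg_cst. Qed.

Lemma cts_id : continuous (fun t : T => t).
Proof. by move=> t; exact: cvg_id. Qed.

Lemma cts_comp (g : U -> W) (f : T -> U) :
  continuous g -> continuous f -> continuous (fun t => g (f t)).
Proof. by move=> cg cf t; apply: continuous_comp; [exact: cf|exact: cg]. Qed.

Lemma cts_pair (f : T -> U) (g : T -> W) :
  continuous f -> continuous g -> continuous (fun t => (f t, g t)).
Proof.
by move=> cf cg t; apply: (@cvg_pair _ _ _ _ (nbhs (f t)) (nbhs (g t)));
  [exact: cf|exact: cg].
Qed.

Lemma cts_add (f g : T -> V) :
  continuous f -> continuous g -> continuous (fun t => f t + g t).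
Proof. by move=> cf cg t; apply: cvgD; [exact: cf|exact: cg]. Qed.

Lemma cts_opp (f : T -> V) : continuous f -> continuous (fun t => - f t).
Proof. by move=> cf t; apply: cvgN; exact: cf. Qed.

Lemma cts_scale (f : T -> K) (g : T -> V) :
  continuous f -> continuous g -> continuous (fun t => f t *: g t).
Proof. by move=> cf cg t; apply: cvgZ; [exact: cf|exact: cg]. Qed.

Lemma cts_mul (f g : T -> K) :
  continuous f -> continuous g -> continuous (fun t => f t * g t).
Proof. by move=> cf cg t; apply: cvgM; [exact: cf|exact: cg]. Qed.

Lemma cts_at_scaleV (f : T -> K) (g : T -> V) t : continuous f -> continuous g ->
  f t != 0 -> {for t, continuous (fun t => (f t)^-1 *: g t)}.
Proof. by move=> cf cg ft; apply: cvgZ (cg t); apply: cvgV => //; exact: cf. Qed.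

Lemma near_neq0 (f : T -> V) t : {for t, continuous f} -> f t != 0 ->
  \forall u \near t, f u != 0.
Proof. by move=> cf ft; exact: cvgr_neq0 cf ft. Qed.

End Continuity.

(** * Multiplicative transport along paths in a subset *)

Section Transport.
Variables (R : realType) (P : topologicalType) (A : set P).

Definition valid (T : topologicalType) (c : T -> P) :=
  continuous c /\ forall t, A (c t).

Definition corestr_fun (T : topologicalType) (c : T -> P) (v : valid c) (t : T)
  : A := SigSub (mem_set (v.2 t)).

Lemma continuous_corestr (T : topologicalType) (c : T -> P) (v : valid c) :
  continuous (corestr_fun v).
Proof. by apply: continuous_set_type; exact: v.1. Qed.

Definition corestr (T : topologicalType) (c : T -> P) (v : valid c) :
  continuousType T A := mkcts (@continuous_corestr T c v).

Definition path_simplex (c : R -> P) (v : valid c) : sing_simplex R A 1 :=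
  comp_cts (corestr v) (@simplex_param R).

Lemma valid_comp (T U : topologicalType) (c : U -> P) (f : T -> U) :
  continuous f -> valid c -> valid (c \o f).
Proof.
move=> cf [cc Ac]; split=> [|t]; last exact: Ac.
by move=> t; apply: continuous_comp; [exact: cf|exact: cc].
Qed.

Lemma continuous_coord_simplex n (j : 'I_n.+1) :
  continuous (fun x : std_simplex R n => val x 0 j).
Proof.
move=> x; apply: (@continuous_comp _ _ _ (@set_val _ (std_simplex R n))
  (fun y : 'rV[R]_n.+1 => y 0 j)); last exact: coord_continuous.
exact: initial_continuous.
Qed.

Definition seg2 (p q : R * R) (t : R) : R * R :=
  (p.1 + t * (q.1 - p.1), p.2 + t * (q.2 - p.2)).

Lemma continuous_affine (a b : R) : continuous (fun t : R => a + t * b).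
Proof.
by apply: cts_add; [exact: cts_cst|apply: cts_mul; [exact: cts_id|exact: cts_cst]].
Qed.

Lemma continuous_seg2 p q : continuous (seg2 p q).
Proof. by apply: cts_pair; exact: continuous_affine. Qed.

Lemma valid_seg2 (H : R * R -> P) p q : valid H -> valid (H \o seg2 p q).
Proof. by apply: valid_comp; exact: continuous_seg2. Qed.

Definition bary3 (a b c : R) (x : std_simplex R 2) : R :=
  val x 0 0 * a + val x 0 1 * b + val x 0 2 * c.

Lemma continuous_bary3 a b c : continuous (bary3 a b c).
Proof.
by do 2?[apply: cts_add]; apply: cts_mul;
  [exact: continuous_coord_simplex|exact: cts_cst|
   exact: continuous_coord_simplex|exact: cts_cst|
   exact: continuous_coord_simplex|exact: cts_cst].
Qed.

Definition bary2 (p0 p1 p2 : R * R) (x : std_simplex R 2) : R * R :=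
  (bary3 p0.1 p1.1 p2.1 x, bary3 p0.2 p1.2 p2.2 x).

Lemma continuous_bary2 p0 p1 p2 : continuous (bary2 p0 p1 p2).
Proof. by apply: cts_pair; exact: continuous_bary3. Qed.

Lemma valid_bary2 (H : R * R -> P) p0 p1 p2 :
  valid H -> valid (H \o bary2 p0 p1 p2).
Proof. by apply: valid_comp; exact: continuous_bary2. Qed.

Lemma bary3_face (a b c : R) (x : std_simplex R 1) :
  let t := simplex_param x in
  [/\ bary3 a b c (face 0 x) = b + t * (c - b),
      bary3 a b c (face 1 x) = a + t * (c - a) &
      bary3 a b c (face 2 x) = a + t * (b - a)].
Proof.
have x0 : val x 0 0 = 1 - simplex_param x.
  have [_ <-] := set_mem (valP x); rewrite big_ord_recr big_ord1 /=.
  rewrite /simplex_param /=.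
  by rewrite (_ : widen_ord _ _ = 0) ?addrK //; exact: ord_inj.
have lft (i j : 'I_3) (k : 'I_2) : j = fintype.lift i k ->
  val (face i x) 0 j = val x 0 k.
  by move=> ->; rewrite mxE liftK.
have lft0 (i : 'I_3) : val (face i x) 0 i = 0.
  by rewrite mxE unlift_none.
have xm : val x 0 1 = simplex_param x.
  by rewrite /simplex_param (_ : ord_max = 1) //; exact: ord_inj.
split; rewrite /bary3 lft0.
- rewrite (lft 0 1 0) ?(lft 0 2 1) ?x0 ?xm; try exact: ord_inj.
  by ring.
- rewrite (lft 1 0 0) ?(lft 1 2 1) ?x0 ?xm; try exact: ord_inj.
  by ring.
- rewrite (lft 2 0 0) ?(lft 2 1 1) ?x0 ?xm; try exact: ord_inj.
  by ring.
Qed.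

Variable chi : character R A.

Definition chain_char : chain R A 1 -> R[i] :=
  projT1 (cid (character_extend chi)).

Lemma chain_charP :
  [/\ forall c, chain_char c != 0,
      forall a b, chain_char (a + b) = chain_char a * chain_char b,
      forall d : chain R A 2, chain_char (bdry d) = 1 &
      forall z : cycle1 R A, chain_char (val z) = chi (hclass z)].
Proof. by rewrite /chain_char; case: cid. Qed.

(* Junk value 1 on paths that are not continuous or leave A. *)
Definition transport (c : R -> P) : R[i] :=
  if pselect (valid c) is left v then chain_char << path_simplex v >> else 1.

Lemma transport_neq0 c : transport c != 0.
Proof.
rewrite /transport; case: pselect => [v|_]; last exact: oner_neq0.
by case: chain_charP.
Qed.

Lemma transportE c (v : valid c) : transport c = chain_char << path_simplex v >>.
Proof.
rewrite /transport; case: pselect => // w; congr (chain_char << _ >>).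
by apply/continuousEP => x; apply: val_inj.
Qed.

Lemma simplex_param01 (x : std_simplex R 1) : 0 <= simplex_param x <= 1.
Proof.
have [x0 x1] := set_mem (valP x); rewrite /simplex_param /= x0 -x1 /=.
by rewrite big_ord_recr big_ord1 /= lerDr x0.
Qed.

Lemma eq_transport (c c' : R -> P) : valid c -> valid c' ->
  (forall t, 0 <= t <= 1 -> c t = c' t) -> transport c = transport c'.
Proof.
move=> v v' e; rewrite !transportE; congr (chain_char << _ >>).
apply/continuousEP => x; apply: val_inj => /=.
by apply: e; exact: simplex_param01.
Qed.

(** [H] on the affine triangle p0 p1 p2 is a singular 2-simplex, and the extended character is
    trivial on its boundary. All later homotopies reduce to this one. *)
Lemma transport_triangle (H : R * R -> P) p0 p1 p2 : valid H ->
  transport (H \o seg2 p0 p1) * transport (H \o seg2 p1 p2) =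
  transport (H \o seg2 p0 p2).
Proof.
move=> vH; rewrite !(transportE (valid_seg2 _ _ vH)).
have [E0 ED Eb _] := chain_charP.
set s : sing_simplex R A 2 := corestr (valid_bary2 p0 p1 p2 vH).
have := Eb << s >>; rewrite bdry2E.
have EN a : chain_char (- a) = (chain_char a)^-1.
  have E00 : chain_char 0 = 1.
    by apply: (mulfI (E0 0)); rewrite -ED addr0 mulr1.
  by apply: (mulIf (E0 a)); rewrite -ED addNr mulVf.
rewrite 2!ED EN.
have fs i p q : (forall x, bary2 p0 p1 p2 (face i x) = seg2 p q (simplex_param x))
    -> simplex_face i s = path_simplex (valid_seg2 p q vH).
  move=> e; apply/continuousEP => x; apply: val_inj => /=.
  by rewrite e.
rewrite (fs 0 p1 p2) => [|x]; last first.
  by rewrite /bary2; have [-> _ _] := bary3_face p0.1 p1.1 p2.1 x;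
     have [-> _ _] := bary3_face p0.2 p1.2 p2.2 x.
rewrite (fs 1 p0 p2) => [|x]; last first.
  by rewrite /bary2; have [_ -> _] := bary3_face p0.1 p1.1 p2.1 x;
     have [_ -> _] := bary3_face p0.2 p1.2 p2.2 x.
rewrite (fs 2 p0 p1) => [|x]; last first.
  by rewrite /bary2; have [_ _ ->] := bary3_face p0.1 p1.1 p2.1 x;
     have [_ _ ->] := bary3_face p0.2 p1.2 p2.2 x.
move=> e; apply: (mulIf (invr_neq0 (E0 << path_simplex (valid_seg2 p0 p2 vH) >>))).
by rewrite mulfV // -[RHS]e; ring.
Qed.

(** A degenerate triangle gives t * t = t for a nonzero t. *)
Lemma transport_cst x : A x -> transport (fun=> x) = 1.
Proof.
move=> Ax; have v : valid (fun _ : R * R => x) by split=> // t; exact: cvg_cst.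
have /= := transport_triangle 0 0 0 v.
have -> : (fun=> x) \o seg2 0 0 = (fun=> x) by [].
by move=> e; apply: (mulfI (transport_neq0 (fun=> x))); rewrite e mulr1.
Qed.

Lemma transport_square (H : R * R -> P) (p0 p1 q0 q1 : R -> P) : valid H ->
  (forall t, H (t, 0) = p0 t) -> (forall t, H (1, t) = p1 t) ->
  (forall t, H (0, t) = q0 t) -> (forall t, H (t, 1) = q1 t) ->
  transport p0 * transport p1 = transport q0 * transport q1.
Proof.
move=> vH hp0 hp1 hq0 hq1.
have <- : H \o seg2 (0, 0) (1, 0) = p0.
  by apply/funext => t; rewrite -hp0 /seg2 /=; congr (H (_, _)); ring.
have <- : H \o seg2 (1, 0) (1, 1) = p1.
  by apply/funext => t; rewrite -hp1 /seg2 /=; congr (H (_, _)); ring.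
have <- : H \o seg2 (0, 0) (0, 1) = q0.
  by apply/funext => t; rewrite -hq0 /seg2 /=; congr (H (_, _)); ring.
have <- : H \o seg2 (0, 1) (1, 1) = q1.
  by apply/funext => t; rewrite -hq1 /seg2 /=; congr (H (_, _)); ring.
by rewrite !transport_triangle.
Qed.

Definition subpath (c : R -> P) (a b : R) : R -> P := fun t => c (a + t * (b - a)).

Lemma subpath01 c : subpath c 0 1 = c.
Proof. by apply/funext => t; rewrite /subpath subr0 mulr1 add0r. Qed.

Lemma valid_subpath c a b : valid c -> valid (subpath c a b).
Proof. by apply: valid_comp; exact: continuous_affine. Qed.

(** This is the triangle rule for collinear vertices, so [a], [b], [d] may come in any order; a
    subpath with b < a runs backwards. *)
Lemma transport_subpath c a b d : valid c ->
  transport (subpath c a b) * transport (subpath c b d) =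
  transport (subpath c a d).
Proof.
move=> vc; have vH : valid (c \o (fst : R * R -> R)).
  by apply: valid_comp vc; move=> t; exact: cvg_fst.
have := transport_triangle (a, 0) (b, 0) (d, 0) vH.
by congr (_ * _ = _).
Qed.

Lemma transport_subpath_id c a : valid c -> transport (subpath c a a) = 1.
Proof.
move=> vc; rewrite (_ : subpath c a a = fun=> c a) ?transport_cst //.
  exact: vc.2.
by apply/funext => t; rewrite /subpath subrr mulr0 addr0.
Qed.

Lemma transport_loop (l : loop R P) (lA : forall t, A (l t)) :
  chi (loop_class (loop_corestr lA)) = transport l.
Proof.
have v : valid l by split=> //; exact: cts_fun.
have [_ _ _ <-] := chain_charP.
rewrite transportE /=; congr (chain_char << _ >>).
by apply/continuousEP => x; apply: val_inj.
Qed.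

End Transport.

(** * The projective plane *)

Section ProjectivePlane.
Variable K : numFieldType.
Local Notation V := 'rV[K]_3.
Implicit Types (a v w : V) (x y : P2 K).

Definition dotp a v : K := \sum_i a 0 i * v 0 i.

Lemma dotpDr a v w : dotp a (v + w) = dotp a v + dotp a w.
Proof. by rewrite -big_split; apply: eq_bigr => i _; rewrite mxE mulrDr. Qed.

Lemma dotpZr a c v : dotp a (c *: v) = c * dotp a v.
Proof. by rewrite big_distrr; apply: eq_bigr => i _; rewrite mxE mulrCA. Qed.

Lemma dotpNr a v : dotp a (- v) = - dotp a v.
Proof. by rewrite -scaleN1r dotpZr mulN1r. Qed.

Lemma dotpBr a v w : dotp a (v - w) = dotp a v - dotp a w.
Proof. by rewrite dotpDr dotpNr. Qed.

Lemma dotp0r a : dotp a 0 = 0.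
Proof. by rewrite -(scale0r 0) dotpZr mul0r. Qed.

Lemma dotpC a v : dotp a v = dotp v a.
Proof. by apply: eq_bigr => i _; rewrite mulrC. Qed.

Lemma continuous_dotp a : continuous (dotp a).
Proof.
rewrite (_ : dotp a = fun v => a 0 0 * v 0 0 + (a 0 1 * v 0 1 + a 0 2 * v 0 2)).
  apply: cts_add; last apply: cts_add; apply: cts_mul;
  try exact: cts_cst; exact: coord_continuous.
apply/funext => v; rewrite /dotp !big_ord_recl big_ord0 addr0.
by congr (_ + (_ + _)); congr (a 0 _ * v 0 _); exact: ord_inj.
Qed.

Lemma mem_nonzero3 v : v != 0 -> v \in nonzero3 K.
Proof. by move=> v0; apply/mem_set. Qed.

Lemma default_rep_subproof : (const_mx 1 : V) \in nonzero3 K.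
Proof.
apply/mem_nonzero3/eqP => /matrixP/(_ 0 0); rewrite !mxE.
by apply/eqP; exact: oner_neq0.
Qed.

(* Junk value (1 : 1 : 1) at v = 0. *)
Definition toP v : P2 K :=
  (\pi_({eq_quot (@proportional K)}) (insubd (SigSub default_rep_subproof) v)).

Lemma hcoord_neq0 x : hcoord x != 0.
Proof. exact: (set_mem (valP (repr (x : {eq_quot (@proportional K)})))). Qed.

Lemma val_insubd_nz v : v != 0 ->
  val (insubd (SigSub default_rep_subproof : nonzero3 K) v) = v.
Proof. by move=> v0; rewrite insubdK //; exact/mem_set. Qed.

Lemma hcoord_toP v : v != 0 -> exists2 c, c != 0 & hcoord (toP v) = c *: v.
Proof.
move=> v0; rewrite /hcoord /toP.
case: piP => u /eqmodP /asboolP[c c0]; rewrite val_insubd_nz // => e.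
by exists c^-1; rewrite ?invr_eq0 // e scalerA mulVf // scale1r.
Qed.

Lemma toPZ c v : c != 0 -> toP (c *: v) = toP v.
Proof.
move=> c0; have [->|v0] := eqVneq v 0; first by rewrite scaler0.
apply/eqmodP/asboolP; exists c => //.
by rewrite !val_insubd_nz // scaler_eq0 negb_or c0.
Qed.

Lemma hcoordK x : toP (hcoord x) = x.
Proof.
rewrite /toP -[RHS]reprK; congr (\pi_ _ _); apply: val_inj.
by rewrite val_insubd_nz ?hcoord_neq0.
Qed.

Lemma has_hcoordP x v : has_hcoord x v <-> v != 0 /\ x = toP v.
Proof.
split=> [[c c0 ->]|[v0 ->]].
  by rewrite toPZ // hcoordK scaler_eq0 negb_or c0 hcoord_neq0.
have [c c0 e] := hcoord_toP v0.
by exists c^-1; rewrite ?invr_eq0 // e scalerA mulVf // scale1r.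
Qed.

Lemma dotp_hcoord_toP a v : v != 0 ->
  (dotp a (hcoord (toP v)) == 0) = (dotp a v == 0).
Proof.
by case/hcoord_toP=> c c0 ->; rewrite dotpZr mulf_eq0 (negbTE c0).
Qed.

Lemma continuous_toP (T : topologicalType) (f : T -> V) :
  continuous f -> (forall t, f t != 0) -> continuous (toP \o f).
Proof.
move=> cf f0.
pose g t : nonzero3 K := SigSub (mem_nonzero3 (f0 t)).
have cg : continuous g by apply: continuous_set_type; exact: cf.
rewrite (_ : toP \o f = (\pi_(P2 K) : nonzero3 K -> P2 K) \o g); last first.
  apply/funext => t /=; rewrite /toP; congr (\pi_ _ _); apply: val_inj.
  by rewrite val_insubd_nz.
by apply: cts_comp cg; exact: pi_continuous.
Qed.

(** [hcoord] is an arbitrary choice of representatives; this is the representative with a(v) = 1,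
    which varies continuously off the line a = 0. On that line it is the junk value 0. *)
Definition affine_lift a x : V := (dotp a (hcoord x))^-1 *: hcoord x.

Lemma affine_liftK a x : dotp a (hcoord x) != 0 -> toP (affine_lift a x) = x.
Proof. by move=> h; rewrite toPZ ?invr_eq0 // hcoordK. Qed.

Lemma affine_lift_toP a v : v != 0 ->
  affine_lift a (toP v) = (dotp a v)^-1 *: v.
Proof.
move=> v0; rewrite /affine_lift; have [c c0 ->] := hcoord_toP v0.
by rewrite dotpZr scalerA invfM mulrAC mulVf // mul1r.
Qed.

(** In the quotient topology it suffices to look at nonzero vectors w, where the map is w / a(w). *)
Lemma continuous_affine_lift a x : dotp a (hcoord x) != 0 ->
  {for x, continuous (affine_lift a)}.
Proof.
move=> ax N; rewrite nbhsE => -[N' [oN' N'x] NN'].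
pose O := [set y : P2 K | dotp a (hcoord y) != 0 /\ N' (affine_lift a y)].
have : nbhs x O.
  apply: open_nbhs_nbhs; split; last by split.
  rewrite /open /= /quotient_open.
  rewrite openE => u /= [au Nu].
  have u0 : val u != 0 by exact: (set_mem (valP u)).
  have piE (w : nonzero3 K) : (\pi_(P2 K) w) = toP (val w).
    rewrite /toP; congr (\pi_ _ _); apply: val_inj.
    by rewrite val_insubd_nz //; exact: (set_mem (valP w)).
  move: au Nu; rewrite piE dotp_hcoord_toP // affine_lift_toP // => au Nu.
  have cv : continuous (fun w : nonzero3 K => dotp a (val w)).
    apply: cts_comp; first exact: continuous_dotp.
    exact: initial_continuous.
  have h1 : \forall w \near u, dotp a (val w) != 0 by apply: near_neq0 (cv u) _.
  have h2 : \forall w \near u, N' ((dotp a (val w))^-1 *: val w).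
    have := @cts_at_scaleV _ _ _ _ (val : nonzero3 K -> V) u cv.
    apply; [exact: initial_continuous|exact: au|exact: open_nbhs_nbhs].
  apply: filterS2 h1 h2 => w w1 w2 /=.
  have w0 : val w != 0 by exact: (set_mem (valP w)).
  by rewrite /O /= piE dotp_hcoord_toP // affine_lift_toP.
by apply: filterS => y [_ /NN'].
Qed.

End ProjectivePlane.

Arguments toP {K} v.

(** The norms of [R] and of [R[i]] take values in different fields; [h] translates the tolerances
    from one to the other. *)
Lemma modulus_continuous (K L : numFieldType) (V : normedModType K)
    (W : normedModType L) (f : V -> W) (h : L -> K) :
  (forall e, 0 < e -> 0 < h e) ->
  (forall e x t, 0 < e -> `|x - t| < h e -> `|f x - f t| < e) -> continuous f.
Proof.
move=> h0 hf x; apply/cvgrPdist_lt => e e0.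
have /cvgrPdist_lt/(_ _ (h0 _ e0)) := @cts_id V x.
by apply: filterS => t; exact: hf.
Qed.

(** * Real functionals on complex vectors *)

Section ComplexPlane.
Variable R : realType.
Local Notation C :=
  (Num.NumField.sort (complex_complex__canonical__Num_NumField R)).
Local Notation Re := (@complex.Re R).
Local Notation Im := (@complex.Im R).
Local Notation V := 'rV[C]_3.
Local Notation "x %:C" := (real_complex R x).

Lemma ReD (z w : C) : Re (z + w) = Re z + Re w.
Proof. by case: z w => [a b] [c d]. Qed.

Lemma ImD (z w : C) : Im (z + w) = Im z + Im w.
Proof. by case: z w => [a b] [c d]. Qed.

Lemma Re_realM (r : R) (z : C) : Re (r%:C * z) = r * Re z.
Proof. by case: z => a b /=; rewrite mul0r subr0. Qed.

Lemma Im_realM (r : R) (z : C) : Im (r%:C * z) = r * Im z.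
Proof. by case: z => a b /=; rewrite mul0r addr0. Qed.

Lemma continuous_real_complex : continuous (fun x : R => x%:C : C).
Proof.
apply: (@modulus_continuous _ _ _ _ _ (fun e : C => Re e)) => [e|e x t].
  by rewrite ltcE => /andP[].
rewrite ltcE => /andP[/eqP e0 _] xt.
rewrite -rmorphB normc_def /= expr0n addr0 sqrtr_sqr ltcE /= e0 eqxx.
exact: xt.
Qed.

Lemma cts_real_complex (T : topologicalType) (f : T -> R) :
  continuous f -> continuous (fun t => (f t)%:C : C).
Proof. exact: cts_comp continuous_real_complex. Qed.

Lemma expiE (x : R) : expi x = (cos x)%:C + 'i%C * (sin x)%:C.
Proof. by rewrite /expi; simpc. Qed.

Lemma cts_expi (T : topologicalType) (f : T -> R) :
  continuous f -> continuous (fun t => expi (f t) : C).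
Proof.
move=> cf; rewrite (_ : (fun t => expi (f t)) =
  (fun t => (cos (f t))%:C + 'i%C * (sin (f t))%:C)); last first.
  by apply/funext => t; rewrite expiE.
apply: cts_add.
  by apply: cts_real_complex; apply: cts_comp cf; exact: continuous_cos.
apply: cts_mul; first exact: cts_cst.
by apply: cts_real_complex; apply: cts_comp cf; exact: continuous_sin.
Qed.

Lemma normRe (z : C) : (`|Re z|)%:C <= `|z|.
Proof.
rewrite normc_def lecR -sqrtr_sqr ler_wsqrtr // lerDl sqr_ge0 //.
Qed.

Lemma normIm (z : C) : (`|Im z|)%:C <= `|z|.
Proof.
rewrite normc_def lecR -sqrtr_sqr ler_wsqrtr // lerDr sqr_ge0 //.
Qed.

Lemma continuous_Re : continuous (fun z : C => Re z).
Proof.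
apply: (@modulus_continuous _ _ _ _ _ (fun e : R => e%:C : C)) => [e e0|e x t _ xt].
  by rewrite ltcR.
rewrite -ltcR; apply: le_lt_trans xt.
by rewrite (_ : Re x - Re t = Re (x - t)) ?normRe //; case: (x) (t) => ? ? [].
Qed.

Lemma continuous_Im : continuous (fun z : C => Im z).
Proof.
apply: (@modulus_continuous _ _ _ _ _ (fun e : R => e%:C : C)) => [e e0|e x t _ xt].
  by rewrite ltcR.
rewrite -ltcR; apply: le_lt_trans xt.
by rewrite (_ : Im x - Im t = Im (x - t)) ?normIm //; case: (x) (t) => ? ? [].
Qed.

Definition cx (a : 'rV[R]_3) : V := map_mx (real_complex R) a.

Lemma dotp_cx (a x : 'rV[R]_3) : dotp (cx a) (cx x) = (dotp a x)%:C.
Proof.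
by rewrite /dotp rmorph_sum; apply: eq_bigr => i _; rewrite !mxE rmorphM.
Qed.

Definition rdot (a : 'rV[R]_3) (v : V) : C := dotp (cx a) v.

Lemma rdotD a v w : rdot a (v + w) = rdot a v + rdot a w.
Proof. exact: dotpDr. Qed.
Lemma rdotZ a c v : rdot a (c *: v) = c * rdot a v.
Proof. exact: dotpZr. Qed.
Lemma rdot_cx a x : rdot a (cx x) = (dotp a x)%:C.
Proof. exact: dotp_cx. Qed.

Lemma rdot_nz a v : rdot a v != 0 -> v != 0.
Proof. by apply: contra_neq => ->; exact: dotp0r. Qed.

(** The retraction of the line onto [0, 1]: [valid] constrains a path at all real parameters, also
    outside the unit interval. *)
Definition clamp (t : R) : R := (1 + `|t| - `|t - 1|) / 2.

Lemma clamp_id t : 0 <= t <= 1 -> clamp t = t.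
Proof.
case/andP=> t0 t1; rewrite /clamp ger0_norm // ler0_norm ?subr_le0 //; lra.
Qed.

Lemma clamp01 t : 0 <= clamp t <= 1.
Proof.
rewrite /clamp; case: (ler0P t) => t0; case: (ler0P (t - 1)) => t1; lra.
Qed.

Lemma continuous_clamp : continuous clamp.
Proof.
apply: cts_mul; last exact: cts_cst.
apply: cts_add.
  by apply: cts_add; [exact: cts_cst|exact: norm_continuous].
apply: cts_opp; apply: (@cts_comp _ _ _ (fun t : R => `|t|)).
  exact: norm_continuous.
by apply: cts_add; [exact: cts_id|exact: cts_cst].
Qed.

Lemma cts_clamp (T : topologicalType) (f : T -> R) :
  continuous f -> continuous (fun t => clamp (f t)).
Proof. exact: cts_comp continuous_clamp. Qed.

End ComplexPlane.

(** * Transport along projected segments *)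

Section Arrangement.
Variables (R : realType) (n : nat) (s : 'I_n -> 'rV[R]_3).
Local Notation CK := (complex_complex__canonical__Num_NumField R).
Local Notation C := (Num.NumField.sort CK).
Local Notation V := 'rV[C]_3.
Local Notation "x %:C" := (real_complex R x : C).
Variable A : set (P2 CK).
Hypothesis hA : forall x, A x <-> forall k, rdot (s k) (hcoord x) != 0.
Variable chi : character R A.

Definition good (v : V) := v != 0 /\ forall k, rdot (s k) v != 0.

Lemma good_toP v : good v -> A (toP v).
Proof. by move=> [v0 sv]; apply/hA => k; rewrite /rdot dotp_hcoord_toP //; exact: sv. Qed.

Lemma toP_good x : A x -> good (hcoord x).
Proof. by move=> /hA Ax; split=> //; exact: hcoord_neq0. Qed.

Lemma goodZ c v : c != 0 -> good v -> good (c *: v).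
Proof.
move=> c0 [v0 sv]; split; first by rewrite scaler_eq0 negb_or c0.
by move=> k; rewrite rdotZ mulf_neq0.
Qed.

Lemma valid_toP (T : topologicalType) (f : T -> V) :
  continuous f -> (forall t, good (f t)) -> valid A (toP \o f).
Proof.
move=> cf gf; split; last by move=> t; exact: good_toP.
by apply: continuous_toP => // t; case: (gf t).
Qed.

Definition segC (a b : V) (t : R) : V := a + (clamp t)%:C *: (b - a).

Definition tseg (a b : V) : C := transport chi (toP \o segC a b).

Lemma tseg_neq0 a b : tseg a b != 0.
Proof. exact: transport_neq0. Qed.

Lemma tseg_scale c a b : c != 0 -> tseg (c *: a) (c *: b) = tseg a b.
Proof.
move=> c0; congr (transport _ _); apply/funext => t /=.
rewrite -(toPZ (segC a b t) c0); congr toP.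
by rewrite /segC -scalerBr [RHS]scalerDr !scalerA mulrC.
Qed.

Lemma tseg_ray c a : good a ->
  (forall t : R, 0 <= t <= 1 -> 1 + t%:C * (c - 1) != 0) -> tseg a (c *: a) = 1.
Proof.
move=> ga c0; rewrite /tseg (_ : _ \o _ = fun=> toP a).
  by apply: transport_cst; exact: good_toP.
apply/funext => t /=; rewrite -(toPZ a (c0 (clamp t) (clamp01 t))).
by rewrite /segC scalerDl scale1r -scalerA scalerBl scale1r.
Qed.

Lemma tseg_id a : good a -> tseg a a = 1.
Proof.
move=> ga; rewrite -{2}(scale1r a) tseg_ray // => t _.
by rewrite subrr mulr0 addr0 oner_neq0.
Qed.

Lemma cts_row_scale (T : topologicalType) (f : T -> R) (g : T -> V) :
  continuous f -> continuous g -> continuous (fun t => (f t)%:C *: g t).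
Proof. by move=> cf cg; apply: cts_scale cg; exact: cts_real_complex. Qed.

(** The straight-line homotopy from a lifted path to its chord fixes both endpoints, so two sides of
    the square are constant. *)
Lemma tseg_path (p : R -> P2 CK) (c : R -> V) : valid A p -> continuous c ->
  (forall t, 0 <= t <= 1 -> p t = toP (c t)) ->
  (forall u t : R, 0 <= u <= 1 -> 0 <= t <= 1 ->
     good ((1 - u)%:C *: c t + u%:C *: (c 0 + t%:C *: (c 1 - c 0)))) ->
  transport chi p = tseg (c 0) (c 1).
Proof.
move=> vp cc pc gc.
pose H (q : R * R) : V := (1 - clamp q.1)%:C *: c (clamp q.2)
  + (clamp q.1)%:C *: (c 0 + (clamp q.2)%:C *: (c 1 - c 0)).
have c1 : continuous (fun q : R * R => q.1) by move=> q; exact: cvg_fst.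
have c2 : continuous (fun q : R * R => q.2) by move=> q; exact: cvg_snd.
have vH : valid A (toP \o H).
  apply: valid_toP; last by move=> q; apply: gc; exact: clamp01.
  apply: cts_add; apply: cts_row_scale.
  - apply: (@cts_add _ R R^o); first exact: cts_cst.
    by apply: (@cts_opp _ R R^o); exact: cts_clamp.
  - by apply: cts_comp cc _; exact: cts_clamp.
  - exact: cts_clamp.
  - apply: cts_add; first exact: cts_cst.
    by apply: cts_row_scale; [exact: cts_clamp|exact: cts_cst].
have HE u t : H (u, t) = (1 - clamp u)%:C *: c (clamp t)
  + (clamp u)%:C *: (c 0 + (clamp t)%:C *: (c 1 - c 0)) by [].
clearbody H.
have cl0 : clamp (0 : R) = 0 by rewrite clamp_id // lexx ler01.
have cl1 : clamp (1 : R) = 1 by rewrite clamp_id // lexx ler01.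
have Hc : H (0, 0) = c 0.
  by rewrite HE cl0 scale0r subr0 scale1r addr0.
have Hd : H (0, 1) = c 1.
  by rewrite HE cl0 cl1 scale0r subr0 scale1r addr0.
have := @transport_square _ _ _ chi _ (fun=> toP (c 0)) (toP \o segC (c 0) (c 1))
  (fun t => toP (H (0, t))) (fun=> toP (c 1)) vH.
rewrite !transport_cst ?mul1r ?mulr1; last 2 first.
- by rewrite -Hd; exact: (vH.2 (0, 1)).
- by rewrite -Hc; exact: (vH.2 (0, 0)).
move=> e; rewrite /tseg {}e => [|t|t|t|t].
- apply: eq_transport; first exact: vp.
    apply: (@valid_comp _ _ _ _ _ (fun t => (0, t)) _ vH).
    by apply: cts_pair; [exact: cts_cst|exact: cts_id].
  move=> t t01; rewrite pc // HE cl0 subr0 scale1r scale0r addr0.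
  by rewrite clamp_id.
- rewrite /= HE; congr toP; rewrite cl0 scale0r addr0.
  by apply/matrixP => i j; rewrite !mxE rmorphB rmorph1; ring.
- by rewrite /segC /comp HE cl1 subrr scale0r add0r scale1r.
- by [].
- rewrite /comp HE cl1 scale1r [c 0 + _]addrC subrK; congr toP.
  by apply/matrixP => i j; rewrite !mxE rmorphB rmorph1; ring.
Qed.

Definition hull3 (a b c : V) := forall x y z : R, 0 <= x -> 0 <= y -> 0 <= z ->
  x + y + z = 1 -> good (x%:C *: a + y%:C *: b + z%:C *: c).

Lemma tseg_triangle a b c : hull3 a b c -> tseg a b * tseg b c = tseg a c.
Proof.
move=> hg.
(* The side [q.1 = 0] of the square is collapsed to the vertex [a]. *)
pose H (q : R * R) : V := a + (clamp q.1)%:C *: ((b - a)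
  + (clamp q.2)%:C *: (c - b)).
have c1 : continuous (fun q : R * R => q.1) by move=> q; exact: cvg_fst.
have c2 : continuous (fun q : R * R => q.2) by move=> q; exact: cvg_snd.
have vH : valid A (toP \o H).
  apply: valid_toP.
    apply: cts_add; first exact: cts_cst.
    apply: cts_row_scale; first exact: cts_clamp.
    apply: cts_add; first exact: cts_cst.
    by apply: cts_row_scale; [exact: cts_clamp|exact: cts_cst].
  move=> [u t]; rewrite /H /=.
  have /andP[u0 u1] := clamp01 u; have /andP[t0 t1] := clamp01 t.
  move: (clamp u) (clamp t) u0 u1 t0 t1 => u' t' u0 u1 t0 t1.
  rewrite (_ : a + _ = (1 - u')%:C *: a + (u' * (1 - t'))%:C *: b +
    (u' * t')%:C *: c).
    by apply: hg; rewrite ?mulr_ge0 ?subr_ge0 //; ring.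
  apply/rowP => j; rewrite !mxE !rmorphM !rmorphB rmorph1; ring.
have HE u t : H (u, t) = a + (clamp u)%:C *: ((b - a)
  + (clamp t)%:C *: (c - b)) by [].
clearbody H.
have cl0 : clamp (0 : R) = 0 by rewrite clamp_id // lexx ler01.
have cl1 : clamp (1 : R) = 1 by rewrite clamp_id // lexx ler01.
have H0 : H (0, 0) = a by rewrite HE cl0 scale0r addr0.
have := @transport_square _ _ _ chi _ (toP \o segC a b) (toP \o segC b c)
  (fun=> toP a) (toP \o segC a c) vH.
rewrite (@transport_cst _ _ _ chi (toP a)) ?mul1r; last first.
  by rewrite -H0; exact: (vH.2 (0, 0)).
apply=> t; rewrite /comp HE /segC ?cl0 ?cl1.
- by rewrite scale0r addr0.
- by rewrite scale1r addrA [a + _]addrC subrK.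
- by rewrite scale0r addr0.
- by rewrite scale1r [b - a + _]addrC addrA subrK.
Qed.

End Arrangement.

(** * Triangles of vectors that avoid the walls *)

Section Diamonds.
Variables (R : realType) (n : nat) (s : 'I_n -> 'rV[R]_3).
Local Notation C :=
  (Num.NumField.sort (complex_complex__canonical__Num_NumField R)).
Local Notation Re := (@complex.Re R).
Local Notation Im := (@complex.Im R).
Local Notation V := 'rV[C]_3.
Local Notation "x %:C" := (real_complex R x : C).
Local Notation I := ('i%C : C).
Implicit Types (x y a g : 'rV[R]_3) (u v w c : V) (k l : 'I_n).

(** The points lie in a closed half plane and, by the positive sums, at most one is on its edge. A
    vanishing convex combination could only carry weight on the edge, so it would be a vertex, which
    is nonzero. *)
Lemma convex_half_plane (h z0 z1 z2 : C) :
  z0 != 0 -> z1 != 0 -> z2 != 0 ->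
  0 <= Re (h * z0) -> 0 <= Re (h * z1) -> 0 <= Re (h * z2) ->
  0 < Re (h * z0) + Re (h * z1) -> 0 < Re (h * z1) + Re (h * z2) ->
  0 < Re (h * z0) + Re (h * z2) ->
  forall x y z : R, 0 <= x -> 0 <= y -> 0 <= z -> x + y + z = 1 ->
  x%:C * z0 + y%:C * z1 + z%:C * z2 != 0.
Proof.
move=> n0 n1 n2 p0 p1 p2 p01 p12 p02 x y z x0 y0 z0' xyz.
apply/eqP => e.
have : Re (h * (x%:C * z0 + y%:C * z1 + z%:C * z2)) = 0 by rewrite e mulr0.
rewrite !mulrDr !ReD ![h * (_ * _)]mulrCA !Re_realM.
move: e p0 p1 p2 p01 p12 p02.
set r0 := Re _; set r1 := Re (h * z1); set r2 := Re (h * z2).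
move=> e p0 p1 p2 p01 p12 p02 /eqP.
rewrite paddr_eq0 ?addr_ge0 ?mulr_ge0 //.
rewrite paddr_eq0 ?mulr_ge0 // !mulf_eq0 => /andP[/andP[h0 h1] h2].
have [ex|ex] := eqVneq x 0; have [ey|ey] := eqVneq y 0;
  have [ez|ez] := eqVneq z 0; move: h0 h1 h2;
  rewrite ?(negbTE ex) ?(negbTE ey) ?(negbTE ez) /=.
- by move: xyz; rewrite ex ey ez => /eqP; rewrite !addr0 eq_sym oner_eq0.
- have ez1 : z = 1 by lra.
  by move: e n2; rewrite ex ey ez1 rmorph0 rmorph1 !mul0r !add0r mul1r => ->;
     rewrite eqxx.
- have ey1 : y = 1 by lra.
  by move: e n1; rewrite ex ez ey1 rmorph0 rmorph1 !mul0r !add0r addr0 mul1r => ->;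
     rewrite eqxx.
- by move=> _ /eqP e1 /eqP e2; lra.
- have ex1 : x = 1 by lra.
  by move: e n0; rewrite ey ez ex1 rmorph0 rmorph1 !mul0r !addr0 mul1r => ->;
     rewrite eqxx.
- by move=> /eqP e1 _ /eqP e2; lra.
- by move=> /eqP e1 /eqP e2 _; lra.
- by move=> /eqP e1 /eqP e2 _; lra.
Qed.

Definition avoids g u v w := forall x y z : R, 0 <= x -> 0 <= y -> 0 <= z ->
  x + y + z = 1 -> x%:C * rdot g u + y%:C * rdot g v + z%:C * rdot g w != 0.

Lemma hull3_avoids u v w : (forall k, avoids (s k) u v w) ->
  (exists g, avoids g u v w) -> hull3 s u v w.
Proof.
move=> hk [g hg] x y z x0 y0 z0 e; split; last first.
  by move=> k; rewrite !rdotD !rdotZ; exact: hk.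
by apply: (@rdot_nz _ g); rewrite !rdotD !rdotZ; exact: hg.
Qed.

(* The functionals in G (which includes all the s l, l != k) do not change   *)
(* sign in the moves below.  The extra one, a in G, serves to keep the       *)
(* vectors nonzero when the arrangement is empty.                            *)
Section OneWall.
Variables (k : 'I_n) (G : set 'rV[R]_3).
Hypothesis Gs : forall l, l != k -> G (s l).
Hypothesis G0 : G !=set0.

Lemma hull3_wall u v w : avoids (s k) u v w -> (forall g, G g -> avoids g u v w) ->
  hull3 s u v w.
Proof.
move=> hk hG; apply: hull3_avoids => [l|]; last first.
  by case: G0 => g Gg; exists g; exact: hG.
by have [->//|lk] := eqVneq l k; apply/hG/Gs.
Qed.

Lemma Re_neq0 (z : C) (r : R) : 0 < r * Re z -> z != 0.
Proof. by apply: contraTneq => ->; rewrite mulr0 ltxx. Qed.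

Lemma Im_neq0 (z : C) (r : R) : 0 < r * Im z -> z != 0.
Proof. by apply: contraTneq => ->; rewrite mulr0 ltxx. Qed.

Lemma real_complex_neq0 (r : R) : r != 0 -> r%:C != 0.
Proof. by move=> r0; rewrite eq_complex negb_and r0. Qed.

Lemma Re_NiM (r : R) (z : C) : Re (- I * r%:C * z) = r * Im z.
Proof. by case: z => a b /=; ring. Qed.

Lemma rdot_icx g y : rdot g (I *: cx y) = I * (dotp g y)%:C.
Proof. by rewrite rdotZ rdot_cx. Qed.

Lemma avoids_cone g x y c :
  0 < dotp g x * Re (rdot g c) -> dotp g y != 0 ->
  avoids g (cx x) c (I *: cx y).
Proof.
move=> gxc gy; rewrite /avoids rdot_cx rdot_icx.
have gx : dotp g x != 0 by apply: contraTneq gxc => ->; rewrite mul0r ltxx.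
have gx2 : 0 < dotp g x * dotp g x by rewrite -expr2 exprn_even_gt0.
have Re0 : Re (I * (dotp g y)%:C) = 0 by rewrite /=; ring.
apply: (@convex_half_plane (dotp g x)%:C); rewrite ?Re_realM ?Re0 /=; try lra.
- exact: real_complex_neq0.
- exact: Re_neq0 gxc.
- by rewrite mulf_neq0 ?neq0Ci ?real_complex_neq0.
Qed.

(** On the wall [k], the images of [c] and iy are on the same imaginary half axis, and a half plane
    bounded by the real axis serves. On the other functionals, [x] and [c] are on the same side of
    the imaginary axis. *)
Lemma hull3_cone x y c :
  (forall g, G g -> 0 < dotp g x * Re (rdot g c) /\ dotp g y != 0) ->
  dotp (s k) x != 0 -> Re (rdot (s k) c) = 0 ->
  0 < dotp (s k) y * Im (rdot (s k) c) -> hull3 s (cx x) c (I *: cx y).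
Proof.
move=> hG kx kc ky.
have ky0 : dotp (s k) y != 0 by apply: contraTneq ky => ->; rewrite mul0r ltxx.
have y2 : 0 < dotp (s k) y * dotp (s k) y by rewrite -expr2 exprn_even_gt0.
apply: hull3_wall => [|g /hG[]]; last exact: avoids_cone.
rewrite /avoids rdot_cx rdot_icx.
apply: (@convex_half_plane (- I * (dotp (s k) y)%:C)); rewrite ?Re_NiM /=; try lra.
- exact: real_complex_neq0.
- exact: Im_neq0 ky.
- by rewrite mulf_neq0 ?neq0Ci ?real_complex_neq0.
Qed.

Lemma hull3_half (h : C) u v w :
  (forall g, G g -> exists r : R, [/\ 0 < r * Re (rdot g u),
     0 < r * Re (rdot g v) & 0 < r * Re (rdot g w)]) ->
  0 < Re (h * rdot (s k) u) -> 0 < Re (h * rdot (s k) v) ->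
  0 < Re (h * rdot (s k) w) -> hull3 s u v w.
Proof.
have nz (z : C) : 0 < Re (h * z) -> z != 0.
  by apply: contraTneq => ->; rewrite mulr0 ltxx.
move=> hG ku kv kw.
apply: hull3_wall => [|g /hG[r [gu gv gw]]].
  by apply: (@convex_half_plane h); rewrite ?nz //; lra.
apply: (@convex_half_plane r%:C); rewrite ?Re_realM; try lra.
- exact: Re_neq0 gu.
- exact: Re_neq0 gv.
- exact: Re_neq0 gw.
Qed.

Lemma hull3_quadrant x c0 c1 :
  (forall g, G g -> 0 < dotp g x * Re (rdot g c0) /\
     0 < dotp g x * Re (rdot g c1)) ->
  0 < dotp (s k) x * Re (rdot (s k) c0) -> Re (rdot (s k) c1) = 0 ->
  rdot (s k) c1 != 0 -> hull3 s (cx x) c0 c1.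
Proof.
have gx2 g r : 0 < dotp g x * r -> 0 < dotp g x * dotp g x.
  move=> gxr; rewrite -expr2 exprn_even_gt0 //=.
  by apply: contraTneq gxr => ->; rewrite mul0r ltxx.
move=> hG k0 k1 kn.
have kx2 := gx2 _ _ k0.
apply: hull3_wall => [|g /hG[g0 g1]]; rewrite /avoids rdot_cx.
  apply: (@convex_half_plane (dotp (s k) x)%:C); rewrite ?Re_realM /= ?k1; try lra.
  - by apply: (@Re_neq0 _ (dotp (s k) x)).
  - exact: Re_neq0 k0.
  - exact: kn.
have gxx := gx2 _ _ g0.
apply: (@convex_half_plane (dotp g x)%:C); rewrite ?Re_realM /=; try lra.
- by apply: (@Re_neq0 _ (dotp g x)).
- exact: Re_neq0 g0.
- exact: Re_neq0 g1.
Qed.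

End OneWall.
End Diamonds.

(** * Diamonds and wall crossing *)

Definition cross_ratio (F : fieldType) (a b c d : F) := a * b / (c * d).

Lemma cross_ratio_mul (F : fieldType) (a b c d e f : F) :
  b != 0 -> c != 0 -> d != 0 ->
  cross_ratio a b c d * cross_ratio c e f b = cross_ratio a e f d.
Proof.
move=> b0 c0 d0; rewrite /cross_ratio.
have [->|f0] := eqVneq f 0; first by rewrite !mul0r !invr0 !mulr0.
by field; rewrite ?b0 ?c0 ?d0 ?f0.
Qed.

Lemma cross_ratio_congr (F : fieldType) (a b c d a' b' c' d' : F) :
  a = a' -> b = b' -> c = c' -> d = d' ->
  cross_ratio a b c d = cross_ratio a' b' c' d'.
Proof. by move=> -> -> -> ->. Qed.

Lemma cross_ratio_flip (F : fieldType) (a b c d : F) :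
  cross_ratio d c b a = (cross_ratio a b c d)^-1.
Proof. by rewrite /cross_ratio invf_div [d * c]mulrC [b * a]mulrC. Qed.

Lemma cross_ratio_split (F : fieldType) (a b c d : F) :
  a != 0 -> b != 0 -> c != 0 -> d != 0 ->
  cross_ratio (a * b) (c * d) (c * b) (a * d) = 1.
Proof. by move=> a0 b0 c0 d0; rewrite /cross_ratio; field; rewrite a0 b0 c0 d0. Qed.

Lemma cross_ratio_same (F : fieldType) (t b d : F) :
  t != 0 -> b != 0 -> d != 0 -> cross_ratio (t * b) d b (t * d) = 1.
Proof. by move=> t0 b0 d0; rewrite /cross_ratio; field; rewrite t0 b0 d0. Qed.

(** The c's are quarter arcs of a circle with marked points 0, 1, 2, 3; x0 and x2 are the ways in at
    0 and 2, a and b the ways out at 1 and 3. *)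
Lemma cross_ratio_circle (F : fieldType) (x0 x2 a b c01 c12 c23 c30 : F) :
  x0 != 0 -> x2 != 0 -> a != 0 -> b != 0 -> c12 != 0 -> c30 != 0 ->
  cross_ratio (x0 * c01 * a) (x2 * c23 * b) (x2 * c12^-1 * a) (x0 * c30^-1 * b)
  = c01 * c12 * c23 * c30.
Proof.
move=> h1 h2 h3 h4 h5 h6; rewrite /cross_ratio; field.
by rewrite h1 h2 h3 h4 h5 h6.
Qed.

Section Expi.
Variable R : realType.
Local Notation CK := (complex_complex__canonical__Num_NumField R).
Local Notation C := (Num.NumField.sort CK).

Lemma expiD (x y : R) : expi (x + y) = expi x * expi y.
Proof. by rewrite /expi cosD sinD; simpc; congr (_ +i* _)%C; ring. Qed.

Lemma expi0 : expi 0 = 1 :> R[i].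
Proof. by rewrite /expi cos0 sin0. Qed.

Lemma expi_pihalf : expi (pi / 2) = 'i%C :> R[i].
Proof. by rewrite /expi cos_pihalf sin_pihalf. Qed.

Lemma normr_expi (x : R) : `|expi x : C| = 1.
Proof. by rewrite normc_def /= cos2Dsin2 sqrtr1. Qed.

(** Multiplication by 1 - i turns by -pi/4, which centres the quarter arc from 1 to i on the
    positive real axis. *)
Lemma Re_quarter (t : R) : 0 <= t <= 1 ->
  0 < complex.Re (((1 - 'i%C) : C) * expi (pi / 2 * t)).
Proof.
move=> /andP[t0 t1]; rewrite /expi.
set c := cos _; set s := sin _.
have p0 : (0 : R) < pi := pi_gt0 R.
have c0 : 0 <= c by apply: cos_ge0_pihalf; apply/andP; split; nra.
have s0 : 0 <= s by apply: sin_ge0_pi; apply/andP; split; nra.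
have cs : c ^+ 2 + s ^+ 2 = 1 := cos2Dsin2 _.
have -> : complex.Re (((1 - 'i%C) : C) * (c +i* s)%C) = c + s.
  by rewrite /=; ring.
by rewrite lt_neqAle addr_ge0 // andbT eq_sym; apply/eqP => e; nra.
Qed.

End Expi.

Section WallCrossing.
Variables (R : realType) (n : nat) (s : 'I_n -> 'rV[R]_3).
Local Notation CK := (complex_complex__canonical__Num_NumField R).
Local Notation C := (Num.NumField.sort CK).
Local Notation Re := (@complex.Re R).
Local Notation Im := (@complex.Im R).
Local Notation V := 'rV[C]_3.
Local Notation "x %:C" := (real_complex R x : C).
Local Notation I := ('i%C : C).
Variable A : set (P2 CK).
Hypothesis hA : forall x, A x <-> forall k, rdot (s k) (hcoord x) != 0.
Variable chi : character R A.
Local Notation tseg := (tseg chi).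
Implicit Types (x y a g : 'rV[R]_3) (u v w c : V) (k l : 'I_n).

Definition edge x y : C := tseg (cx x) (I *: cx y).

Lemma edge_neq0 x y : edge x y != 0.
Proof. exact: tseg_neq0. Qed.

(* The holonomy of the closed polygon x, iy, x', iy', x. *)
Definition diamond x y x' y' : C :=
  cross_ratio (edge x y) (edge x' y') (edge x' y) (edge x y').

Lemma diamond_mul x y x' y' x'' :
  diamond x y x' y' * diamond x' y x'' y' = diamond x y x'' y'.
Proof. by apply: cross_ratio_mul; exact: edge_neq0. Qed.

Lemma diamond_flip x y x' y' : diamond x y' x' y = (diamond x y x' y')^-1.
Proof. exact: cross_ratio_flip. Qed.

(** The signs at [y] and [y'] may differ: a diamond winds around a wall only if the wall also
    separates [x] from [x']. *)
Definition stays g x x' y y' :=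
  [/\ 0 < dotp g x * dotp g x', dotp g y != 0 & dotp g y' != 0].

Lemma same_sign_trans (a b c : R) : 0 < a * b -> 0 < a * c -> 0 < b * c.
Proof.
move=> ab ac; have a0 : a != 0 by apply: contraTneq ab => ->; rewrite mul0r ltxx.
rewrite -(pmulr_rgt0 (b * c) (_ : 0 < a * a)); last first.
  by rewrite -expr2 exprn_even_gt0.
by rewrite mulrACA mulr_gt0.
Qed.

(** Both edges from [x] factor through the real segment from [x] to [x'], whose transport
    cancels. *)
Lemma diamond_same_chamber a x x' y y' : stays a x x' y y' ->
  (forall k, stays (s k) x x' y y') -> diamond x y x' y' = 1.
Proof.
move=> ha hs.
have st y1 : (forall g, stays g x x' y y' -> dotp g y1 != 0) ->
    edge x y1 = tseg (cx x) (cx x') * edge x' y1.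
  move=> hy; rewrite /edge (tseg_triangle hA) //.
  apply: hull3_avoids => [k|]; last exists a.
    apply: avoids_cone; first by rewrite rdot_cx; case: (hs k).
    by apply: hy; exact: hs.
  apply: avoids_cone; first by rewrite rdot_cx; case: ha.
  exact: hy.
rewrite /diamond (st y) => [|g []//]; rewrite (st y') => [|g []//].
by apply: cross_ratio_same; [exact: tseg_neq0|exact: edge_neq0|exact: edge_neq0].
Qed.

Lemma convex_pos (a b t : R) : 0 < a -> 0 < b -> 0 <= t <= 1 ->
  0 < (1 - t) * a + t * b.
Proof. by move=> a0 b0 /andP[t0 t1]; nra. Qed.

Lemma convex_combE u v w (h t : R) :
  (1 - h)%:C *: u + h%:C *: (v + t%:C *: (w - v)) =
  (1 - h)%:C *: u + (h * (1 - t))%:C *: v + (h * t)%:C *: w.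
Proof. by apply/rowP => j; rewrite !mxE !rmorphM !rmorphB rmorph1; ring. Qed.

Lemma mulr3_gt0 (b c e : R) : 0 < c -> 0 < b * e -> 0 < b * (c * e).
Proof. by move=> c0 be0; rewrite mulrCA mulr_gt0. Qed.

Section OneWall.
Variables (k : 'I_n) (a x x' y y' Y : 'rV[R]_3).
Hypothesis ha : stays a x x' y y'.
Hypothesis hs : forall l, l != k -> stays (s l) x x' y y'.
Hypothesis fxx' : dotp (s k) x * dotp (s k) x' < 0.
Hypothesis fY : dotp (s k) Y = 0.

Let f := s k.
Let d := x - x'.
Let fd := dotp f d.
(** The time at which the segment from [x] to [x'] meets the wall. The radius [r] below is at most
    t0 and at most 1 - t0, so real parts of the disc stay on the segment. *)
Let t0 := dotp f x / fd.
Let r := t0 * (1 - t0).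
(** A disc transverse to the wall: as f(Y) = 0, the functional [f] is z f(d) on it. The shift iY
    leaves real parts unchanged and moves the disc off the lines [vv i]. *)
Definition disc_point (z : C) : V := cx (x - t0 *: d) + I *: cx Y + z *: cx d.

Lemma wall_fd : 0 < dotp f x * fd.
Proof. by rewrite /fd dotpBr mulrBr; move: fxx'; rewrite -/f; nra. Qed.

Let fd_neq0 : fd != 0.
Proof. by apply: contraTneq wall_fd => ->; rewrite mulr0 ltxx. Qed.

Lemma wall_time : 0 < t0 < 1.
Proof.
have fx0 : dotp f x != 0 by apply: contraTneq wall_fd => ->; rewrite mul0r ltxx.
have e1 : t0 = dotp f x ^+ 2 / (dotp f x * fd) by rewrite /t0; field; rewrite fd_neq0 fx0.
have e2 : 1 - t0 = - (dotp f x * dotp f x') / (dotp f x * fd).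
  have e3 : fd - dotp f x = - dotp f x' by rewrite /fd dotpBr; ring.
  rewrite /t0 -[1](divff fd_neq0) -mulrBl e3; field.
  by rewrite fd_neq0 fx0.
apply/andP; split.
  by rewrite e1 divr_gt0 ?wall_fd // exprn_even_gt0.
by rewrite -subr_gt0 e2 divr_gt0 ?wall_fd // oppr_gt0.
Qed.

Lemma wall_radius : 0 < r.
Proof. by have /andP[h0 h1] := wall_time; rewrite mulr_gt0 // subr_gt0. Qed.

Lemma Re_mulr (z : C) (h : R) : Re (z * h%:C) = Re z * h.
Proof. by rewrite mulrC Re_realM mulrC. Qed.

Lemma Im_mulr (z : C) (h : R) : Im (z * h%:C) = Im z * h.
Proof. by rewrite mulrC Im_realM mulrC. Qed.

Lemma Re_disc g z :
  Re (rdot g (disc_point z)) = dotp g (x - (t0 - Re z) *: d).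
Proof.
rewrite /disc_point !rdotD !rdotZ !rdot_cx !ReD !Re_mulr /=.
by rewrite (dotpBr g x (t0 *: d)) (dotpBr g x ((t0 - Re z) *: d)) !dotpZr; ring.
Qed.

Lemma Im_disc g z :
  Im (rdot g (disc_point z)) = dotp g Y + Im z * dotp g d.
Proof.
rewrite /disc_point !rdotD !rdotZ !rdot_cx !ImD !Im_mulr /=.
by ring.
Qed.

Lemma rdot_wall_disc z : rdot f (disc_point z) = z * fd%:C.
Proof.
apply/eqP; rewrite eq_complex Re_disc Im_disc /f fY add0r.
rewrite (dotpBr _ x (_ *: d)) dotpZr -/f -/fd Re_mulr Im_mulr eqxx andbT.
by rewrite mulrBl /t0 divfK //; apply/eqP; ring.
Qed.

(** The real part is the value of [g] at time t0 - Re z of the segment from [x] to [x'], and that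
    time lies in [0, 1]. *)
Lemma disc_stays g z : stays g x x' y y' -> `|Re z| <= r ->
  0 < dotp g x * Re (rdot g (disc_point z)).
Proof.
move=> [gxx' _ _] zr; rewrite Re_disc.
have /andP[h0 h1] := wall_time.
have gx2 : 0 < dotp g x * dotp g x.
  by rewrite -expr2 exprn_even_gt0 //=; apply: contraTneq gxx' => ->;
    rewrite mul0r ltxx.
have th : 0 <= t0 - Re z <= 1.
  move: zr; rewrite ler_norml /r => /andP[z1 z2].
  by apply/andP; split; nra.
have := convex_pos gx2 gxx' th.
by congr (0 < _); rewrite (dotpBr g x (_ *: d)) dotpZr /d dotpBr; ring.
Qed.

Lemma disc_stays' g z : stays g x x' y y' -> `|Re z| <= r ->
  0 < dotp g x' * Re (rdot g (disc_point z)).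
Proof.
move=> gs zr; apply: same_sign_trans (disc_stays gs zr).
by case: gs.
Qed.

Let G := [set g | stays g x x' y y'].
Let Gs l : l != k -> G (s l). Proof. exact: hs. Qed.
Let G0 : G !=set0. Proof. by exists a. Qed.

(** At this point of the disc [f] is imaginary, with the sign of f(y1); hence [x] and [x'] both
    reach i y1 through it, in spite of the wall between them. *)
Lemma edge_cone (h : R) y1 : (forall g, G g -> dotp g y1 != 0) ->
  `|h| <= r -> 0 < dotp f y1 * (h * fd) ->
  edge x y1 = tseg (cx x) (disc_point (I * h%:C)) *
              tseg (disc_point (I * h%:C)) (I *: cx y1) /\
  edge x' y1 = tseg (cx x') (disc_point (I * h%:C)) *
              tseg (disc_point (I * h%:C)) (I *: cx y1).
Proof.
move=> hy1 hr hf.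
have Re0 : Re (I * h%:C) = 0 by rewrite Re_mulr mul0r.
have zr : `|Re (I * h%:C)| <= r by rewrite Re0 normr0 ltW // wall_radius.
have fxn : dotp f x != 0 by apply: contraTneq fxx' => e; rewrite -/f e mul0r ltxx.
have fxn' : dotp f x' != 0 by apply: contraTneq fxx' => e; rewrite -/f e mulr0 ltxx.
have e1 : Re (rdot f (disc_point (I * h%:C))) = 0.
  by rewrite rdot_wall_disc Re_mulr Re0 mul0r.
have e2 : Im (rdot f (disc_point (I * h%:C))) = h * fd.
  by rewrite rdot_wall_disc Im_mulr Im_mulr mul1r.
split; rewrite (tseg_triangle hA) //; apply: (hull3_cone Gs G0) => //.
- by move=> g Gg; split; [exact: disc_stays|exact: hy1].
- by rewrite -/f e2.
- by move=> g Gg; split; [exact: disc_stays'|exact: hy1].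
- by rewrite -/f e2.
Qed.

(** All four edges pass through the same point ±ir of the disc, and the pieces cancel in pairs. *)
Lemma diamond_one_side : 0 < dotp f y * dotp f y' -> diamond x y x' y' = 1.
Proof.
move=> fyy'.
have [h [hr hy]] : exists h : R, `|h| <= r /\ 0 < dotp f y * (h * fd).
  have r0 := wall_radius.
  have rr : `|r| = r by rewrite ger0_norm // ltW.
  have fy0 : dotp f y * fd != 0.
    by rewrite mulf_neq0 //; apply: contraTneq fyy' => ->; rewrite mul0r ltxx.
  have [p|p] := ltP 0 (dotp f y * fd).
    exists r; rewrite rr; split => //.
    by rewrite mulrCA mulr_gt0.
  exists (- r); rewrite normrN rr; split => //.
  by rewrite mulrCA mulNr oppr_gt0 pmulr_rlt0 // lt_neqAle fy0.
have hy' : 0 < dotp f y' * (h * fd) by exact: same_sign_trans fyy' hy.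
have gy g : G g -> dotp g y != 0 by case.
have gy' g : G g -> dotp g y' != 0 by case.
have [e1 e2] := edge_cone gy hr hy; have [e3 e4] := edge_cone gy' hr hy'.
by rewrite /diamond e1 e2 e3 e4; apply: cross_ratio_split; exact: tseg_neq0.
Qed.

Lemma norm_Re_le (z : C) (h : R) : `|z| <= h%:C -> `|Re z| <= h.
Proof. by move=> zh; rewrite -lecR; apply: le_trans zh; exact: normRe. Qed.

Lemma norm_Im_le (z : C) (h : R) : `|z| <= h%:C -> `|Im z| <= h.
Proof. by move=> zh; rewrite -lecR; apply: le_trans zh; exact: normIm. Qed.

Lemma stays_disc_neq0 g z : stays g x x' y y' -> `|z| <= r%:C ->
  rdot g (disc_point z) != 0.
Proof. by move=> gs /norm_Re_le zr; exact: Re_neq0 (disc_stays gs zr). Qed.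

Lemma good_disc z : `|z| <= r%:C -> z != 0 -> good s (disc_point z).
Proof.
move=> zr z0; split; first exact: rdot_nz (stays_disc_neq0 ha zr).
move=> l; have [->|lk] := eqVneq l k; last exact: stays_disc_neq0 (hs lk) zr.
by rewrite rdot_wall_disc mulf_neq0 // real_complex_neq0.
Qed.

Lemma cts_disc (T : topologicalType) (h : T -> C) :
  continuous h -> continuous (fun t => disc_point (h t)).
Proof.
move=> ch; apply: cts_add; first exact: cts_cst.
by apply: cts_scale ch _; exact: cts_cst.
Qed.

Definition rotation (u : C) (t : R) : C := r%:C * (u * expi (pi / 2 * t)).

Lemma norm_rotation (u : C) t : `|u| = 1 -> `|rotation u t| = r%:C.
Proof.
move=> u1; rewrite /rotation !normrM u1 normr_expi mulr1 mulr1.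
by rewrite ger0_norm // lecR; apply: ltW; exact: wall_radius.
Qed.

Lemma rotation_neq0 (u : C) t : `|u| = 1 -> rotation u t != 0.
Proof.
move=> u1; rewrite -normr_eq0 norm_rotation // real_complex_neq0 //.
by rewrite gt_eqF // wall_radius.
Qed.

Lemma cts_rotation (u : C) : continuous (fun t : R => rotation u t).
Proof.
apply: cts_mul; first exact: cts_cst.
apply: cts_mul; first exact: cts_cst.
by apply: cts_expi; apply: cts_mul; [exact: cts_cst|exact: cts_id].
Qed.

(** For the wall [k] a quarter arc lies in an open half plane, by [Re_quarter]; for the other
    functionals the real part keeps its sign on the whole disc. *)
Lemma hull3_arc (u : C) t1 t2 t3 : `|u| = 1 ->
  0 <= t1 <= 1 -> 0 <= t2 <= 1 -> 0 <= t3 <= 1 ->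
  hull3 s (disc_point (rotation u t1)) (disc_point (rotation u t2))
    (disc_point (rotation u t3)).
Proof.
move=> u1 h1 h2 h3.
have u0 : u != 0 by rewrite -normr_eq0 u1 oner_neq0.
have half t : 0 <= t <= 1 ->
    0 < Re ((1 - I) / (u * fd%:C) * rdot f (disc_point (rotation u t))).
  move=> t01; rewrite rdot_wall_disc /rotation.
  have cancel (F : fieldType) (b c d' e h : F) : b != 0 -> d' != 0 ->
    c / (b * d') * (h * (b * e) * d') = h * (c * e).
    by move=> b0 d0; field; rewrite b0 d0.
  rewrite cancel ?real_complex_neq0 // Re_realM mulr_gt0 // ?wall_radius //.
  exact: Re_quarter.
have sd g t : G g -> 0 < dotp g x * Re (rdot g (disc_point (rotation u t))).
  by move=> Gg; apply: disc_stays => //; apply: norm_Re_le; rewrite norm_rotation.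
apply: (hull3_half Gs G0 (h := (1 - I) / (u * fd%:C))); try exact: half.
by move=> g Gg; exists (dotp g x); split; exact: sd.
Qed.

Lemma transport_arc (u : C) : `|u| = 1 ->
  transport chi (toP \o (fun t => disc_point (rotation u t))) =
  tseg (disc_point (rotation u 0)) (disc_point (rotation u 1)).
Proof.
move=> u1; have cc : continuous (fun t : R => disc_point (rotation u t)).
  by apply: cts_disc; exact: cts_rotation.
apply: (@tseg_path _ _ s A hA chi _ (fun t => disc_point (rotation u t))) => //.
  apply: valid_toP => // t; apply: good_disc; last exact: rotation_neq0.
  by rewrite norm_rotation.
move=> h t h01 t01.
have i0 : 0 <= (0 : R) <= 1 by rewrite lexx ler01.
have i1 : 0 <= (1 : R) <= 1 by rewrite lexx ler01.
rewrite (_ : _ + _ = (1 - h)%:C *: disc_point (rotation u t)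
  + (h * (1 - t))%:C *: disc_point (rotation u 0)
  + (h * t)%:C *: disc_point (rotation u 1)).
  move: (h01) (t01) => /andP[h0 h1] /andP[t0' t1'].
  by apply: hull3_arc; rewrite ?mulr_ge0 ?subr_ge0 //; ring.
exact: convex_combE.
Qed.

Section Circle.
Variables (xi : C) (vv : 'I_3 -> 'rV[R]_3).
(** The disc has to miss the lines [vv i] too, since meridians live in the complement of all the
    lines; [hYv] secures this through imaginary parts. *)
Hypothesis hmer : forall (p : V) (v : V) (h : R), 0 < h -> rdot f p = 0 ->
  (forall t : C, `|t| <= h%:C ->
    [/\ rdot f (p + t *: v) = 0 -> t = 0,
        forall l, l != k -> rdot (s l) (p + t *: v) != 0 &
        forall i, rdot (vv i) (p + t *: v) != 0]) ->
  transport chi (fun t : R => toP (p + (h%:C * expi (2 * pi * t)) *: v)) = xi.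
Hypothesis hYv : forall i (h : R), `|h| <= r -> dotp (vv i) Y + h * dotp (vv i) d != 0.

Lemma transport_circle :
  transport chi (fun t : R => toP (disc_point (r%:C * expi (2 * pi * t)))) = xi.
Proof.
apply: (@hmer (cx (x - t0 *: d) + I *: cx Y) (cx d) r wall_radius).
  have := rdot_wall_disc 0; rewrite /disc_point scale0r addr0 => ->.
  by rewrite mul0r.
move=> t tr; rewrite -/(disc_point t); split.
- rewrite rdot_wall_disc => /eqP; rewrite mulf_eq0 => /orP[/eqP//|].
  by rewrite (negbTE (real_complex_neq0 fd_neq0)).
- by move=> l lk; exact: stays_disc_neq0 (hs lk) tr.
- move=> i; apply: contra_neq (hYv i (norm_Im_le tr)) => e.
  by rewrite -Im_disc e.
Qed.

Lemma tseg_arc_sym (u : C) (t1 t2 : R) : `|u| = 1 -> 0 <= t1 <= 1 -> 0 <= t2 <= 1 ->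
  tseg (disc_point (rotation u t2)) (disc_point (rotation u t1)) =
  (tseg (disc_point (rotation u t1)) (disc_point (rotation u t2)))^-1.
Proof.
move=> u1 h1 h2; apply: (mulfI (tseg_neq0 chi (disc_point (rotation u t1))
  (disc_point (rotation u t2)))).
rewrite (tseg_triangle hA); last exact: hull3_arc.
rewrite (tseg_id hA) ?mulfV //; first exact: tseg_neq0.
by apply: good_disc; rewrite ?rotation_neq0 // norm_rotation.
Qed.

Let c0 := disc_point (rotation 1 0).
Let c1 := disc_point (rotation I 0).
Let c2 := disc_point (rotation (-1) 0).
Let c3 := disc_point (rotation (- I) 0).

Lemma rotation_0 (u : C) : rotation u 0 = u * r%:C.
Proof. by rewrite /rotation mulr0 expi0 mulr1 mulrC. Qed.

Lemma rdot_wall_rotation (u : C) :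
  rdot f (disc_point (rotation u 0)) = u * (r * fd)%:C.
Proof.
have M (b c : R) : u * b%:C * c%:C = u * (b * c)%:C by rewrite rmorphM mulrA.
by rewrite rdot_wall_disc rotation_0 M.
Qed.

Lemma rotation_next (u : C) : rotation u 1 = rotation (u * I) 0.
Proof. by rewrite /rotation mulr1 mulr0 expi0 expi_pihalf mulr1. Qed.

Lemma norm_I : `|I| = 1. Proof. by rewrite -expi_pihalf normr_expi. Qed.
Lemma norm_NI : `|- I| = 1. Proof. by rewrite normrN norm_I. Qed.
Lemma norm_N1 : `|-1 : C| = 1. Proof. by rewrite normrN normr1. Qed.
Lemma norm_1 : `|1 : C| = 1. Proof. exact: normr1. Qed.
Lemma mulII : I * I = -1. Proof. by rewrite -expr2 sqr_i. Qed.

(** The points are 1, i, -1, -i times the radius; each quarter of the meridian is replaced by its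
    chord. *)
Lemma xi_arcs : tseg c0 c1 * tseg c1 c2 * tseg c2 c3 * tseg c3 c0 = xi.
Proof.
pose c (t : R) : V := disc_point (r%:C * expi (2 * pi * t)).
have vc : valid A (toP \o c).
  have rc t : r%:C * expi (2 * pi * t) = rotation 1 (4 * t).
    rewrite /rotation mul1r; congr (_ * expi _).
    by rewrite mulrA; congr (_ * _); field.
  apply: valid_toP => // [|t].
    apply: cts_disc; apply: cts_mul; first exact: cts_cst.
    by apply: cts_expi; apply: cts_mul; [exact: cts_cst|exact: cts_id].
  by apply: good_disc; rewrite rc ?norm_rotation ?rotation_neq0 ?norm_1.
have arc (u u' : C) (b b' : R) : expi (2 * pi * b) = u -> `|u| = 1 ->
    b' = b + 4^-1 -> u' = u * I -> transport chi (subpath (toP \o c) b b') =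
    tseg (disc_point (rotation u 0)) (disc_point (rotation u' 0)).
  move=> eu u1 -> ->; apply: etrans (congr1 (fun z =>
    tseg (disc_point (rotation u 0)) (disc_point z)) (rotation_next u)).
  apply: etrans (transport_arc u1).
  apply: (congr1 (transport chi)); apply/funext => t.
  have e : 2 * pi * (b + t * (b + 4^-1 - b)) = 2 * pi * b + pi / 2 * t :> R by field.
  by rewrite /subpath /comp /c e expiD eu.
have q1 : expi (2 * pi * 4^-1) = I.
  by rewrite -expi_pihalf; congr expi; field.
have q2 : expi (2 * pi * (4^-1 + 4^-1) : R) = -1.
  rewrite (_ : _ * _ = 2 * pi * 4^-1 + 2 * pi * 4^-1); last by field.
  by rewrite expiD q1 mulII.
have q3 : expi (2 * pi * (4^-1 + 4^-1 + 4^-1)) = - I.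
  rewrite (_ : _ * _ = 2 * pi * (4^-1 + 4^-1) + 2 * pi * 4^-1); last by field.
  by rewrite expiD q1 q2 mulN1r.
have q0 : expi (2 * pi * 0) = 1 :> C by rewrite mulr0 expi0.
have b1 : 4^-1 = 0 + 4^-1 :> R by rewrite add0r.
have b4 : 1 = 4^-1 + 4^-1 + 4^-1 + 4^-1 :> R by field.
have u1 : I = 1 * I by rewrite mul1r.
have u3 : - I = -1 * I by rewrite mulN1r.
have u4 : 1 = - I * I by rewrite mulNr mulII opprK.
pose T b b' := transport chi (subpath (toP \o c) b b').
have prod4 (e0 e1 e2 e3 e0' e1' e2' e3' : C) : e0' = e0 -> e1' = e1 ->
    e2' = e2 -> e3' = e3 -> e0 * e1 * e2 * e3 = e0' * e1' * e2' * e3'.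
  by move=> -> -> -> ->.
transitivity (T 0 4^-1 * T 4^-1 (4^-1 + 4^-1) *
  T (4^-1 + 4^-1) (4^-1 + 4^-1 + 4^-1) * T (4^-1 + 4^-1 + 4^-1) 1).
  apply: prod4.
  - exact: arc q0 norm_1 b1 u1.
  - exact: arc q1 norm_I (erefl _) (esym mulII).
  - exact: arc q2 norm_N1 (erefl _) u3.
  - exact: arc q3 norm_NI b4 u4.
rewrite /T.
by rewrite !transport_subpath // subpath01 -transport_circle.
Qed.

(** The edges meet the disc as follows: [x] enters at [c0], [x'] at [c2], and the ways to iy and iy'
    leave from [c1] and [c3]. What remains of the diamond is the positively oriented circle c0 c1 c2
    c3. *)
Lemma diamond_cross_pos : 0 < dotp f x * dotp f y -> dotp f x * dotp f y' < 0 ->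
  diamond x y x' y' = xi.
Proof.
move=> xy xy'.
have i0 : 0 <= (0 : R) <= 1 by rewrite lexx ler01.
have i1 : 0 <= (1 : R) <= 1 by rewrite lexx ler01.
have gy g : G g -> dotp g y != 0 by case.
have gy' g : G g -> dotp g y' != 0 by case.
have rr : `|r| = r by rewrite ger0_norm // ltW // wall_radius.
have e1 : c1 = disc_point (I * r%:C) := congr1 disc_point (rotation_0 I).
have NIC (h : R) : - I * h%:C = I * (- h)%:C by rewrite rmorphN mulrN mulNr.
have e3 : c3 = disc_point (I * (- r)%:C) :=
  congr1 disc_point (etrans (rotation_0 (- I)) (NIC r)).
have [q [xq qE qN rq]] : exists q : R, [/\ 0 < dotp f x * q, q = r * fd,
    - r * fd = - q & forall u : C, rdot f (disc_point (rotation u 0)) = u * q%:C].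
  exists (r * fd); split=> [|||u].
  - by apply: mulr3_gt0; [exact: wall_radius|exact: wall_fd].
  - by [].
  - exact: mulNr.
  - exact: rdot_wall_rotation.
have h1 : 0 < dotp f y * (r * fd) by rewrite -qE; exact: same_sign_trans xy xq.
have xq' : dotp f x' * q < 0.
  rewrite -oppr_gt0 -mulrN; apply: (@same_sign_trans (- dotp f x)).
    by rewrite mulNr oppr_gt0.
  by rewrite mulrNN.
have h3 : 0 < dotp f y' * ((- r) * fd).
  rewrite qN; apply: (@same_sign_trans (- dotp f x)).
    by rewrite mulNr oppr_gt0.
  by rewrite mulrNN.
have [|exy ex'y] := edge_cone gy _ h1; first by rewrite rr.
have [|exy' ex'y'] := edge_cone gy' _ h3; first by rewrite normrN rr.
move: exy ex'y exy' ex'y'; rewrite -e1 -e3 => exy ex'y exy' ex'y'.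
have rt (u : C) : `|u| = 1 -> `|Re (rotation u 0)| <= r.
  by move=> u1; apply: norm_Re_le; rewrite norm_rotation.
have q0 : q != 0 by apply: contraTneq xq => ->; rewrite mulr0 ltxx.
have n1 : rdot f c1 != 0.
  by rewrite rq mulf_neq0 ?neq0Ci ?real_complex_neq0.
have n3 : rdot f c3 != 0.
  by rewrite rq mulf_neq0 ?oppr_eq0 ?neq0Ci ?real_complex_neq0.
have R1 : Re (rdot f c1) = 0 by rewrite rq Re_mulr mul0r.
have R3 : Re (rdot f c3) = 0 by rewrite rq Re_mulr /= oppr0 mul0r.
have x0 : 0 < dotp f x * Re (rdot f c0) by rewrite rq Re_mulr /= mul1r.
have x2 : 0 < dotp f x' * Re (rdot f c2).
  by rewrite rq Re_mulr /= mulN1r mulrN oppr_gt0.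
have t01 : tseg (cx x) c1 = tseg (cx x) c0 * tseg c0 c1.
  apply: esym; apply: (tseg_triangle hA).
  apply: (hull3_quadrant Gs G0 _ x0 R1 n1) => g Gg.
  by split; [exact: disc_stays Gg (rt _ norm_1)|exact: disc_stays Gg (rt _ norm_I)].
have t03 : tseg (cx x) c3 = tseg (cx x) c0 * tseg c0 c3.
  apply: esym; apply: (tseg_triangle hA).
  apply: (hull3_quadrant Gs G0 _ x0 R3 n3) => g Gg.
  by split; [exact: disc_stays Gg (rt _ norm_1)|exact: disc_stays Gg (rt _ norm_NI)].
have t21 : tseg (cx x') c1 = tseg (cx x') c2 * tseg c2 c1.
  apply: esym; apply: (tseg_triangle hA).
  apply: (hull3_quadrant Gs G0 _ x2 R1 n1) => g Gg.
  by split; [exact: disc_stays' Gg (rt _ norm_N1)|exact: disc_stays' Gg (rt _ norm_I)].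
have t23 : tseg (cx x') c3 = tseg (cx x') c2 * tseg c2 c3.
  apply: esym; apply: (tseg_triangle hA).
  apply: (hull3_quadrant Gs G0 _ x2 R3 n3) => g Gg.
  by split; [exact: disc_stays' Gg (rt _ norm_N1)|exact: disc_stays' Gg (rt _ norm_NI)].
have s21 : tseg c2 c1 = (tseg c1 c2)^-1.
  have := tseg_arc_sym norm_I i0 i1.
  by rewrite (rotation_next I) mulII.
have s03 : tseg c0 c3 = (tseg c3 c0)^-1.
  have := tseg_arc_sym norm_NI i0 i1.
  by rewrite (rotation_next (- I)) mulNr mulII opprK.
have mul_eq (e b c b1 b2 b3 : C) : e = b * c -> b = b1 * b2 -> b2 = b3 ->
    e = b1 * b3 * c by move=> -> -> ->.
have E1 := mul_eq _ _ _ _ _ _ exy t01 (erefl _).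
have E2 := mul_eq _ _ _ _ _ _ ex'y' t23 (erefl _).
have E3 := mul_eq _ _ _ _ _ _ ex'y t21 s21.
have E4 := mul_eq _ _ _ _ _ _ exy' t03 s03.
apply: etrans (cross_ratio_congr E1 E2 E3 E4) _; apply: etrans xi_arcs.
by apply: cross_ratio_circle; exact: tseg_neq0.
Qed.

End Circle.

End OneWall.
End WallCrossing.

(** * Signs along a segment and the contribution of one wall *)

Section WallFactor.
Variables (R : realType) (F : fieldType).
Implicit Types (z : F) (b c t v : R).

(* Contribution of a wall with meridian value z to the holonomy of a diamond *)
(* x, iy, x', iy', given the values b, b', c, c' of its equation at x, x',   *)
(* y, y': the diamond winds around the wall iff both signs change.           *)
Definition wall_factor z b b' c c' : F :=
  if (b * b' < 0) && (c * c' < 0) then (if 0 < b * c then z else z^-1) else 1.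

Lemma pos_neq0l b c : 0 < b * c -> b != 0.
Proof. by apply: contraTneq => ->; rewrite mul0r ltxx. Qed.

Lemma pos_neq0r b c : 0 < b * c -> c != 0.
Proof. by apply: contraTneq => ->; rewrite mulr0 ltxx. Qed.

Lemma neg_neq0l b c : b * c < 0 -> b != 0.
Proof. by apply: contraTneq => ->; rewrite mul0r ltxx. Qed.

Lemma neg_neq0r b c : b * c < 0 -> c != 0.
Proof. by apply: contraTneq => ->; rewrite mulr0 ltxx. Qed.

Lemma same_sign b v c : 0 < b * v -> (0 < b * c) = (0 < v * c).
Proof.
move=> bv; apply/idP/idP => h; first exact: same_sign_trans bv h.
by rewrite mulrC in bv; exact: same_sign_trans bv h.
Qed.

Lemma same_sign_neg b v c : 0 < b * v -> (b * c < 0) = (v * c < 0).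
Proof.
by move=> bv; rewrite -!oppr_gt0 -!mulrN; exact: same_sign.
Qed.

Lemma wall_factor_stay z b b' c c' : 0 < b * b' -> wall_factor z b b' c c' = 1.
Proof. by move=> h; rewrite /wall_factor ltNge ltW. Qed.

Lemma wall_factor_stay_y z b b' c c' : 0 < c * c' -> wall_factor z b b' c c' = 1.
Proof. by move=> h; rewrite /wall_factor andbC ltNge ltW. Qed.

Lemma wall_factor_eq_left z b v b' c c' : 0 < b * v ->
  wall_factor z b b' c c' = wall_factor z v b' c c'.
Proof.
by move=> bv; rewrite /wall_factor (same_sign _ bv) (same_sign_neg _ bv).
Qed.

Lemma wall_factor_eq_right z b v b' c c' : 0 < v * b' ->
  wall_factor z b b' c c' = wall_factor z b v c c'.
Proof.
move=> vb; rewrite /wall_factor ![b * _]mulrC -(same_sign_neg _ vb).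
by rewrite [v * b]mulrC.
Qed.

Lemma move_stay b b' t : 0 < b * b' -> 0 <= t <= 1 ->
  0 < b * (b - t * (b - b')) /\ 0 < (b - t * (b - b')) * b'.
Proof.
move=> bb t01.
have b2 : 0 < b * b by rewrite -expr2 exprn_even_gt0 // (pos_neq0l bb).
have h : 0 < b * (b - t * (b - b')).
  by have := convex_pos b2 bb t01; congr (0 < _); ring.
by split=> //; exact: same_sign_trans h bb.
Qed.

Lemma cross_gap b b' : b * b' < 0 -> 0 < b * (b - b') /\ (b - b') * b' < 0.
Proof.
move=> bb; have b2 : 0 < b * b by rewrite -expr2 exprn_even_gt0 // (neg_neq0l bb).
have b2' : 0 < b' * b' by rewrite -expr2 exprn_even_gt0 // (neg_neq0r bb).
by rewrite mulrBr mulrBl; split; lra.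
Qed.

(** [b - t * (b - b')] is the value of the wall's equation at time t of the segment; it vanishes at
    time [b / (b - b')]. *)
Lemma move_before b b' t : b * b' < 0 -> t < b / (b - b') ->
  0 < b * (b - t * (b - b')) /\ (b - t * (b - b')) * b' < 0.
Proof.
move=> bb tb; have [g1 g2] := cross_gap bb.
have h : 0 < b * (b - t * (b - b')).
  have -> : b * (b - t * (b - b')) = (b / (b - b') - t) * (b * (b - b')).
    by field; exact: pos_neq0r g1.
  by rewrite mulr_gt0 // subr_gt0.
by split=> //; rewrite -(same_sign_neg _ h).
Qed.

Lemma move_after b b' t : b * b' < 0 -> b / (b - b') < t ->
  b * (b - t * (b - b')) < 0 /\ 0 < (b - t * (b - b')) * b'.
Proof.
move=> bb tb; have [g1 g2] := cross_gap bb; have w0 := pos_neq0r g1.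
split.
  have -> : b * (b - t * (b - b')) = - ((t - b / (b - b')) * (b * (b - b'))).
    by field.
  by rewrite oppr_lt0 mulr_gt0 // subr_gt0.
have -> : (b - t * (b - b')) * b' = (t - b / (b - b')) * - ((b - b') * b').
  by field.
by rewrite mulr_gt0 ?subr_gt0 // oppr_gt0.
Qed.

Lemma cross_time b b' : b * b' < 0 -> 0 < b / (b - b') < 1.
Proof.
move=> bb; have [g1 g2] := cross_gap bb; have w0 := pos_neq0r g1.
have w2 : 0 < (b - b') * (b - b') by rewrite -expr2 exprn_even_gt0.
have -> : b / (b - b') = b * (b - b') / ((b - b') * (b - b')) by field.
rewrite divr_gt0 //= ltr_pdivrMr // mul1r -subr_gt0.
have -> : (b - b') * (b - b') - b * (b - b') = - ((b - b') * b') by ring.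
by rewrite oppr_gt0.
Qed.

(** If the segment is cut away from the crossing time, exactly one half crosses the wall, in the
    same direction as the whole. *)
Lemma wall_factor_split z b b' c c' t : b != 0 -> b' != 0 -> 0 <= t <= 1 ->
  (b * b' < 0 -> t != b / (b - b')) ->
  let v := b - t * (b - b') in
  wall_factor z b b' c c' = wall_factor z b v c c' * wall_factor z v b' c c'.
Proof.
move=> b0 b0' t01 tb /=.
have [bb|bb|/eqP bb] := ltgtP (b * b') 0; last first.
- by move: bb; rewrite mulf_eq0 (negbTE b0) (negbTE b0').
- have [h1 h2] := move_stay bb t01.
  by rewrite !wall_factor_stay ?mulr1.
have [lt|lt|e] := ltgtP t (b / (b - b')); last by move: (tb bb); rewrite e eqxx.
- have [h1 h2] := move_before bb lt.
  by rewrite (wall_factor_stay _ _ _ h1) mul1r; exact: wall_factor_eq_left.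
- have [h1 h2] := move_after bb lt.
  by rewrite (wall_factor_stay _ _ _ h2) mulr1; exact: wall_factor_eq_right.
Qed.

End WallFactor.

(** * Diamonds crossing several walls *)

Section GeneralDiamond.
Variables (R : realType) (n : nat) (s : 'I_n -> 'rV[R]_3).
Local Notation CK := (complex_complex__canonical__Num_NumField R).
Local Notation C := (Num.NumField.sort CK).
Local Notation V := 'rV[C]_3.
Local Notation "x %:C" := (real_complex R x : C).
Variable A : set (P2 CK).
Hypothesis hA : forall x, A x <-> forall k, rdot (s k) (hcoord x) != 0.
Variables (chi : character R A) (xi : 'I_n -> C) (vv : 'I_3 -> 'rV[R]_3).
Hypothesis hmer : forall k (p v : V) (h : R), 0 < h -> rdot (s k) p = 0 ->
  (forall t : C, `|t| <= h%:C ->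
    [/\ rdot (s k) (p + t *: v) = 0 -> t = 0,
        forall l, l != k -> rdot (s l) (p + t *: v) != 0 &
        forall i, rdot (vv i) (p + t *: v) != 0]) ->
  transport chi (fun t : R => toP (p + (h%:C * expi (2 * pi * t)) *: v)) = xi k.
Hypothesis hY : forall k, exists Y, dotp (s k) Y = 0 /\
  forall i, dotp (vv i) Y != 0.
Hypothesis hprop : forall k l c, k != l -> s k <> c *: s l.
Implicit Types (x y a g : 'rV[R]_3) (k l : 'I_n).

Lemma diamond_one_wall k a x x' y y' : stays a x x' y y' ->
  (forall l, l != k -> stays (s l) x x' y y') ->
  dotp (s k) x * dotp (s k) x' < 0 ->
  dotp (s k) y != 0 -> dotp (s k) y' != 0 ->
  diamond chi x y x' y' = wall_factor (xi k) (dotp (s k) x) (dotp (s k) x')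
    (dotp (s k) y) (dotp (s k) y').
Proof.
move=> ha hs fxx' fy fy'.
have [Y0 [fY0 hY0]] := hY k.
(* [M] is so large that every |vv i (Y)| exceeds |vv i (x - x')|; as the radius t0 (1 - t0) is at
   most 1, the disc then misses all three lines. *)
pose M : R := 1 + \sum_i `|dotp (vv i) (x - x')| / `|dotp (vv i) Y0|.
pose Y := M *: Y0.
have fY : dotp (s k) Y = 0 by rewrite dotpZr fY0 mulr0.
have [fyy'|fyy'|/eqP fyy'] := ltgtP (dotp (s k) y * dotp (s k) y') 0; last first.
- by move: fyy'; rewrite mulf_eq0 (negbTE fy) (negbTE fy').
- by rewrite wall_factor_stay_y // (diamond_one_side hA chi ha hs fxx' fY).
have hYv i h : `|h| <= 1 -> dotp (vv i) Y + h * dotp (vv i) (x - x') != 0.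
  move=> h1; rewrite dotpZr addr_eq0; apply/eqP => /(congr1 Num.norm).
  rewrite normrN !normrM => e.
  have Y0i : 0 < `|dotp (vv i) Y0| by rewrite normr_gt0.
  have M1 : 1 + `|dotp (vv i) (x - x')| / `|dotp (vv i) Y0| <= M.
    rewrite lerD2l (bigD1 i) //= lerDl sumr_ge0 // => j _.
    by rewrite divr_ge0.
  have : `|dotp (vv i) (x - x')| < `|M| * `|dotp (vv i) Y0|.
    have M2 : M <= `|M| by exact: ler_norm.
    apply: lt_le_trans (_ : (1 + `|dotp (vv i) (x - x')| / `|dotp (vv i) Y0|)
       * `|dotp (vv i) Y0| <= _); last by rewrite ler_pM2r // (le_trans M1).
    by rewrite mulrDl mul1r divfK ?gt_eqF // ltrDr.
  by rewrite e ltNge ler_piMl.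
have rad (t : R) : t * (1 - t) <= 1 by nra.
have hYv' i h : `|h| <= dotp (s k) x / dotp (s k) (x - x') *
    (1 - dotp (s k) x / dotp (s k) (x - x')) ->
    dotp (vv i) Y + h * dotp (vv i) (x - x') != 0.
  by move=> hr; apply: hYv; apply: le_trans hr (rad _).
rewrite /wall_factor fxx' fyy' /=.
have [xy|xy] := ltP 0 (dotp (s k) x * dotp (s k) y).
  apply: (diamond_cross_pos hA ha hs fxx' fY (hmer (k := k)) hYv' xy).
  by rewrite -(same_sign_neg _ (_ : 0 < dotp (s k) y * _)) // mulrC.
(* For the other orientation [y] and [y'] are exchanged, which inverts the diamond. *)
have sw g : stays g x x' y y' -> stays g x x' y' y by case.
have xy0 : dotp (s k) x * dotp (s k) y < 0.
  by rewrite lt_neqAle xy mulf_neq0 // (neg_neq0l fxx').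
have xy' : 0 < dotp (s k) x * dotp (s k) y'.
  have : 0 < (- dotp (s k) y) * dotp (s k) y' by rewrite mulNr oppr_gt0.
  apply: same_sign_trans; rewrite mulNr oppr_gt0 mulrC //.
have hs' l : l != k -> stays (s l) x x' y' y by move=> lk; apply/sw/hs.
have := diamond_cross_pos hA (sw _ ha) hs' fxx' fY (hmer (k := k)) hYv' xy' xy0.
by rewrite diamond_flip => <-; rewrite invrK.
Qed.

Definition off_walls x := forall k, dotp (s k) x != 0.

(** If two walls are crossed between [x] and [x'], this says that the crossing times differ. *)
Definition generic x x' := forall k l, k != l ->
  dotp (s k) x * dotp (s l) x' != dotp (s l) x * dotp (s k) x'.

Definition diamond_weight x y x' y' : C :=
  \prod_k wall_factor (xi k) (dotp (s k) x) (dotp (s k) x')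
    (dotp (s k) y) (dotp (s k) y').

Lemma stays_pos a x x' y y' k : off_walls y -> off_walls y' ->
  0 < dotp (s k) x * dotp (s k) x' -> stays (s k) x x' y y'.
Proof. by move=> oy oy' h; split. Qed.

Lemma diamond_no_wall a x x' y y' : stays a x x' y y' ->
  off_walls y -> off_walls y' ->
  (forall k, 0 < dotp (s k) x * dotp (s k) x') ->
  diamond chi x y x' y' = diamond_weight x y x' y'.
Proof.
move=> ha oy oy' h; rewrite (diamond_same_chamber hA chi ha) => [|k].
  by rewrite /diamond_weight big1 // => k _; rewrite wall_factor_stay.
exact: stays_pos a _ _ _ _ _ oy oy' (h k).
Qed.

(** Induction on the number of walls between [x] and [x']: the segment is cut just after its first
    crossing, and [diamond_mul] composes the two parts. *)
Lemma diamond_generic N a x x' y y' : stays a x x' y y' ->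
  off_walls x -> off_walls x' -> off_walls y -> off_walls y' -> generic x x' ->
  (#|[pred k | (dotp (s k) x * dotp (s k) x' < 0)%R]| <= N)%N ->
  diamond chi x y x' y' = diamond_weight x y x' y'.
Proof.
move=> ha ox ox' oy oy'; elim: N x ox ha => [|N IH] x ox ha gen card.
  apply: (diamond_no_wall ha oy oy') => k.
  have := card; rewrite leqn0 => /eqP/card0_eq/(_ k); rewrite !inE => h.
  by rewrite lt_neqAle eq_sym mulf_neq0 ?ox ?ox' //= leNgt h.
pose cross k := dotp (s k) x * dotp (s k) x' < 0.
have [/existsP[k0 ck0]|] := boolP [exists k, cross k]; last first.
  rewrite negb_exists => /forallP h; apply: (diamond_no_wall ha oy oy') => k.
  by rewrite lt_neqAle eq_sym mulf_neq0 ?ox ?ox' //= leNgt h.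
pose time k := dotp (s k) x / (dotp (s k) x - dotp (s k) x').
have [k [ck kmin]] : exists k, cross k /\ forall l, cross l -> time k <= time l.
  by case: (@Order.TotalTheory.arg_minP _ _ _ k0 cross time ck0) => k ck h;
    exists k; split.
(* The next crossing time, or 1 if there is none; a point strictly between it and [time k] has
   crossed the wall [k] alone. *)
pose T0 : R := \big[Order.min/1]_(l | cross l && (l != k)) time l.
have /andP[tk0 tk1] : 0 < time k < 1 by exact: cross_time.
have tT0 : time k < T0.
  apply: lt_bigmin => // l /andP[cl lk]; rewrite lt_neqAle kmin // andbT.
  have [_ w1] := cross_gap ck; have [_ w2] := cross_gap cl.
  apply: contra_neq (gen k l _); last by rewrite eq_sym.
  move=> e; have n1 := neg_neq0l w1; have n2 := neg_neq0l w2.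
  move/eqP: e; rewrite /time eqr_div // => /eqP.
  by rewrite !mulrBr [_ * dotp (s k) x]mulrC => /addrI/oppr_inj.
have T01 : T0 <= 1 by exact: bigmin_le_id.
have [T [kT TT0]] : exists T, time k < T /\ T < T0.
  by exists ((time k + T0) / 2); split; lra.
have Tl l : cross l -> l != k -> T < time l.
  by move=> cl lk; apply: lt_le_trans TT0 _; apply: bigmin_le_cond; rewrite cl.
have T01' : 0 <= T <= 1 by apply/andP; split; lra.
pose x1 := x - T *: (x - x').
have dx1 g : dotp g x1 = dotp g x - T * (dotp g x - dotp g x').
  by rewrite /x1 dotpBr dotpZr dotpBr.
have stay l : l != k -> 0 < dotp (s l) x * dotp (s l) x1.
  move=> lk; rewrite dx1; have [cl|ncl] := boolP (cross l).
    by have [] := move_before cl (Tl l cl lk).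
  have pos : 0 < dotp (s l) x * dotp (s l) x'.
    by rewrite lt_neqAle eq_sym mulf_neq0 ?ox ?ox' //= leNgt.
  by have [] := move_stay pos T01'.
have [ck1 ck2] := move_after ck kT; rewrite -!dx1 in ck1 ck2.
have ox1 : off_walls x1.
  move=> l; have [->|lk] := eqVneq l k; first exact: neg_neq0r ck1.
  exact: pos_neq0r (stay l lk).
have [axx' ay ay'] := ha; have [a1 a2] := move_stay axx' T01'.
rewrite -!dx1 in a1 a2.
have sa1 : stays a x x1 y y' by split.
have sl1 l : l != k -> stays (s l) x x1 y y'.
  by move=> lk; split; rewrite ?oy ?oy' ?stay.
rewrite -(diamond_mul _ _ _ x1) (diamond_one_wall sa1 sl1 ck1 (oy k) (oy' k)).
rewrite (IH x1 ox1).
- rewrite /diamond_weight (bigD1 k) //= [RHS](bigD1 k) //= mulrA.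
  congr (_ * _).
    rewrite (wall_factor_split _ _ _ (ox k) (ox' k) T01'); last first.
      by move=> _; rewrite gt_eqF.
    by rewrite -dx1.
  apply: eq_bigr => l lk; rewrite (wall_factor_split _ _ _ (ox l) (ox' l) T01').
    by rewrite -dx1 (wall_factor_stay _ _ _ (stay l lk)) mul1r.
  by move=> cl; rewrite lt_eqF // Tl.
- by split.
(* Genericity survives the cut: the 2 x 2 determinants are multiplied by 1 - T, which is nonzero. *)
- move=> l j lj; rewrite !dx1 -subr_eq0.
  rewrite (_ : _ - _ = (1 - T) * (dotp (s l) x * dotp (s j) x' -
     dotp (s j) x * dotp (s l) x')); last by ring.
  by rewrite mulf_neq0 ?subr_eq0 ?gen // eq_sym lt_eqF //; lra.
- rewrite -ltnS; apply: leq_trans card; apply: proper_card.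
  apply/properP; split; last first.
    by exists k; rewrite !inE // -leNgt ltW.
  apply/fintype.subsetP => l; rewrite !inE => cl.
  have lk : l != k by apply: contraTneq cl => ->; rewrite -leNgt ltW.
  by rewrite (same_sign_neg _ (stay l lk)).
Qed.

End GeneralDiamond.

(** * Generic perturbation of a real vector *)

Section Perturbation.
Variable R : realType.
Implicit Types (x q g : 'rV[R]_3).

Lemma poly_near_neq0 (p : {poly R}) : p != 0 ->
  \forall e \near (0 : R)^', p.[e] != 0.
Proof.
move=> p0; have [m [q /implyP/(_ p0) q0 pE]] := multiplicity_XsubC p 0.
have h1 : \forall e \near (0 : R)^', q.[e] != 0.
  apply: nbhs_dnbhs; apply: (@near_neq0 _ _ _ (fun e : R => q.[e])).
    exact: continuous_horner.
  by move: q0; rewrite rootE.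
have h2 : \forall e \near (0 : R)^', e != 0 by exact: nbhs_dnbhs_neq.
apply: filterS2 h1 h2 => e qe e0.
by rewrite pE hornerM horner_exp hornerXsubC subr0 mulf_neq0 // expf_neq0.
Qed.

Definition moment (e : R) : 'rV[R]_3 := \row_i e ^+ i.

(** Along the moment curve (1, e, e^2) a covector becomes the polynomial with its own coordinates as
    coefficients. The factor ['X] keeps them apart from the constant term. *)
Lemma moment_poly q x : exists p : {poly R},
  (forall e, dotp q (x + e *: moment e) = p.[e]) /\ (q != 0 -> p != 0).
Proof.
pose r : {poly R} := \poly_(i < 3) q 0 (inord i).
exists ((dotp q x)%:P + 'X * r); split=> [e|].
  rewrite dotpDr dotpZr hornerD hornerC hornerM hornerX; congr (_ + _ * _).
  rewrite horner_poly /dotp; apply: eq_bigr => i _.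
  by rewrite mxE inord_val.
apply: contraNneq => p0; apply/eqP/rowP => i; rewrite mxE.
have := congr1 (fun p : {poly R} => p`_i.+1) p0.
by rewrite /= coefD coefC coefXM /= add0r coef_poly ltn_ord inord_val coef0.
Qed.

(** Finitely many nonzero polynomials have no zero at small e != 0, and the sign conditions are
    open. *)
Lemma generic_perturbation (I J : finType) (q : I -> 'rV[R]_3)
    (g : J -> 'rV[R]_3) x : (forall i, q i != 0) -> (forall j, dotp (g j) x != 0) ->
  exists x', (forall i, dotp (q i) x' != 0) /\
             forall j, 0 < dotp (g j) x * dotp (g j) x'.
Proof.
move=> q0 gx.
have hq : \forall e \near (0 : R)^', forall i, dotp (q i) (x + e *: moment e) != 0.
  apply: filter_forall => i; have [p [pE p0]] := moment_poly (q i) x.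
  by apply: filterS (poly_near_neq0 (p0 (q0 i))) => e; rewrite pE.
have hg : \forall e \near (0 : R)^', forall j,
    0 < dotp (g j) x * dotp (g j) (x + e *: moment e).
  apply: filter_forall => j; have [p [pE p0]] := moment_poly (g j) x.
  pose p' := (dotp (g j) x) *: p.
  have p'0 : 0 < p'.[0].
    rewrite /p' hornerZ -pE scale0r addr0.
    by rewrite -expr2 exprn_even_gt0 //= gx.
  apply: nbhs_dnbhs.
  have := @continuous_horner R p' 0; rewrite /continuous_at => h.
  have : \forall e \near (0 : R), 0 < p'.[e] by exact: (cvgr_gt _ h).
  by apply: filterS => e; rewrite /p' hornerZ pE.
have [e [h1 h2]] := filter_ex (filterI hq hg).
by exists (x + e *: moment e).
Qed.

End Perturbation.

(** * Transport along a side of the triangle *)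

Lemma near_forall (T : topologicalType) (J : finType) (P : J -> T -> Prop) (t : T) :
  (forall j, \forall t' \near t, P j t') -> \forall t' \near t, forall j, P j t'.
Proof. by move=> hP; exact: filter_forall. Qed.

Lemma near_gt0 (R : realType) (T : topologicalType) (f : T -> R) (t : T) :
  {for t, continuous f} -> 0 < f t -> \forall t' \near t, 0 < f t'.
Proof. by move=> cf ft; exact: (cvgr_gt _ cf). Qed.

Section Potential.
Variables (R : realType) (n : nat) (s : 'I_n -> 'rV[R]_3).
Local Notation CK := (complex_complex__canonical__Num_NumField R).
Local Notation C := (Num.NumField.sort CK).
Local Notation Re := (@complex.Re R).
Local Notation V := 'rV[C]_3.
Variable A : set (P2 CK).
Hypothesis hA : forall x, A x <-> forall k, rdot (s k) (hcoord x) != 0.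
Variable chi : character R A.
Local Notation tseg := (tseg chi).
Implicit Types (x y g h : 'rV[R]_3) (u : C) (w : V) (k l : 'I_n).

(** The index [None] adds an auxiliary functional, so that nonvanishing of all values makes a vector
    nonzero even without walls. *)
Definition extend_by g (j : option 'I_n) : 'rV[R]_3 := if j is Some k then s k else g.

Lemma hull3_extend g (w1 w2 w3 : V) :
  (forall j, avoids (extend_by g j) w1 w2 w3) -> hull3 s w1 w2 w3.
Proof.
move=> hj; apply: hull3_avoids => [k|]; first exact: (hj (Some k)).
by exists g; exact: (hj None).
Qed.

Section Chart.
Variables (g : 'rV[R]_3) (om : option 'I_n -> C).
(** An open convex cone: each functional is confined to the open half plane selected by [om j].
    Hence any triangle in it is good. *)
Definition chart : set V :=
  [set w | forall j, 0 < Re (om j * rdot (extend_by g j) w)].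

Lemma half_neq0 (z z' : C) : 0 < Re (z * z') -> z' != 0.
Proof. by apply: contraTneq => ->; rewrite mulr0 ltxx. Qed.

Lemma chart_hull w1 w2 w3 : chart w1 -> chart w2 -> chart w3 -> hull3 s w1 w2 w3.
Proof.
move=> h1 h2 h3; apply: (@hull3_extend g) => j.
apply: (@convex_half_plane _ (om j));
  rewrite ?addr_gt0 ?(ltW (h1 j)) ?(ltW (h2 j)) ?(ltW (h3 j)) ?h1 ?h2 ?h3 //.
- exact: half_neq0 (h1 j).
- exact: half_neq0 (h2 j).
- exact: half_neq0 (h3 j).
Qed.

Lemma chart_good w : chart w -> good s w.
Proof.
move=> cw; split; first exact: rdot_nz (half_neq0 (cw None)).
by move=> k; exact: half_neq0 (cw (Some k)).
Qed.

Lemma cts_rdot h : continuous (rdot h : V -> C).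
Proof. exact: continuous_dotp. Qed.

Lemma near_chart w : chart w -> \forall w' \near w, chart w'.
Proof.
move=> cw; suff : \forall w' \near w, forall j,
  0 < Re (om j * rdot (extend_by g j) w') by [].
apply: near_forall => j.
have ct : continuous (fun w' : V => Re (om j * rdot (extend_by g j) w') : R).
  apply: (@cts_comp _ _ _ (fun z : C => Re z)
    (fun w' => om j * rdot (extend_by g j) w')); first exact: continuous_Re.
  by apply: cts_mul; [exact: cts_cst|exact: cts_rdot].
by apply: near_gt0; [exact: ct|exact: cw].
Qed.

Variables (c : R -> P2 CK) (h : 'rV[R]_3).
Hypothesis vc : valid A c.

Definition lift t : V := affine_lift (cx h) (c t).

Lemma rdot_lift t : rdot h (hcoord (c t)) != 0 -> rdot h (lift t) = 1.
Proof. by move=> hc; rewrite /lift /affine_lift rdotZ mulVf. Qed.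

Lemma rdot_lift_neq0 t : rdot h (lift t) != 0 -> rdot h (hcoord (c t)) != 0.
Proof.
apply: contra_neq => e; rewrite /lift /affine_lift rdotZ -/(rdot _ _) e.
by rewrite mulr0.
Qed.

Lemma continuous_lift t : rdot h (hcoord (c t)) != 0 -> {for t, continuous lift}.
Proof.
move=> hc; apply: continuous_comp; first exact: vc.1.
exact: continuous_affine_lift.
Qed.

(** For t close to t0 the lifted arc stays in the convex chart and can be replaced by its chord. *)
Lemma transport_local t0 : rdot h (hcoord (c t0)) != 0 -> chart (lift t0) ->
  \forall t \near t0, [/\ rdot h (hcoord (c t)) != 0, chart (lift t) &
    transport chi (subpath c t0 t) = tseg (lift t0) (lift t)].
Proof.
move=> ht0 ct0.
have h1 : \forall t \near t0, rdot h (hcoord (c t)) != 0.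
  have cl : {for t0, continuous (fun t => rdot h (lift t) : C)}.
    apply: continuous_comp; first exact: continuous_lift.
    exact: cts_rdot.
  have := near_neq0 cl; rewrite rdot_lift // => /(_ (oner_neq0 _)).
  by apply: filterS => t; exact: rdot_lift_neq0.
have h2 : \forall t \near t0, chart (lift t).
  by have := continuous_lift ht0; apply; exact: near_chart.
have : \forall t \near t0, rdot h (hcoord (c t)) != 0 /\ chart (lift t).
  by apply: filterS2 h1 h2.
move=> /(@nbhs_ballP R R^o)[e /= e0 be].
apply/(@nbhs_ballP R R^o); exists e => [|t bt]; first exact: e0.
have seg (r : R) : 0 <= r <= 1 -> ball t0 e (t0 + r * (t - t0)).
  move=> /andP[r0 r1]; rewrite /ball /= opprD addNKr normrN normrM.
  rewrite ger0_norm //; apply: le_lt_trans bt.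
  by rewrite -[X in _ <= X]mul1r distrC ler_wpM2r // distrC.
have [ht ct] := be t bt; split; [exact: ht|exact: ct|].
pose d (r : R) := lift (t0 + clamp r * (t - t0)).
have cl0 : clamp (0 : R) = 0 by rewrite clamp_id // lexx ler01.
have cl1 : clamp (1 : R) = 1 by rewrite clamp_id // lexx ler01.
have d0 : d 0 = lift t0 by rewrite /d cl0 mul0r addr0.
have d1 : d 1 = lift t by rewrite /d cl1 mul1r addrC subrK.
have cd r : 0 <= r <= 1 -> chart (d r).
  move=> r01; have [_ cr] := be _ (seg r r01).
  by rewrite /d clamp_id //; exact: cr.
have i0 : 0 <= (0 : R) <= 1 by rewrite lexx ler01.
have i1 : 0 <= (1 : R) <= 1 by rewrite lexx ler01.
apply: etrans (f_equal2 tseg d0 d1); apply: (@tseg_path _ _ s A hA chi _ d).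
- exact: valid_subpath.
- move=> r; apply: (@continuous_comp _ _ _ (fun r : R => t0 + clamp r * (t - t0)) lift).
    apply: (@cts_add _ R R^o (fun=> t0)); first exact: cts_cst.
    by apply: (@cts_mul _ R); [exact: continuous_clamp|exact: cts_cst].
  by apply: continuous_lift; exact: (be _ (seg _ (clamp01 r))).1.
- move=> r r01; rewrite /d clamp_id //; apply: esym; apply: affine_liftK.
  exact: (be _ (seg r r01)).1.
- move=> a r a01 r01; rewrite convex_combE.
  move: (a01) (r01) => /andP[a0 a1] /andP[r0 r1].
  by apply: (chart_hull (cd r r01) (cd 0 i0) (cd 1 i1));
    rewrite ?mulr_ge0 ?subr_ge0 //; ring.
Qed.

End Chart.
End Potential.

Lemma near_all (T : topologicalType) (P : T -> Prop) (t : T) :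
  (forall t', P t') -> \forall t' \near t, P t'.
Proof. by move=> hP; exact: nearW. Qed.

Lemma near_imp2 (T : topologicalType) (P Q P' : T -> Prop) (t : T) :
  (forall t', P t' -> Q t' -> P' t') -> (\forall t' \near t, P t') ->
  (\forall t' \near t, Q t') -> \forall t' \near t, P' t'.
Proof. by move=> h hP hQ; apply: filterS2 hP hQ. Qed.

Lemma near_imp (T : topologicalType) (P P' : T -> Prop) (t : T) :
  (forall t', P t' -> P' t') -> (\forall t' \near t, P t') ->
  \forall t' \near t, P' t'.
Proof. by move=> h hP; apply: filterS hP. Qed.

Lemma locally_constant (R : realType) (T : Type) (h : R -> T) :
  (forall t0, \forall t \near t0, h t = h t0) -> forall a b, h b = h a.
Proof.
move=> hloc a b; have cR : connected [set: R].
  by apply/connected_intervalP => x y _ _ z _.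
have : [set t | h t = h a] = setT.
  apply: cR; first by exists a.
  - exists [set t | h t = h a]; last by rewrite setTI.
    rewrite openE => t /= ht.
    by apply: near_imp (hloc t) => t' e /=; rewrite e.
  - exists [set t | h t = h a]; last by rewrite setTI.
    rewrite -openC openE => t /= ht.
    by apply: near_imp (hloc t) => t' e /=; rewrite e.
by move=> /seteqP[_ /(_ b I)].
Qed.

(** * A potential for the transport on a complex line *)

Section LinePotential.
Variables (R : realType) (n : nat) (s : 'I_n -> 'rV[R]_3).
Local Notation CK := (complex_complex__canonical__Num_NumField R).
Local Notation C := (Num.NumField.sort CK).
Local Notation Re := (@complex.Re R).
Local Notation Im := (@complex.Im R).
Local Notation V := 'rV[C]_3.
Local Notation "x %:C" := (real_complex R x : C).
Local Notation I := ('i%C : C).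
Variable A : set (P2 CK).
Hypothesis hA : forall x, A x <-> forall k, rdot (s k) (hcoord x) != 0.
Variable chi : character R A.
Local Notation tseg := (tseg chi).
Variables v p q p' q' : 'rV[R]_3.
Hypothesis hline : forall w : V, rdot v w = 0 ->
  w = rdot p' w *: cx p + rdot q' w *: cx q.
Hypothesis dual_pp : dotp p' p = 1.
Hypothesis dual_pq : dotp p' q = 0.
Hypothesis dual_qp : dotp q' p = 0.
Hypothesis dual_qq : dotp q' q = 1.
Hypothesis off_p : off_walls s p.
Hypothesis edge_real : forall r : R, off_walls s (r *: p + q) ->
  edge chi (r *: p + q) p = edge chi (r *: p + q) (- p).
Implicit Types (u w : C) (g : 'rV[R]_3) (sg : R).

Definition point_at u : V := u *: cx p + cx q.
(** At real points the sign 1 is a convention; by [edge_real] the other ray has the same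
    transport. *)
Definition sgn_Im u : R := if 0 <= Im u then 1 else -1.
(** A multiple of [p] such that the segment from [point_at u] has affine coordinate u + i sg t / (1
    - t) at time t: a ray parallel to the imaginary axis. *)
Definition end_at sg : V := (I * sg%:C) *: cx p.
Definition pot u : C := tseg (point_at u) (end_at (sgn_Im u)).

(* The holonomy from x to the point p of the line v = 0 (the point at        *)
(* infinity of the affine coordinate u), along a ray parallel to the         *)
(* imaginary axis of u that does not cross the real axis.                    *)
Definition line_pot (x : P2 CK) : C :=
  if rdot q' (hcoord x) == 0 then 1
  else pot (rdot p' (hcoord x) / rdot q' (hcoord x)).

Lemma rdot_point_at g u : rdot g (point_at u) = u * (dotp g p)%:C + (dotp g q)%:C.
Proof. by rewrite rdotD rdotZ !rdot_cx. Qed.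

Lemma rdot_end_at g sg : rdot g (end_at sg) = I * (sg * dotp g p)%:C.
Proof. by rewrite rdotZ rdot_cx rmorphM mulrA. Qed.

Lemma point_at_real (r : R) : point_at r%:C = cx (r *: p + q).
Proof. by apply/rowP => j; rewrite !mxE rmorphD rmorphM. Qed.

Lemma end_at1 : end_at 1 = I *: cx p.
Proof. by rewrite /end_at rmorph1 mulr1. Qed.

Lemma end_atN1 : end_at (-1) = I *: cx (- p).
Proof. by apply/rowP => j; rewrite !mxE rmorphN rmorph1 mulrN1 mulNr rmorphN mulrN. Qed.

Lemma sgn_ImP u : sgn_Im u = 1 \/ sgn_Im u = -1.
Proof. by rewrite /sgn_Im; case: ifP; [left|right]. Qed.

Lemma pot_real (r : R) sg : off_walls s (r *: p + q) -> sg = 1 \/ sg = -1 ->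
  pot r%:C = tseg (point_at r%:C) (end_at sg).
Proof.
move=> or; have e : pot r%:C = edge chi (r *: p + q) p.
  rewrite /pot (_ : sgn_Im r%:C = 1); last by rewrite /sgn_Im lexx.
  apply: (f_equal2 tseg); [exact: point_at_real|exact: end_at1].
case=> ->; apply: (etrans e).
  by apply: (f_equal2 tseg); apply: esym; [exact: point_at_real|exact: end_at1].
apply: (etrans (edge_real or)).
by apply: (f_equal2 tseg); apply: esym; [exact: point_at_real|exact: end_atN1].
Qed.

(** A real functional with value b at [p] has imaginary part b Im u at [point_at u], so the three
    images lie in one open half plane bounded by the real axis. *)
Lemma hull3_same_side g u0 u sg : 0 < sg * Im u0 -> 0 < sg * Im u ->
  sg * sg = 1 -> (forall j, dotp (extend_by s g j) p != 0) ->
  hull3 s (point_at u0) (point_at u) (end_at sg).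
Proof.
move=> h0 h1 sg2 gp; apply: (@hull3_extend _ _ _ g) => j.
have b2 : 0 < dotp (extend_by s g j) p * dotp (extend_by s g j) p.
  by rewrite -expr2 exprn_even_gt0 //= gp.
set b := dotp _ p in b2.
have ImE w : sg * b * Im (rdot (extend_by s g j) (point_at w)) = sg * Im w * (b * b).
  by rewrite rdot_point_at ImD Im_mulr /= -/b; ring.
have ImE' : sg * b * Im (rdot (extend_by s g j) (end_at sg)) = b * b.
  rewrite rdot_end_at Im_mulr /= -/b mul1r mulrACA sg2 mul1r //.
have q0 : 0 < sg * b * Im (rdot (extend_by s g j) (point_at u0)).
  by rewrite ImE mulr_gt0.
have q1 : 0 < sg * b * Im (rdot (extend_by s g j) (point_at u)).
  by rewrite ImE mulr_gt0.
have q2 : 0 < sg * b * Im (rdot (extend_by s g j) (end_at sg)) by rewrite ImE'.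
have n0 := Im_neq0 q0; have n1 := Im_neq0 q1; have n2 := Im_neq0 q2.
rewrite -Re_NiM in q0; rewrite -Re_NiM in q1; rewrite -Re_NiM in q2.
exact: (convex_half_plane n0 n1 n2 (ltW q0) (ltW q1) (ltW q2)
  (addr_gt0 q0 q1) (addr_gt0 q1 q2) (addr_gt0 q0 q2)).
Qed.

Lemma hull3_real_base g (om : option 'I_n -> R) (w0 w1 : V) (c : C) :
  (forall j, dotp (extend_by s g j) p != 0) ->
  chart s g (fun j => (om j)%:C) w0 -> chart s g (fun j => (om j)%:C) w1 ->
  (forall j, 0 <= Re ((om j)%:C * (c * (dotp (extend_by s g j) p)%:C))) -> c != 0 ->
  hull3 s w0 w1 (c *: cx p).
Proof.
move=> gp c0 c1 hc cn; apply: (@hull3_extend _ _ _ g) => j.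
rewrite /avoids rdotZ rdot_cx.
have h0 := c0 j; have h1 := c1 j; have h2 := hc j.
apply: (@convex_half_plane _ (om j)%:C);
  rewrite ?(ltW h0) ?(ltW h1) ?h2 ?(addr_gt0 h0 h1) ?(ltr_wpDr h2 h0) ?(ltr_wpDr h2 h1) //.
- exact: half_neq0 h0.
- exact: half_neq0 h1.
- by rewrite mulf_neq0 ?real_complex_neq0.
Qed.

Definition lp_coord (x : P2 CK) : C := rdot p' (hcoord x) / rdot q' (hcoord x).

Lemma rdot_affine_lift g h (x : P2 CK) :
  rdot g (affine_lift (cx h) x) = rdot g (hcoord x) / rdot h (hcoord x).
Proof. by rewrite rdotZ mulrC. Qed.

Lemma affine_lift_line h (x : P2 CK) : rdot v (hcoord x) = 0 ->
  affine_lift (cx h) x = (rdot p' (hcoord x) / rdot h (hcoord x)) *: cx p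
    + (rdot q' (hcoord x) / rdot h (hcoord x)) *: cx q.
Proof.
move=> vx; rewrite [LHS]hline ?rdot_affine_lift //.
by rewrite vx mul0r.
Qed.

Lemma affine_lift_fin (x : P2 CK) : rdot v (hcoord x) = 0 ->
  rdot q' (hcoord x) != 0 -> affine_lift (cx q') x = point_at (lp_coord x).
Proof. by move=> vx qx; rewrite affine_lift_line // divff // scale1r. Qed.

(** Complex conjugation; as multiplier of a chart it centres the half plane on the value z. *)
Definition conj_re_im (z : C) : C := ((Re z)%:C - I * (Im z)%:C).

Lemma conj_pos (z : C) : z != 0 -> 0 < Re (conj_re_im z * z).
Proof.
case: z => a b z0; have h : (a != 0) || (b != 0).
  by move: z0; rewrite eq_complex negb_and.
rewrite (_ : complex.Re _ = a ^+ 2 + b ^+ 2); last first.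
  by rewrite /conj_re_im /=; ring.
rewrite lt_neqAle addr_ge0 ?sqr_ge0 // andbT eq_sym paddr_eq0 ?sqr_ge0 //.
by rewrite !expf_eq0 /= negb_and.
Qed.

(** If u0 is not real, u stays in the same half plane and both rays end alike. If u0 is real, u may
    lie on either side, but the potential at u0 can be computed with the ray that suits u. *)
Lemma pot_step g u0 u : (forall j, dotp (extend_by s g j) p != 0) ->
  good s (point_at u0) ->
  chart s g (fun j => conj_re_im (rdot (extend_by s g j) (point_at u0))) (point_at u0) ->
  chart s g (fun j => conj_re_im (rdot (extend_by s g j) (point_at u0))) (point_at u) ->
  (Im u0 != 0 -> 0 < Im u0 * Im u) ->
  tseg (point_at u0) (point_at u) * pot u = pot u0.
Proof.
move=> gp gu0 c0 c1 him.
have [Im0|Im0] := eqVneq (Im u0) 0; last first.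
  have sE : sgn_Im u = sgn_Im u0.
    move: (him Im0); rewrite /sgn_Im; case: (lerP 0 (Im u0)) => h0.
      have h0' : 0 < Im u0 by rewrite lt_neqAle eq_sym Im0.
      by rewrite pmulr_rgt0 // => /ltW ->.
    by rewrite nmulr_rgt0 // => h; rewrite leNgt h.
  have sp : 0 < sgn_Im u0 * Im u0.
    rewrite /sgn_Im; case: (lerP 0 (Im u0)) => h0.
      by rewrite mul1r lt_neqAle eq_sym Im0.
    by rewrite mulN1r oppr_gt0.
  rewrite /pot sE; apply: (tseg_triangle hA); apply: (@hull3_same_side g) => //.
    by apply: same_sign_trans (him Im0); rewrite mulrC.
  by case: (sgn_ImP u0) => ->; rewrite ?mulrNN mulr1.
have ur : u0 = (Re u0)%:C by case: (u0) Im0 => a b /= ->.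
have or : off_walls s (Re u0 *: p + q).
  move=> k; have := gu0.2 k; rewrite ur point_at_real rdot_cx.
  by apply: contra_neq => ->.
have omE j : conj_re_im (rdot (extend_by s g j) (point_at u0)) =
    (dotp (extend_by s g j) (Re u0 *: p + q))%:C.
  by rewrite {1}ur point_at_real rdot_cx /conj_re_im /= mulr0 subr0.
have e : (fun j => conj_re_im (rdot (extend_by s g j) (point_at u0))) =
    (fun j => (dotp (extend_by s g j) (Re u0 *: p + q))%:C).
  by apply/funext => j; exact: omE.
rewrite e in c0 c1.
have -> : pot u0 = tseg (point_at u0) (end_at (sgn_Im u)).
  by rewrite ur; apply: pot_real => //; exact: sgn_ImP.
apply: (tseg_triangle hA); apply: (hull3_real_base gp c0 c1) => [j|].
  by rewrite Re_realM Re_mulr Re_mulr /= !mul0r mulr0.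
by rewrite mulf_neq0 ?neq0Ci ?real_complex_neq0 //; case: (sgn_ImP u) => ->;
  rewrite ?oppr_eq0 oner_neq0.
Qed.

Lemma line_pot_fin (x : P2 CK) : rdot q' (hcoord x) != 0 ->
  line_pot x = pot (lp_coord x).
Proof. by rewrite /line_pot => /negbTE ->. Qed.

Lemma exists_separating u : exists g,
  rdot g (point_at u) != 0 /\ dotp g p != 0.
Proof.
(* The value of q' + e p' at [point_at u] is e u + 1; for e = 1 it vanishes only at u = -1. *)
pose e : R := if u == -1 then -1 else 1.
have e0 : e != 0 by rewrite /e; case: ifP; rewrite ?oppr_eq0 oner_neq0.
exists (q' + e *: p').
have gp : dotp (q' + e *: p') p = e.
  by rewrite dotpC dotpDr dotpZr ![dotp p _]dotpC dual_qp dual_pp add0r mulr1.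
have gq : dotp (q' + e *: p') q = 1.
  by rewrite dotpC dotpDr dotpZr ![dotp q _]dotpC dual_qq dual_pq mulr0 addr0.
split; last by rewrite gp.
rewrite rdot_point_at gp gq /e; have [->|u1] := eqVneq u (-1).
  by rewrite rmorphN rmorph1 mulrNN mulr1 -[_ + _]/(2%:R) pnatr_eq0.
by rewrite rmorph1 mulr1 addr_eq0.
Qed.

Lemma line_pot_near_fin (c : R -> P2 CK) t0 : valid A c ->
  (forall t, rdot v (hcoord (c t)) = 0) -> rdot q' (hcoord (c t0)) != 0 ->
  \forall t \near t0,
    transport chi (subpath c t0 t) * line_pot (c t) = line_pot (c t0).
Proof.
move=> vc cv q0.
set u0 := lp_coord (c t0).
have lE t : rdot q' (hcoord (c t)) != 0 -> lift c q' t = point_at (lp_coord (c t)).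
  by move=> h; apply: affine_lift_fin.
have [g [gu gp]] := exists_separating u0.
have gpj j : dotp (extend_by s g j) p != 0 by case: j => [k|] //=; exact: off_p.
have gu0 : good s (point_at u0).
  rewrite -lE // /lift; apply: goodZ; first by rewrite invr_eq0.
  exact: (toP_good hA (vc.2 t0)).
pose om j := conj_re_im (rdot (extend_by s g j) (point_at u0)).
have c0 : chart s g om (point_at u0).
  by move=> j; apply: conj_pos; case: j => [k|] //=; exact: gu0.2.
have c0' : chart s g om (lift c q' t0) by rewrite lE.
have h1 := transport_local hA chi vc q0 c0'.
have h2 : \forall t \near t0, Im u0 != 0 -> 0 < Im u0 * Im (lp_coord (c t)).
  have [Im0|Im0] := eqVneq (Im u0) 0.
    by apply: near_all => t.
  have ct : {for t0, continuous (fun t => Im u0 * Im (rdot p' (lift c q' t)) : R)}.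
    have cl := continuous_lift vc q0.
    have cI : continuous (fun w : V => Im u0 * Im (rdot p' w) : R).
      apply: (@cts_mul _ R); first exact: cts_cst.
      apply: (@cts_comp _ _ _ (fun z : C => Im z) (fun w : V => rdot p' w)).
        exact: continuous_Im.
      exact: cts_rdot.
    exact: (@continuous_comp _ _ _ (lift c q') _ t0 cl (cI _)).
  have : 0 < Im u0 * Im (rdot p' (lift c q' t0)).
    by rewrite rdot_affine_lift -expr2 exprn_even_gt0.
  move=> /(near_gt0 ct) h2; apply: near_imp2 h1 h2 => t _.
  by rewrite rdot_affine_lift => h _; exact: h.
apply: near_imp2 h1 h2 => t [qt ct ->] him.
rewrite !line_pot_fin // (lE _ q0) (lE _ qt).
apply: (pot_step gpj gu0 c0 _ him).
by rewrite -lE.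
Qed.

Lemma I_neq0 : I != 0.
Proof. by rewrite eq_complex /= oner_eq0 andbF. Qed.

Lemma Im_inverse u w : w * u = 1 -> Im w = - (Im u * (Re w ^+ 2 + Im w ^+ 2)).
Proof.
case: u w => a b [c d] e.
have e1 : c * a - d * b = 1 by have := congr1 Re e.
have e2 : c * b + d * a = 0 by have := congr1 Im e.
rewrite /= -[LHS]mulr1 -e1 mulrBr mulrCA.
have -> : d * a = - (c * b) by apply/eqP; rewrite -addr_eq0 addrC e2.
by ring.
Qed.

(** Near [p] the coordinate is w = 1 / u. Scaled by w, the segment defining [pot u] runs from p + w
    q to a multiple e p with Re e >= 0; the triangle with [p] is good, and its side from p to e p is
    projectively constant. *)
Lemma line_pot_near_inf (c : R -> P2 CK) t0 : valid A c ->
  (forall t, rdot v (hcoord (c t)) = 0) -> rdot q' (hcoord (c t0)) = 0 ->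
  \forall t \near t0,
    transport chi (subpath c t0 t) * line_pot (c t) = line_pot (c t0).
Proof.
move=> vc cv q0.
have p0 : rdot p' (hcoord (c t0)) != 0.
  apply: contraTneq (hcoord_neq0 (c t0)) => e; rewrite negbK.
  by rewrite [hcoord _]hline // e q0 !scale0r addr0.
pose w t : C := rdot q' (hcoord (c t)) / rdot p' (hcoord (c t)).
have lE t : rdot p' (hcoord (c t)) != 0 -> lift c p' t = cx p + w t *: cx q.
  by move=> h; rewrite /lift affine_lift_line // divff // scale1r.
have l0 : lift c p' t0 = cx p by rewrite lE // /w q0 mul0r scale0r addr0.
have gpj j : dotp (extend_by s p' j) p != 0.
  by case: j => [k|] /=; [exact: off_p|rewrite dual_pp oner_neq0].
pose om j : R := dotp (extend_by s p' j) p.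
have om2 j : 0 < om j * om j by rewrite -expr2 exprn_even_gt0 //= gpj.
have c0 : chart s p' (fun j => (om j)%:C) (cx p).
  by move=> j; rewrite rdot_cx Re_realM; exact: om2.
have c0' : chart s p' (fun j => (om j)%:C) (lift c p' t0) by rewrite l0.
have h1 := transport_local hA chi vc p0 c0'.
apply: near_imp h1 => t [pt ct ->].
rewrite l0 [line_pot (c t0)]/line_pot q0 eqxx /line_pot.
have gp : good s (cx p) := chart_good c0.
have [qt|qt] := eqVneq (rdot q' (hcoord (c t))) 0.
  by rewrite mulr1 lE // /w qt mul0r scale0r addr0; exact: (tseg_id hA).
set u := rdot p' _ / _.
have wu : w t * u = 1.
  by rewrite /w /u mulrA divfK // divff.
have w0 : w t != 0 by rewrite mulf_neq0 // invr_eq0.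
pose e : C := w t * (I * (sgn_Im u)%:C).
have potE : pot u = tseg (lift c p' t) (e *: cx p).
  apply: etrans (esym (tseg_scale chi _ _ w0)) _.
  apply: (f_equal2 tseg); last by rewrite /end_at scalerA.
  by rewrite (lE _ pt) /point_at scalerDr scalerA wu scale1r.
have e0 : e != 0.
  apply: mulf_neq0; first exact: w0.
  apply: mulf_neq0; first exact: I_neq0.
  apply: real_complex_neq0.
  by case: (sgn_ImP u) => ->; rewrite ?oppr_eq0 oner_neq0.
have Ree : 0 <= Re e.
  (* As w = 1 / u, the imaginary parts of w and u have opposite signs, so Re e = |Im u| |w|^2. *)
  have -> : Re e = - (sgn_Im u * Im (w t)).
    by rewrite /e mulrA Re_mulr; case: (w t) => a b /=; ring.
  rewrite (Im_inverse wu) mulrN opprK mulrA.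
  apply: mulr_ge0; last by apply: addr_ge0; exact: sqr_ge0.
  rewrite /sgn_Im; case: (lerP 0 (Im u)) => h; first by rewrite mul1r.
  by rewrite mulN1r oppr_ge0 ltW.
rewrite potE; clearbody e u w; rewrite (tseg_triangle hA).
  apply: (tseg_ray hA chi gp) => r /andP[r0 r1].
  have [->|rn1] := eqVneq r 1; first by rewrite rmorph1 mul1r addrC subrK.
  apply: (@half_neq0 _ 1); rewrite mul1r ReD Re_realM.
  have -> : Re (e - 1) = Re e - 1 by case: (e) => a b.
  have r1' : r < 1 by rewrite lt_neqAle rn1.
  have : 0 <= r * Re e by rewrite mulr_ge0.
  by rewrite /=; lra.
apply: (hull3_real_base gpj c0 ct _ e0) => j.
rewrite Re_realM Re_mulr mulrCA.
apply: mulr_ge0; [exact: Ree|exact: ltW (om2 j)].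
Qed.

Lemma line_pot_near (c : R -> P2 CK) t0 : valid A c ->
  (forall t, rdot v (hcoord (c t)) = 0) ->
  \forall t \near t0,
    transport chi (subpath c t0 t) * line_pot (c t) = line_pot (c t0).
Proof.
move=> vc cv; have [e|e] := eqVneq (rdot q' (hcoord (c t0))) 0.
  exact: line_pot_near_inf.
exact: line_pot_near_fin.
Qed.

(** Transport from a to t times the potential at t is locally constant in t. This handles an
    arbitrary continuous arc without deforming it. *)
Lemma transport_line (c : R -> P2 CK) (a b : R) : valid A c ->
  (forall t, rdot v (hcoord (c t)) = 0) ->
  transport chi (subpath c a b) * line_pot (c b) = line_pot (c a).
Proof.
move=> vc cv.
pose h t := transport chi (subpath c a t) * line_pot (c t).
have loc t0 : \forall t \near t0, h t = h t0.
  apply: near_imp (line_pot_near t0 vc cv) => t e.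
  by rewrite /h -(transport_subpath chi a t0 t vc) -mulrA e.
have -> : line_pot (c a) = h a.
  by rewrite /h transport_subpath_id // mul1r.
exact: locally_constant.
Qed.

End LinePotential.

(** * The holonomy of the triangle *)

Section GenericPosition.
Variables (R : realType) (n : nat) (s : 'I_n -> 'rV[R]_3).
Local Notation CK := (complex_complex__canonical__Num_NumField R).
Local Notation C := (Num.NumField.sort CK).
Local Notation V := 'rV[C]_3.
Local Notation "x %:C" := (real_complex R x : C).
Local Notation I := ('i%C : C).
Variable A : set (P2 CK).
Hypothesis hA : forall x, A x <-> forall k, rdot (s k) (hcoord x) != 0.
Variables (chi : character R A) (xi : 'I_n -> C) (vv : 'I_3 -> 'rV[R]_3).
Hypothesis hmer : forall k (p v : V) (h : R), 0 < h -> rdot (s k) p = 0 ->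
  (forall t : C, `|t| <= h%:C ->
    [/\ rdot (s k) (p + t *: v) = 0 -> t = 0,
        forall l, l != k -> rdot (s l) (p + t *: v) != 0 &
        forall i, rdot (vv i) (p + t *: v) != 0]) ->
  transport chi (fun t : R => toP (p + (h%:C * expi (2 * pi * t)) *: v)) = xi k.
Hypothesis hY : forall k, exists Y, dotp (s k) Y = 0 /\
  forall i, dotp (vv i) Y != 0.
Hypothesis hprop : forall k l (c : R), k != l -> s k <> c *: s l.
Implicit Types (x y a g : 'rV[R]_3) (k l : 'I_n).

Lemma dotpDl a b x : dotp (a + b) x = dotp a x + dotp b x.
Proof. by rewrite !(dotpC _ x) dotpDr. Qed.

Lemma dotpZl (c : R) a x : dotp (c *: a) x = c * dotp a x.
Proof. by rewrite !(dotpC _ x) dotpZr. Qed.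

Lemma dotpBl a b x : dotp (a - b) x = dotp a x - dotp b x.
Proof. by rewrite !(dotpC _ x) dotpBr. Qed.

Lemma diamondE a x x' y y' : stays a x x' y y' ->
  off_walls s x -> off_walls s x' -> off_walls s y -> off_walls s y' ->
  diamond chi x y x' y' = diamond_weight s xi x y x' y'.
Proof.
move=> ha ox ox' oy oy'.
(* Genericity with respect to [x'] means that these covectors do not vanish at the perturbed [x];
   the diagonal holds a nonzero filler. *)
pose q (kl : 'I_n * 'I_n) : 'rV[R]_3 :=
  if kl.1 == kl.2 then const_mx 1
  else dotp (s kl.2) x' *: s kl.1 - dotp (s kl.1) x' *: s kl.2.
have q0 kl : q kl != 0.
  case: kl => k l; rewrite /q /=; case: (eqVneq k l) => [_|kl].
    by apply/eqP => /rowP/(_ 0); rewrite !mxE => /eqP; rewrite oner_eq0.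
  rewrite subr_eq0; apply/eqP => e.
  apply: (hprop (c := (dotp (s l) x')^-1 * dotp (s k) x') kl).
  by rewrite -scalerA -e scalerA mulVf ?scale1r // ox'.
have [aL ay ay'] := ha.
have gx j : dotp (extend_by s a j) x != 0.
  by case: j => [k|] /=; [exact: ox|exact: pos_neq0l aL].
have [x1 [x1q x1g]] := generic_perturbation q0 gx.
have ax1 : 0 < dotp a x * dotp a x1 := x1g None.
have sx1 k : 0 < dotp (s k) x * dotp (s k) x1 := x1g (Some k).
have ox1 : off_walls s x1 by move=> k; exact: pos_neq0r (sx1 k).
have gen : generic s x1 x'.
  move=> k l kl; have := x1q (k, l); rewrite /q /= (negbTE kl).
  rewrite dotpBl !dotpZl subr_eq0; apply: contra_neq => e.
  by rewrite mulrC e mulrC.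
have ha1 : stays a x x1 y y' by split.
have ha2 : stays a x1 x' y y' by split=> //; exact: same_sign_trans ax1 aL.
rewrite -(diamond_mul _ _ _ x1) (diamond_same_chamber hA chi ha1) => [|k].
  rewrite mul1r (diamond_generic hA hmer hY ha2 ox1 ox' oy oy' gen (leqnn _)).
  by apply: eq_bigr => k _; rewrite -(wall_factor_eq_left _ _ _ _ (sx1 k)).
by split; [exact: sx1|exact: oy|exact: oy'].
Qed.

Lemma edge_ray x (sg : R) : off_walls s x -> x != 0 -> sg = 1 \/ sg = -1 ->
  edge chi x (sg *: x) = 1.
Proof.
move=> ox x0 hs.
have -> : edge chi x (sg *: x) = tseg chi (cx x) ((I * sg%:C) *: cx x).
  apply: (f_equal2 (tseg chi)) => //.
  by apply/rowP => j; rewrite !mxE rmorphM mulrA.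
apply: (tseg_ray hA) => [|t t01].
  split; last by move=> k; rewrite rdot_cx real_complex_neq0 // ox.
  by apply: contra_neq x0 => /rowP e; apply/rowP => j; have := e j;
    rewrite !mxE => /complexI.
have -> : 1 + t%:C * (I * sg%:C - 1) = ((1 - t) +i* (t * sg))%C.
  by rewrite /real_complex_def; simpc; congr (_ +i* _)%C; ring.
rewrite eq_complex /= negb_and; have [e|//] := eqVneq (1 - t) 0.
have -> : t = 1 by lra.
by rewrite mul1r; case: hs => ->; rewrite ?oppr_eq0 oner_neq0.
Qed.

Lemma edge_opp x y : edge chi (- x) (- y) = edge chi x y.
Proof.
have N1 : -1 != 0 :> C by rewrite oppr_eq0 oner_neq0.
apply: etrans (tseg_scale chi (cx x) (I *: cx y) N1).
apply: (f_equal2 (tseg chi)); apply/rowP => j; rewrite !mxE rmorphN.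
  by rewrite mulN1r.
by rewrite mulN1r mulrN.
Qed.

(** Multiplication by i carries the segment from iy to x to the edge from -y to ix, so the second
    factor is the first edge run backwards. *)
Lemma edge_turn a x y : off_walls s x -> off_walls s y ->
  dotp a x != 0 -> dotp a y != 0 -> edge chi x y * edge chi (- y) x = 1.
Proof.
move=> ox oy ax ay.
have -> : edge chi (- y) x = tseg chi (I *: cx y) (cx x).
  apply: etrans (tseg_scale chi (I *: cx y) (cx x) (I_neq0 R)).
  apply: (f_equal2 (tseg chi)); last by [].
  apply/rowP => j; rewrite !mxE rmorphN mulrA -expr2 sqr_i mulN1r //.
have fj j : dotp (extend_by s a j) x != 0 by case: j => [k|] /=; rewrite ?ox.
have fj' j : dotp (extend_by s a j) y != 0 by case: j => [k|] /=; rewrite ?oy.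
have gx : good s (cx x).
  split; last by move=> k; rewrite rdot_cx real_complex_neq0 // ox.
  by apply: (@rdot_nz _ a); rewrite rdot_cx real_complex_neq0.
rewrite (tseg_triangle hA) ?(tseg_id hA) //.
apply: (@hull3_extend _ _ _ a) => j; rewrite /avoids rdot_icx rdot_cx.
have b2 : 0 < dotp (extend_by s a j) x * dotp (extend_by s a j) x.
  by rewrite -expr2 exprn_even_gt0 //= fj.
have Re0 : complex.Re (I * (dotp (extend_by s a j) y)%:C) = 0.
  by rewrite Re_mulr mul0r.
have n0 := real_complex_neq0 (fj j).
have n1 : I * (dotp (extend_by s a j) y)%:C != 0.
  by apply: mulf_neq0; [exact: I_neq0|exact: real_complex_neq0].
set b := (dotp (extend_by s a j) x)%:C; set z := I * _.
have q0 : 0 < complex.Re (b * b) by rewrite Re_realM.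
have q1 : complex.Re (b * z) = 0 by rewrite Re_realM Re0 mulr0.
have le0 : 0 <= complex.Re (b * z) by rewrite q1.
have l01 : 0 < complex.Re (b * b) + complex.Re (b * z) by rewrite q1 addr0.
have l10 : 0 < complex.Re (b * z) + complex.Re (b * b) by rewrite q1 add0r.
exact: (convex_half_plane n0 n1 n0 (ltW q0) le0 (ltW q0) l01 l10 (addr_gt0 q0 q0)).
Qed.

End GenericPosition.

(** [P] is a union of equivalence classes, each of product 1; [h] labels a class by a representative
    picked from it. *)
Lemma prod_classes (F : comNzRingType) (J : finType) (same : rel J) (P : pred J)
    (f : J -> F) : equivalence_rel same ->
  (forall k l, same k l -> P k = P l) ->
  (forall k, \prod_(l | same k l) f l = 1) -> \prod_(l | P l) f l = 1.
Proof.
move=> eqv Psame f1.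
pose h l := [pick k | same k l].
have hE k l : (h l == h k) = same k l.
  have refl x : same x x by have [] := eqv x x x.
  have sym x y : same x y = same y x.
    apply/idP/idP => s1.
      by have [_ /(_ s1)] := eqv x y x; rewrite refl => <-.
    by have [_ /(_ s1)] := eqv y x y; rewrite refl => <-.
  have tr x y z : same x y -> same x z = same y z.
    by have [_] := eqv x y z.
  apply/eqP/idP => [|s1].
    rewrite /h; case: pickP => [a al|/(_ l)]; last by rewrite refl.
    case: pickP => [b bk [ab]|/(_ k)]; last by rewrite refl.
    by rewrite -(tr b k l bk) -ab.
  by apply: eq_pick => x; rewrite /= ![same x _]sym -(tr k l x s1).
rewrite (partition_big h xpredT) //=; apply: big1 => o _.
have [/existsP[k /andP[Pk /eqP hk]]|] := boolP [exists k, P k && (h k == o)].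
  apply: etrans (f1 k); apply: eq_bigl => l; rewrite -hk hE.
  by case skl: (same k l); rewrite ?andbF // -(Psame _ _ skl) Pk.
rewrite negb_exists => /forallP none.
by rewrite big_pred0 // => l; exact/negbTE/none.
Qed.

(** The two sign changes mean that x0, x1, x2 have the same sign; then x2 and -x0 have opposite
    signs and the winding is negative. This is the origin of the minus sign in the theorem. *)
Lemma wall_factor_triangle (R : realType) (F : fieldType) (z : F) (x0 x1 x2 : R) :
  wall_factor z x2 (- x1) (- x0) x1 =
  if (0 < x0 * x1) && (0 < x1 * x2) then z^-1 else 1.
Proof.
rewrite /wall_factor !mulrN !mulNr !oppr_lt0 oppr_gt0 [x2 * x1]mulrC andbC.
case h : ((0 < x0 * x1) && (0 < x1 * x2)) => //.
move: h => /andP[h0 h1]; rewrite ifF //; apply/negbTE; rewrite -leNgt ltW //.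
by apply: same_sign_trans h1 _; rewrite mulrC.
Qed.

Section Triangle.
Variables (R : realType) (n : nat) (s : 'I_n -> 'rV[R]_3).
Local Notation CK := (complex_complex__canonical__Num_NumField R).
Local Notation C := (Num.NumField.sort CK).
Local Notation V := 'rV[C]_3.
Local Notation "x %:C" := (real_complex R x : C).
Variable A : set (P2 CK).
Hypothesis hA : forall x, A x <-> forall k, rdot (s k) (hcoord x) != 0.
Variables (chi : character R A) (xi : 'I_n -> C) (vv e : 'I_3 -> 'rV[R]_3).
Hypothesis hmer : forall k (p v : V) (h : R), 0 < h -> rdot (s k) p = 0 ->
  (forall t : C, `|t| <= h%:C ->
    [/\ rdot (s k) (p + t *: v) = 0 -> t = 0,
        forall l, l != k -> rdot (s l) (p + t *: v) != 0 &
        forall i, rdot (vv i) (p + t *: v) != 0]) ->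
  transport chi (fun t : R => toP (p + (h%:C * expi (2 * pi * t)) *: v)) = xi k.
Hypothesis hprop : forall k l (c : R), k != l -> s k <> c *: s l.
Hypothesis hdual : forall i j, dotp (vv i) (e j) = (i == j)%:R.
Hypothesis hbasis : forall w : V, w = \sum_j rdot (vv j) w *: cx (e j).
Hypothesis hoff : forall j, off_walls s (e j).
(** The two walls meet the side of [e i] and [e j] in the same point; dually, the points S_k and S_l
    are collinear with the third V. *)
Definition same_line i j : rel 'I_n := fun k l =>
  dotp (s k) (e j) * dotp (s l) (e i) == dotp (s k) (e i) * dotp (s l) (e j).
Hypothesis hclass : forall i j k, i != j -> \prod_(l | same_line i j k l) xi l = 1.
Implicit Types (x y a g : 'rV[R]_3) (k l : 'I_n) (i j : 'I_3).

(** With a_i = s_k(e_i), all nonzero, the three terms of s_k(Y) are a_0 a_1 a_2 times 1, 1 and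
    -2. *)
Lemma meeting_points k : exists Y, dotp (s k) Y = 0 /\
  forall i, dotp (vv i) Y != 0.
Proof.
pose a i := dotp (s k) (e i).
exists ((a 1 * a 2) *: e 0 + (a 0 * a 2) *: e 1 + (- 2 * (a 0 * a 1)) *: e 2).
split=> [|i]; first by rewrite !dotpDr !dotpZr -/(a 0) -/(a 1) -/(a 2); ring.
have a0 j : a j != 0 by exact: hoff.
rewrite !dotpDr !dotpZr !hdual.
case: i => [] [|[|[|//]]] hi /=; rewrite ?mulr1 ?mulr0 ?addr0 ?add0r;
  by rewrite !mulf_neq0 ?oppr_eq0 ?pnatr_eq0.
Qed.

Lemma same_line_equiv i j : equivalence_rel (same_line i j).
Proof.
have ratio k l : same_line i j k l =
    (dotp (s k) (e j) / dotp (s k) (e i) == dotp (s l) (e j) / dotp (s l) (e i)).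
  by rewrite eqr_div ?hoff // /same_line [X in _ = (_ == X)]mulrC.
by move=> x y z; rewrite !ratio; split=> // /eqP ->.
Qed.

Lemma e_neq0 i : e i != 0.
Proof.
apply/eqP => e0; have := hdual i i; rewrite e0 dotp0r eqxx => /eqP.
by rewrite eq_sym oner_eq0.
Qed.

(** In the diamond with x = r e_i + e_j, x' = y = e_i and y' = -e_i, the two edges at e_i are
    trivial. Its walls, those separating x from e_i, form a union of classes of [same_line]. *)
Lemma edge_real_line i j (r : R) : i != j -> off_walls s (r *: e i + e j) ->
  edge chi (r *: e i + e j) (e i) = edge chi (r *: e i + e j) (- e i).
Proof.
move=> ij ox.
have ij0 : (i == j) = false by exact: negbTE.
have ji : (j == i) = false by rewrite eq_sym.
have ei0 := e_neq0 i.
have offN : off_walls s (- e i) by move=> k; rewrite dotpNr oppr_eq0 hoff.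
(* This functional is r + |r| + 1 > 0 at r e_i + e_j and 1 at e_i. *)
have st : stays (vv i + (`|r| + 1) *: vv j) (r *: e i + e j) (e i) (e i) (- e i).
  have E x : dotp (vv i + (`|r| + 1) *: vv j) x =
    dotp (vv i) x + (`|r| + 1) * dotp (vv j) x by rewrite dotpDl dotpZl.
  have Ei : dotp (vv i + (`|r| + 1) *: vv j) (e i) = 1.
    by rewrite E !hdual eqxx ji mulr0 addr0.
  split; rewrite ?dotpNr ?Ei ?oppr_eq0 ?oner_neq0 //.
  rewrite mulr1 E !dotpDr !dotpZr !hdual !eqxx ij0 ji mulr1 mulr0 addr0 add0r mulr1.
  by have := ler_norm (- r); rewrite normrN; lra.
have := diamondE hA hmer meeting_points hprop st ox (hoff i) (hoff i) offN.
have e1 : edge chi (e i) (e i) = 1.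
  have := edge_ray hA chi (hoff i) ei0 (or_introl (erefl 1)).
  by rewrite scale1r.
have eN1 : edge chi (e i) (- e i) = 1.
  have := edge_ray hA chi (hoff i) ei0 (or_intror (erefl (-1))).
  by rewrite scaleN1r.
rewrite /diamond e1 eN1 /cross_ratio mulr1 mul1r.
pose P := [pred l | dotp (s l) (r *: e i + e j) * dotp (s l) (e i) < 0].
have -> : diamond_weight s xi (r *: e i + e j) (e i) (e i) (- e i) = 1.
  have P1 : \prod_(l | P l) xi l = 1.
    apply: (prod_classes (same_line_equiv i j)) => [k l|k]; last exact: hclass.
    rewrite /P /= /same_line !dotpDr !dotpZr => /eqP h.
    have fk := hoff i k; have fl := hoff i l.
    set bk := dotp (s k) (e i) in h fk *; set bl := dotp (s l) (e i) in h fl *.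
    set ck := dotp (s k) (e j) in h *; set cl := dotp (s l) (e j) in h *.
    have k2 : 0 < bk * bk by rewrite -expr2 exprn_even_gt0.
    have l2 : 0 < bl * bl by rewrite -expr2 exprn_even_gt0.
    rewrite -(pmulr_llt0 ((r * bk + ck) * bk) l2).
    rewrite -(pmulr_llt0 ((r * bl + cl) * bl) k2).
    have -> // : (r * bk + ck) * bk * (bl * bl) = (r * bl + cl) * bl * (bk * bk).
    have -> : (r * bk + ck) * bk * (bl * bl) = r * bk * bk * bl * bl + (ck * bl) * bk * bl.
      by ring.
    by rewrite h; ring.
  apply: (@etrans _ _ (\prod_(l | P l) xi l)^-1); last by rewrite P1 invr1.
  rewrite /diamond_weight -prodfV [RHS]big_mkcond /=; apply: eq_bigr => k _.
  have fk := hoff i k.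
  rewrite /wall_factor !dotpNr mulrN.
  have k2 : 0 < dotp (s k) (e i) * dotp (s k) (e i).
    by rewrite -expr2 exprn_even_gt0.
  rewrite oppr_lt0 k2 andbT; case: ifP => // h.
  by rewrite ltNge ltW.
by move=> /(congr1 (fun z => z * edge chi (r *: e i + e j) (- e i)));
  rewrite mul1r divfK // edge_neq0.
Qed.

Lemma cx_e_neq0 i : cx (e i) != 0.
Proof. by apply: (@rdot_nz _ (vv i)); rewrite rdot_cx hdual eqxx oner_neq0. Qed.

Lemma rdot_vertex g i : exists2 z : C, z != 0 &
  rdot g (hcoord (toP (cx (e i)))) = z * (dotp g (e i))%:C.
Proof.
have [z z0 ez] := hcoord_toP (cx_e_neq0 i); exists z => //.
by rewrite ez rdotZ rdot_cx.
Qed.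

(** The arc goes from the point at infinity of the affine coordinate, of potential 1, to the point u
    = 0, whose potential is the edge. *)
Lemma transport_side (i j l : 'I_3) (c : R -> P2 CK) (a b : R) :
  i != j -> i != l -> j != l -> valid A c ->
  (forall t, rdot (vv l) (hcoord (c t)) = 0) ->
  c a = toP (cx (e i)) -> c b = toP (cx (e j)) ->
  transport chi (subpath c a b) * edge chi (e j) (e i) = 1.
Proof.
move=> ij il jl vc cl ca cb.
have ij0 : (i == j) = false by exact: negbTE.
have ji0 : (j == i) = false by rewrite eq_sym.
have hline (w : V) : rdot (vv l) w = 0 ->
    w = rdot (vv i) w *: cx (e i) + rdot (vv j) w *: cx (e j).
  move=> lw; rewrite {1}[w]hbasis (bigD1 i) //= (bigD1 j) //=; last by rewrite ji0.
  rewrite big1 ?addr0 // => h /andP[hi hj].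
  have -> : h = l.
    apply: val_inj; move: ij il jl hi hj; rewrite -!val_eqE /=.
    by move: (ltn_ord i) (ltn_ord j) (ltn_ord l) (ltn_ord h); lia.
  by rewrite lw scale0r.
have dii : dotp (vv i) (e i) = 1 by rewrite hdual eqxx.
have djj : dotp (vv j) (e j) = 1 by rewrite hdual eqxx.
have dij : dotp (vv i) (e j) = 0 by rewrite hdual ij0.
have dji : dotp (vv j) (e i) = 0 by rewrite hdual ji0.
have := transport_line hA hline dii dij dji djj (hoff i)
  (fun r => @edge_real_line i j r ij) a b vc cl.
have -> : line_pot chi (e i) (e j) (vv i) (vv j) (c a) = 1.
  rewrite /line_pot ca; have [z z0 ->] := rdot_vertex (vv j) i.
  by rewrite dji mulr0 eqxx.
have -> : line_pot chi (e i) (e j) (vv i) (vv j) (c b) = edge chi (e j) (e i).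
  rewrite /line_pot cb; have [z z0 ->] := rdot_vertex (vv j) j.
  have [z' z'0 ->] := rdot_vertex (vv i) j.
  rewrite djj dij rmorph1 mulr1 (negbTE z0) mulr0 mul0r.
  rewrite /pot /sgn_Im lexx.
  apply: (f_equal2 (tseg chi)); last exact: end_at1.
  by rewrite /point_at scale0r add0r.
by [].
Qed.

(** [c0], [c1], [c2] stay on one side of the triangle at all parameters, whereas [c] does so only on
    an interval each time. In the diamond e_2, -i e_0, -e_1, i e_1 one edge is trivial and the rest
    give the three sides. *)
Lemma transport_triangle_loop (c : R -> P2 CK) (t0 t1 t2 t3 : R) (c0 c1 c2 : R -> P2 CK) :
  valid A c -> valid A c0 -> valid A c1 -> valid A c2 ->
  (forall t, rdot (vv 0) (hcoord (c0 t)) = 0) ->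
  (forall t, rdot (vv 1) (hcoord (c1 t)) = 0) ->
  (forall t, rdot (vv 2) (hcoord (c2 t)) = 0) ->
  transport chi (subpath c t0 t1) = transport chi c0 ->
  transport chi (subpath c t1 t2) = transport chi c1 ->
  transport chi (subpath c t2 t3) = transport chi c2 ->
  c0 0 = toP (cx (e 1)) -> c0 1 = toP (cx (e 2)) ->
  c1 0 = toP (cx (e 2)) -> c1 1 = toP (cx (e 0)) ->
  c2 0 = toP (cx (e 0)) -> c2 1 = toP (cx (e 1)) ->
  transport chi (subpath c t0 t3) =
  \prod_(k | (0 < dotp (s k) (e 0) * dotp (s k) (e 1)) &&
             (0 < dotp (s k) (e 1) * dotp (s k) (e 2))) (xi k)^-1.
Proof.
move=> vc vc0 vc1 vc2 l0 l1 l2 E0 E1 E2 a0 b0 a1 b1 a2 b2.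
have S0 := @transport_side 1 2 0 c0 0 1 isT isT isT vc0 l0 a0 b0.
have S1 := @transport_side 2 0 1 c1 0 1 isT isT isT vc1 l1 a1 b1.
have S2 := @transport_side 0 1 2 c2 0 1 isT isT isT vc2 l2 a2 b2.
rewrite !subpath01 in S0 S1 S2.
rewrite -(transport_subpath chi t0 t2 t3 vc) -(transport_subpath chi t0 t1 t2 vc).
rewrite E0 E1 E2.
(* This functional is 1 at both e_2 and -e_1. *)
pose g : 'rV[R]_3 := vv 2 - vv 1 + vv 0.
have gE x : dotp g x = dotp (vv 2) x - dotp (vv 1) x + dotp (vv 0) x.
  by rewrite /g dotpDl dotpBl.
have offN i : off_walls s (- e i) by move=> k; rewrite dotpNr oppr_eq0 hoff.
have g0 : dotp g (e 0) = 1 by rewrite gE !hdual /=; ring.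
have g1 : dotp g (e 1) = -1 by rewrite gE !hdual /=; ring.
have g2 : dotp g (e 2) = 1 by rewrite gE !hdual /=; ring.
have st : stays g (e 2) (- e 1) (- e 0) (e 1).
  by split; rewrite ?dotpNr ?g0 ?g1 ?g2 ?opprK ?mulr1 ?ltr01 ?oppr_eq0 ?oner_neq0.
have D := diamondE hA hmer meeting_points hprop st (hoff 2) (offN 1) (offN 0) (hoff 1).
have eN : edge chi (- e 1) (e 1) = 1.
  have n1 : - e 1 != 0 by rewrite oppr_eq0 e_neq0.
  have := edge_ray hA chi (offN 1) n1 (or_intror (erefl (-1))).
  by rewrite scaleN1r opprK.
have e20 : edge chi (e 2) (- e 0) * edge chi (e 0) (e 2) = 1.
  have a20 : dotp g (e 0) != 0 by rewrite g0 oner_neq0.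
  have a22 : dotp g (e 2) != 0 by rewrite g2 oner_neq0.
  have h := edge_opp chi (e 2) (- e 0); rewrite opprK in h.
  have comb (x y z : C) : z = y -> x * z = 1 -> y * x = 1.
    by move=> <-; rewrite mulrC.
  exact: comb h (edge_turn hA chi (hoff 0) (hoff 2) a20 a22).
have e10 : edge chi (- e 1) (- e 0) = edge chi (e 1) (e 0) by exact: edge_opp.
have final (F : fieldType) (T0 T1 T2 b c' d f w : F) :
    T0 * b = 1 -> T1 * c' = 1 -> T2 * d = 1 -> f * c' = 1 ->
    cross_ratio f 1 d b = w -> T0 * T1 * T2 = w.
  move=> h0 h1 h2 h3 <-; rewrite /cross_ratio mulr1.
  have nb : b != 0 by apply: contra_eq_neq h0 => ->; rewrite mulr0 eq_sym oner_eq0.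
  have nc : c' != 0 by apply: contra_eq_neq h1 => ->; rewrite mulr0 eq_sym oner_eq0.
  have nd : d != 0 by apply: contra_eq_neq h2 => ->; rewrite mulr0 eq_sym oner_eq0.
  have -> : T0 = b^-1 by apply: (mulIf nb); rewrite h0 mulVf.
  have -> : T1 = c'^-1 by apply: (mulIf nc); rewrite h1 mulVf.
  have -> : T2 = d^-1 by apply: (mulIf nd); rewrite h2 mulVf.
  have -> : f = c'^-1 by apply: (mulIf nc); rewrite h3 mulVf.
  by field; rewrite nb nc nd.
apply: (final _ _ _ _ _ _ _ _ _ S0 S1 S2 e20).
apply: etrans (cross_ratio_congr (erefl _) (esym eN) (esym e10) (erefl _)) _.
apply: (etrans D).
rewrite /diamond_weight [RHS]big_mkcond /=; apply: eq_bigr => k _.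
by rewrite !dotpNr wall_factor_triangle.
Qed.

End Triangle.

(** * The vertices of the triangle as a dual basis *)

Section DualBasis.
Variables (R : realType) (vv : 'I_3 -> 'rV[R]_3).
Local Notation CK := (complex_complex__canonical__Num_NumField R).
Local Notation C := (Num.NumField.sort CK).
Let M : 'M[R]_3 := \matrix_i vv i.
Hypothesis M_full : row_full M.

(** The j-th vector spans the common point of the two lines D_i with i != j. *)
Definition dual_basis (j : 'I_3) : 'rV[R]_3 := row j (invmx M)^T.
Local Notation e := dual_basis.

Let M_unit : M \in unitmx. Proof. by rewrite -row_full_unit. Qed.

Lemma dual_basisP i j : dotp (vv i) (e j) = (i == j)%:R.
Proof.
have := congr1 (fun N : 'M[R]_3 => N i j) (mulmxV M_unit).
rewrite !mxE => <-; apply: eq_bigr => k _.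
by rewrite !mxE.
Qed.

Lemma covector_basis a : a = \sum_j dotp a (e j) *: vv j.
Proof.
rewrite -{1}[a](mulmxKV M_unit) mulmx_sum_row; apply: eq_bigr => j _.
rewrite rowK; congr (_ *: _); rewrite mxE; apply: eq_bigr => k _.
by rewrite !mxE.
Qed.

Lemma complex_dual_basis (w : 'rV[C]_3) : w = \sum_j rdot (vv j) w *: cx (e j).
Proof.
pose N : 'M[C]_3 := map_mx (real_complex R) M.
have NV : map_mx (real_complex R) (invmx M) *m N = 1%:M :> 'M[C]_3.
  by rewrite -map_mxM mulVmx // map_mx1.
apply: trmx_inj; rewrite -[LHS]mul1mx -NV -mulmxA.
apply/colP => h; rewrite mxE [RHS]mxE summxE; apply: eq_bigr => j _.
rewrite !mxE mulrC; congr (_ * _).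
by apply: eq_bigr => k _; rewrite !mxE.
Qed.

Lemma not_through_vertices (a : 'rV[R]_3) i j l : i != j -> i != l -> j != l ->
  (dotp a (e l) == 0) = (a <= vv i + vv j)%MS.
Proof.
move=> ij il jl.
have aE : a = dotp a (e i) *: vv i + dotp a (e j) *: vv j + dotp a (e l) *: vv l.
  rewrite [LHS]covector_basis (bigD1 i) //= (bigD1 j) /=; last by rewrite eq_sym.
  rewrite (bigD1 l) /=; last by rewrite eq_sym il eq_sym jl.
  rewrite big1 ?addr0 ?addrA // => h /andP[/andP[hi hj] hl].
  exfalso; move: ij il jl hi hj hl; rewrite -!val_eqE /=.
  by move: (ltn_ord i) (ltn_ord j) (ltn_ord l) (ltn_ord h); lia.
apply/eqP/idP => [al|/sub_addsmxP[[d1 d2] /= ->]].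
  rewrite aE al scale0r addr0 addmx_sub_adds // scalemx_sub //.
rewrite (mx11_scalar d1) (mx11_scalar d2) !mul_scalar_mx.
rewrite dotpDl !dotpZl !dual_basisP.
by rewrite (negbTE il) (negbTE jl) !mulr0 addr0.
Qed.

Lemma same_line_span (a b : 'rV[R]_3) i j l : i != j -> i != l -> j != l ->
  dotp a (e i) != 0 ->
  (dotp a (e j) * dotp b (e i) == dotp a (e i) * dotp b (e j)) =
  (b <= a + vv l)%MS.
Proof.
move=> ij il jl ai.
have li : (l == i) = false by rewrite eq_sym; exact: negbTE.
have lj : (l == j) = false by rewrite eq_sym; exact: negbTE.
have three h : [\/ h = i, h = j | h = l].
  have : [|| h == i, h == j | h == l].
    move: ij il jl; rewrite -!val_eqE /=.
    by move: (ltn_ord i) (ltn_ord j) (ltn_ord l) (ltn_ord h); lia.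
  by case/or3P => /eqP ->; [constructor 1|constructor 2|constructor 3].
apply/eqP/idP => [ab|/sub_addsmxP[[d1 d2] /= ->]]; last first.
  rewrite (mx11_scalar d1) (mx11_scalar d2) !mul_scalar_mx.
  by rewrite !dotpDl !dotpZl !dual_basisP li lj !mulr0 !addr0; ring.
(* [t] matches the values at [e i]; the hypothesis then matches those at [e j], and [vv l] absorbs
   the difference at [e l]. *)
pose t := dotp b (e i) / dotp a (e i).
have bE : b = t *: a + (dotp b (e l) - t * dotp a (e l)) *: vv l.
  rewrite [LHS]covector_basis [RHS]covector_basis; apply: eq_bigr => h _.
  congr (_ *: _); rewrite dotpDl !dotpZl dual_basisP.
  case: (three h) => ->; rewrite ?li ?lj ?eqxx ?mulr0 ?addr0 ?mulr1.
  - by rewrite /t divfK.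
  - by rewrite /t mulrAC [dotp b _ * _]mulrC ab mulrAC divff // mul1r.
  - by rewrite addrC subrK.
by rewrite bE addmx_sub_adds // scalemx_sub.
Qed.

End DualBasis.

(** * The associated arrangement *)

Section RootsOfUnity.
Variables (R : realType) (m : nat).
Local Notation CK := (complex_complex__canonical__Num_NumField R).
Local Notation C := (Num.NumField.sort CK).

Definition zeta (a : 'I_m.+1) : C := expi (2 * pi * a%:R / m.+1%:R).

Lemma expi_period (x : R) (k : nat) : expi (x + 2 * pi * k%:R) = expi x.
Proof.
elim: k => [|k IH]; first by rewrite mulr0 addr0.
rewrite -[RHS]IH (_ : _ + _ = x + 2 * pi * k%:R + pi *+ 2).
  by rewrite /expi cosD2pi sinD2pi.
by rewrite mulr2n -natr1; ring.
Qed.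

Lemma zetaD a b : zeta (a + b) = zeta a * zeta b.
Proof.
rewrite /zeta -expiD; have n0 : m.+1%:R != 0 :> R by rewrite pnatr_eq0.
(* The sum in ['I_m.+1] is reduced modulo m + 1; the quotient contributes full turns. *)
rewrite -(expi_period _ ((a + b) %/ m.+1)); congr expi.
have e : (a%:R + b%:R : R) = ((a + b) %/ m.+1)%:R * m.+1%:R + (a + b)%R%:R.
  by rewrite -natrD {1}(divn_eq (a + b) m.+1) natrD natrM.
have -> : 2 * pi * a%:R / m.+1%:R + 2 * pi * b%:R / m.+1%:R =
  2 * pi * (a%:R + b%:R) / m.+1%:R :> R by ring.
rewrite e; move: (m.+1%:R : R) n0 => M M0; by field.
Qed.

Lemma zeta0 : zeta 0 = 1.
Proof. by rewrite /zeta mulr0 mul0r expi0. Qed.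

Lemma zeta_sum (J : finType) (P : pred J) (f : J -> 'I_m.+1) :
  zeta (\sum_(j | P j) f j) = \prod_(j | P j) zeta (f j).
Proof. by apply: (big_morph zeta zetaD zeta0). Qed.

Lemma expiN_zeta (a : 'I_m.+1) : expi (- (2 * pi / m.+1%:R) * a%:R) = (zeta a)^-1.
Proof.
have n0 : zeta a != 0 by rewrite -normr_eq0 normr_expi oner_neq0.
apply: (mulIf n0); rewrite mulVf // /zeta -expiD -[RHS]expi0.
by congr expi; ring.
Qed.

End RootsOfUnity.

Lemma other_two (l : 'I_3) : exists i j : 'I_3, [/\ i != j, i != l & j != l].
Proof.
by case: l => [] [|[|[|//]]] hl; [exists 1, 2|exists 0, 2|exists 0, 1]; split.
Qed.

Lemma third (i j : 'I_3) : exists l : 'I_3, i != l /\ j != l.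
Proof.
case: i => [] [|[|[|//]]] hi; case: j => [] [|[|[|//]]] hj;
  by [exists 0; split|exists 1; split|exists 2; split].
Qed.

(** * The configuration satisfies the analytic hypotheses *)

Section Bridge.
Variables (R : realType) (m : nat) (C : configuration R 3 m).
Variables (T : inner_cyclic R (conf_size C)) (xt : character R (arr_compl (ic_rest T))).
Hypothesis hC : planar C.
Hypothesis hT : associated T.
Hypothesis hxt : induced_character xt.
Local Notation CK := (complex_complex__canonical__Num_NumField R).
Local Notation CC := (Num.NumField.sort CK).
Local Notation "x %:C" := (real_complex R x : CC).
Let s (k : 'I_(conf_size C)) := hcoord (conf_S C k).
Let vv (i : 'I_3) := hcoord (conf_V C i).
Let e := dual_basis vv.

Lemma rest_compl x : arr_compl (ic_rest T) x <->
  forall k, rdot (s k) (hcoord x) != 0.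
Proof.
have [_ hS _ _] := hT; split=> [nx k|nx [k _]].
  by apply/eqP => e0; apply: nx; exists k => //; rewrite /ic_rest hS.
by rewrite /ic_rest hS => e0; have /eqP := nx k.
Qed.

Lemma lineV i x : ic_line T (inl i) x <-> rdot (vv i) (hcoord x) = 0.
Proof. by have [-> _ _ _] := hT. Qed.

Lemma lineS k x : ic_line T (inr k) x <-> rdot (s k) (hcoord x) = 0.
Proof. by have [_ -> _ _] := hT. Qed.

Lemma S_not_proportional k l (c : R) : k != l -> s k <> c *: s l.
Proof.
move=> kl h; have c0 : c != 0.
  by apply: contraTneq (hcoord_neq0 (conf_S C k)) => c0; rewrite negbK -/(s k) h c0 scale0r.
move/eqP: kl; apply; apply: (@conf_S_inj _ _ _ C).
by rewrite -[LHS]hcoordK -[RHS]hcoordK -/(s k) h toPZ.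
Qed.

Lemma transport_incl (l : loop R (arr_compl (ic_line T))) :
  xt (H1_map (set_incl (@ic_compl_sub _ _ T)) (loop_class l)) =
  transport xt (fun t => val (l t)).
Proof.
have v : valid (arr_compl (ic_rest T)) (fun t => val (l t)).
  split; last by move=> t; apply: (@ic_compl_sub _ _ T); exact: (set_mem (valP (l t))).
  apply: (@cts_comp _ _ _ (val : arr_compl (ic_line T) -> _) l).
    exact: initial_continuous.
  exact: cts_fun.
rewrite /loop_class H1_mapE.
have [_ _ _ <-] := chain_charP xt.
rewrite (transportE xt v) /= pushU; congr (chain_char xt << _ >>).
by apply/continuousEP => x; apply: val_inj.
Qed.

(** The loop misses all the lines, so its class comes from the complement of the whole arrangement;
    there [ic_merP] gives the value, and [hxt] carries it over to [xt]. *)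
Lemma transport_meridian k (p v : 'rV[CC]_3) (h : R) : 0 < h -> rdot (s k) p = 0 ->
  (forall t : CC, `|t| <= h%:C ->
    [/\ rdot (s k) (p + t *: v) = 0 -> t = 0,
        forall l, l != k -> rdot (s l) (p + t *: v) != 0 &
        forall i, rdot (vv i) (p + t *: v) != 0]) ->
  transport xt (fun t : R => toP (p + (h%:C * expi (2 * pi * t)) *: v)) =
  ic_mer T (inr k).
Proof.
move=> h0 pk disc.
have nz t : `|t| <= h%:C -> p + t *: v != 0.
  by case/disc => _ _ /(_ 0); exact: rdot_nz.
pose w (t : R) := h%:C * expi (2 * pi * t).
have hC0 : h%:C != 0 by rewrite real_complex_neq0 // gt_eqF.
have wn t : `|w t| = h%:C.
  by rewrite /w normrM normr_expi mulr1 ger0_norm // lecR ltW.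
have w0 t : w t != 0 by rewrite -normr_eq0 wn.
pose c (t : R) : P2 CK := toP (p + w t *: v).
have cA t : arr_compl (ic_line T) (c t).
  have wl : `|w t| <= h%:C by rewrite wn.
  have [d1 d2 d3] := disc _ wl.
  have dz g : rdot g (hcoord (c t)) = 0 -> rdot g (p + w t *: v) = 0.
    by move/eqP; rewrite /rdot dotp_hcoord_toP ?nz // => /eqP.
  case=> -[i|l] _.
    by move/lineV/dz/eqP; rewrite (negbTE (d3 i)).
  move/lineS/dz; have [-> /d1 wt0|lk /eqP] := eqVneq l k.
    by move: (w0 t); rewrite wt0 eqxx.
  by rewrite (negbTE (d2 l lk)).
have cc : continuous c.
  apply: (@continuous_toP _ _ (fun t => p + w t *: v)) => [|t].
    apply: cts_add; first exact: cts_cst.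
    apply: cts_scale; last exact: cts_cst.
    apply: cts_mul; first exact: cts_cst.
    by apply: cts_expi; apply: (@cts_mul _ R); [exact: cts_cst|exact: cts_id].
  by apply: nz; rewrite wn.
have vc : valid (arr_compl (ic_line T)) c by split.
have per t : corestr vc (t + 1) = corestr vc t.
  apply: val_inj => /=; rewrite /c /w mulrDr mulr1.
  by have := expi_period (2 * pi * t) 1; rewrite mulr1 => ->.
pose l := Loop per.
have mer : is_meridian (inr k) l.
  exists p, v, h; split=> //.
  - have nzp : p != 0.
      have := nz 0; rewrite normr0 scale0r addr0; apply.
      by rewrite lecR ltW.
    exists (toP p); first by apply/has_hcoordP.
    by apply/lineS/eqP; rewrite /rdot dotp_hcoord_toP //; apply/eqP.
  - move=> t x j th /has_hcoordP[tn ->].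
    have [d1 d2 d3] := disc _ th.
    have dz g : rdot g (hcoord (toP (p + t *: v))) = 0 -> rdot g (p + t *: v) = 0.
      by move/eqP; rewrite /rdot dotp_hcoord_toP // => /eqP.
    case: j => [i /lineV/dz/eqP|l' /lineS/dz]; first by rewrite (negbTE (d3 i)).
    have [->|lk] := eqVneq l' k; first by move/d1.
    by move/eqP; rewrite (negbTE (d2 l' lk)).
  - move=> t; apply/has_hcoordP; split=> //.
    by apply: nz; rewrite wn.
by rewrite -(ic_merP mer) -hxt transport_incl.
Qed.

Lemma vertex_unique i j l (x : P2 CK) : i != j -> i != l -> j != l ->
  rdot (vv i) (hcoord x) = 0 -> rdot (vv j) (hcoord x) = 0 ->
  x = toP (cx (e l)).
Proof.
move=> ij il jl xi xj.
have E : hcoord x = rdot (vv l) (hcoord x) *: cx (e l).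
  rewrite {1}[hcoord x](complex_dual_basis hC) (bigD1 l) //= big1 ?addr0 // => h hl.
  have [->|->] : h = i \/ h = j.
    have : (h == i) || (h == j).
      move: ij il jl hl; rewrite -!val_eqE /=.
      by move: (ltn_ord i) (ltn_ord j) (ltn_ord l) (ltn_ord h); lia.
    by case/orP => /eqP ->; [left|right].
    by rewrite xi scale0r.
  by rewrite xj scale0r.
have c0 : rdot (vv l) (hcoord x) != 0.
  apply: contraTneq (hcoord_neq0 x) => c0; by rewrite negbK E c0 scale0r.
by rewrite -[LHS]hcoordK E toPZ.
Qed.

Lemma S_off_vertices j : off_walls s (e j).
Proof.
move=> k.
have [i [l [il ij lj]]] := other_two j.
rewrite (not_through_vertices hC _ il ij lj).
by apply/negP; exact: (@conf_line_V _ _ _ C i l k il).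
Qed.

(** With h the third index, the class of k consists of the points S on the line through S_k and V_h,
    whose labels sum to zero. *)
Lemma class_prod i j k : i != j ->
  \prod_(l | same_line s e i j k l) ic_mer T (inr l) = 1.
Proof.
move=> ij.
have [h [ih jh]] := third i j.
have [_ _ _ hS] := hT.
under eq_bigr do rewrite hS.
rewrite -[RHS](zeta0 R m) -(conf_sum k h) zeta_sum.
apply: eq_bigl => l.
rewrite /same_line (same_line_span hC _ ij ih jh); last exact: S_off_vertices.
by apply/idP/idP => [|/set_mem//]; move=> kl; apply/mem_set.
Qed.

End Bridge.

(** * The invariant as a product over walls *)

Section Evaluation.
Variables (R : realType) (m : nat) (C : configuration R 3 m).
Variables (T : inner_cyclic R (conf_size C)) (xt : character R (arr_compl (ic_rest T))).
Hypothesis hC : planar C.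
Hypothesis hT : associated T.
Hypothesis hxt : induced_character xt.
Local Notation CK := (complex_complex__canonical__Num_NumField R).
Let s (k : 'I_(conf_size C)) := hcoord (conf_S C k).
Let vv (i : 'I_3) := hcoord (conf_V C i).
Let e := dual_basis vv.

(** Freezing the path at its ends keeps it on its side of the triangle for all real parameters. *)
Definition clamped_path (c : R -> P2 CK) (a b : R) (u : R) := c (a + clamp u * (b - a)).

Lemma clamped_pathP (A : set (P2 CK)) (chi : character R A) c a b : valid A c ->
  valid A (clamped_path c a b) /\
  transport chi (subpath c a b) = transport chi (clamped_path c a b).
Proof.
move=> vc; have vcl : valid A (clamped_path c a b).
  apply: (valid_comp _ vc); apply: (@cts_add _ R R^o (fun=> a)); first exact: cts_cst.
  by apply: (@cts_mul _ R); [exact: continuous_clamp|exact: cts_cst].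
split; first exact: vcl.
apply: eq_transport => [||t t01]; [exact: valid_subpath|exact: vcl|].
by rewrite /clamped_path clamp_id.
Qed.

Lemma clamped_param (a b u : R) : a <= b -> a <= a + clamp u * (b - a) <= b.
Proof.
move=> ab; have /andP[u0 u1] := clamp01 u.
by apply/andP; split; nra.
Qed.

(** Periodicity identifies the piece from 1 to a + 1 with that from 0 to a, which cancels the piece
    from a to 0. *)
Lemma transport_period (A : set (P2 CK)) (chi : character R A) (l : loop R (P2 CK)) a :
  valid A l -> transport chi l = transport chi (subpath l a (a + 1)).
Proof.
move=> vl.
rewrite -(transport_subpath chi a 1 (a + 1) vl) -(transport_subpath chi a 0 1 vl).
rewrite subpath01.
have -> : subpath l 1 (a + 1) = subpath l 0 a.
  apply/funext => t; rewrite /subpath -[RHS]loop_periodic; congr (l _); ring.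
rewrite mulrAC transport_subpath // transport_subpath_id // mul1r //.
Qed.

(** The circle is restarted at the parameter t 0, where it enters the first line; the three changes
    of line are forced to be vertices, as two of the lines have only one common point. *)
Lemma I_invariantE : I_invariant xt =
  \prod_(k | (0 < dotp (s k) (e 0) * dotp (s k) (e 1)) &&
             (0 < dotp (s k) (e 1) * dotp (s k) (e 2))) (ic_mer T (inr k))^-1.
Proof.
have vc : valid (arr_compl (ic_rest T)) (ic_circle T).
  by split; [exact: cts_fun|exact: ic_circle_compl].
have [t [t01 t12 t20 [L0 L1 L2]]] := ic_cyclic T.
have side i a b : a <= b -> (forall r, a <= r <= b -> ic_line T (inl i) (ic_circle T r)) ->
    forall u, rdot (vv i) (hcoord (clamped_path (ic_circle T) a b u)) = 0.
  by move=> ab h u; apply/(lineV hT)/h/clamped_param.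
have p0 a b : clamped_path (ic_circle T) a b 0 = ic_circle T a.
  by rewrite /clamped_path clamp_id ?lexx ?ler01 // mul0r addr0.
have p1 a b : clamped_path (ic_circle T) a b 1 = ic_circle T b.
  by rewrite /clamped_path clamp_id ?lexx ?ler01 // mul1r addrC subrK.
have in0 r : t 0 <= r <= t 1 -> rdot (vv 0) (hcoord (ic_circle T r)) = 0.
  by move=> h; apply/(lineV hT)/L0.
have in1 r : t 1 <= r <= t 2 -> rdot (vv 1) (hcoord (ic_circle T r)) = 0.
  by move=> h; apply/(lineV hT)/L1.
have in2 r : t 2 <= r <= t 0 + 1 -> rdot (vv 2) (hcoord (ic_circle T r)) = 0.
  by move=> h; apply/(lineV hT)/L2.
have E1 : ic_circle T (t 1) = toP (cx (e 2)).
  by apply: (vertex_unique hC (i := 0) (j := 1)) => //; [apply: in0|apply: in1];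
    rewrite lexx ltW.
have E2 : ic_circle T (t 2) = toP (cx (e 0)).
  by apply: (vertex_unique hC (i := 1) (j := 2)) => //; [apply: in1|apply: in2];
    rewrite lexx ltW.
have E0 : ic_circle T (t 0 + 1) = toP (cx (e 1)).
  apply: (vertex_unique hC (i := 0) (j := 2)) => //.
    by rewrite loop_periodic; apply: in0; rewrite lexx ltW.
  by apply: in2; rewrite lexx ltW.
have E0' : ic_circle T (t 0) = toP (cx (e 1)) by rewrite -E0 loop_periodic.
have [v0 q0] := clamped_pathP xt (t 0) (t 1) vc.
have [v1 q1] := clamped_pathP xt (t 1) (t 2) vc.
have [v2 q2] := clamped_pathP xt (t 2) (t 0 + 1) vc.
rewrite /I_invariant transport_loop (transport_period xt (t 0) vc).
apply: (transport_triangle_loop (rest_compl hT) (transport_meridian hT hxt)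
  (@S_not_proportional _ _ C) (dual_basisP hC) (complex_dual_basis hC)
  (S_off_vertices hC) (class_prod hC hT) vc v0 v1 v2
  (side 0 _ _ (ltW t01) L0) (side 1 _ _ (ltW t12) L1) (side 2 _ _ (ltW t20) L2)
  q0 q1 q2); rewrite ?p0 ?p1 ?E0 ?E1 ?E2 ?E0' //.
Qed.

End Evaluation.

(** * Chambers *)

Section Chambers.
Variables (R : realType) (m : nat) (C : configuration R 3 m).
Hypothesis hC : planar C.
Let s (k : 'I_(conf_size C)) := hcoord (conf_S C k).
Let vv (i : 'I_3) := hcoord (conf_V C i).
Let e := dual_basis vv.
Let co (z : P2 R) i := dotp (hcoord z) (e i).

(** Products of two coordinates do not feel the sign of the representative; the case i = j makes all
    the coordinates nonzero. *)
Definition same_chamber (x z : P2 R) :=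
  forall i j, 0 < (co z i * co z j) * (co x i * co x j).

Lemma off_sides (z : P2 R) :
  (~` [set x | exists i j : 'I_3, i != j /\
     line_through (conf_V C i) (conf_V C j) x]) z <-> forall l, co z l != 0.
Proof.
split=> [nz l|nz [i [j [ij]]]].
  apply/eqP => zl; apply: nz; have [i [j [ij il jl]]] := other_two l.
  exists i, j; split=> //.
  by rewrite /line_through /= -(not_through_vertices hC _ ij il jl); apply/eqP.
have [l [il jl]] := third i j.
by rewrite /line_through /= -(not_through_vertices hC _ ij il jl) (negbTE (nz l)).
Qed.

Lemma open_sign (c : R) i j : open [set z : P2 R | 0 < co z i * co z j * c].
Proof.
rewrite /open /= /quotient_open.
pose f (u : nonzero3 R) : R := dotp (val u) (e i) * dotp (val u) (e j) * c.
have cf : continuous f.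
  have cd h : continuous (fun u : nonzero3 R => dotp (val u) h : R).
    have -> : (fun u : nonzero3 R => dotp (val u) h) = (fun u => dotp h (val u)).
      by apply/funext => u; rewrite dotpC.
    by apply: cts_comp; [exact: continuous_dotp|exact: initial_continuous].
  by apply: cts_mul; [apply: cts_mul; exact: cd|exact: cts_cst].
rewrite (_ : _ @^-1` _ = f @^-1` [set r | 0 < r]).
  by move/continuousP: cf; apply; exact: open_gt.
have coE (u : nonzero3 R) : exists2 d, d != 0 &
    forall h, dotp (hcoord (\pi_(P2 R) u)) h = d * dotp (val u) h.
  have u0 : val u != 0 by exact: (set_mem (valP u)).
  have -> : \pi_(P2 R) u = toP (val u).
    by rewrite /toP; congr (\pi_ _ _); apply: val_inj; rewrite val_insubd_nz.
  by have [d d0 ->] := hcoord_toP u0; exists d => // h; exact: dotpZl.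
apply/seteqP; split=> u; have [d d0 E] := coE u; have d2 : 0 < d * d
    by rewrite -expr2 exprn_even_gt0.
all: rewrite /preimage /= /co /f !E.
  by move=> h; rewrite -(pmulr_rgt0 _ d2); move: h; congr (0 < _); ring.
by move=> h; rewrite -(pmulr_rgt0 _ d2) in h; move: h; congr (0 < _); ring.
Qed.

Lemma connected_same_chamber (B : set (P2 R)) x z : connected B -> B x -> B z ->
  (forall y l, B y -> co y l != 0) -> same_chamber x z.
Proof.
move=> cB Bx Bz nB i j.
have nx l : co x l != 0 by exact: nB.
set c := co x i * co x j.
have c0 : c != 0 by rewrite mulf_neq0.
have BE : B `&` [set y | 0 < co y i * co y j * c] = B.
  apply: cB.
  - by exists x; split=> //=; rewrite -/c -expr2 exprn_even_gt0.
  - by exists [set y | 0 < co y i * co y j * c] => //; exact: open_sign.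
  (* On [B] no coordinate vanishes, so the positive set is the complement of the open negative
     one. *)
  - exists (~` [set y | 0 < co y i * co y j * - c]).
      by apply: open_closedC; exact: open_sign.
    apply/seteqP; split=> y /= [By].
      by move=> h; split=> //; rewrite mulrN oppr_gt0; apply/negP; rewrite -leNgt ltW.
    rewrite mulrN oppr_gt0 => /negP; rewrite -leNgt => h; split=> //.
    by rewrite lt_neqAle h eq_sym !mulf_neq0 // nB.
by move: Bz; rewrite -BE => -[].
Qed.

Lemma same_chamber_connected x z : (forall l, co x l != 0) -> same_chamber x z ->
  exists B : set (P2 R), [/\ connected B, B x, B z & forall y l, B y -> co y l != 0].
Proof.
move=> nx xz.
(* The representative of z is given the sign that agrees with x; a segment of vectors then stays in
   the chamber. *)
pose sg : R := if 0 < co x 0 * co z 0 then 1 else -1.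
pose w := sg *: hcoord z.
have nz l : co z l != 0.
  by have := xz l l; apply: contraTneq => ->; rewrite !mul0r ltxx.
have sg0 : sg != 0 by rewrite /sg; case: ifP; rewrite ?oppr_eq0 oner_neq0.
have we l : dotp w (e l) = sg * co z l by rewrite dotpZl.
have w0 : 0 < co x 0 * dotp w (e 0).
  rewrite we /sg; have [h|h] := ltP 0 (co x 0 * co z 0); first by rewrite mul1r.
  by rewrite mulN1r mulrN oppr_gt0 lt_neqAle h andbT mulf_neq0.
have wl l : 0 < co x l * dotp w (e l).
  rewrite -(pmulr_rgt0 _ w0); have := xz 0 l.
  have sg2 : sg * sg = 1 by rewrite /sg; case: ifP; rewrite ?mulrNN mulr1.
  by congr (0 < _); rewrite !we -[LHS]mul1r -sg2; ring.
have w1 : toP w = toP (hcoord z) by rewrite toPZ.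
clearbody w.
pose y (t : R) := (1 - clamp t) *: hcoord x + clamp t *: w.
have yl t l : 0 < co x l * dotp (y t) (e l).
  rewrite /y dotpDl !dotpZl -/(co x l) mulrDr mulrCA [co x l * (clamp t * _)]mulrCA.
  apply: convex_pos; [|exact: wl|exact: clamp01].
  by rewrite -expr2 exprn_even_gt0 //= nx.
have y0 : forall r, y r != 0.
  move=> r; apply/eqP => e0; have := yl r 0.
  by rewrite e0 dotpC dotp0r mulr0 ltxx.
have cl0 : clamp (0 : R) = 0 by rewrite clamp_id // lexx ler01.
have cl1 : clamp (1 : R) = 1 by rewrite clamp_id // lexx ler01.
exists (range (toP \o y)); split.
- apply: connected_continuous_connected.
    by apply/connected_intervalP => a b _ _ c _.
  apply: continuous_subspaceT; apply: continuous_toP => //.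
  apply: cts_add; apply: cts_scale; try exact: cts_cst.
    apply: (@cts_add _ R R^o); first exact: cts_cst.
    by apply: (@cts_opp _ R R^o); exact: continuous_clamp.
  exact: continuous_clamp.
- by exists 0 => //=; rewrite /y cl0 subr0 scale1r scale0r addr0 hcoordK.
- by exists 1 => //=; rewrite /y cl1 subrr scale0r scale1r add0r w1 hcoordK.
- move=> _ l [t _ <-] /=; rewrite /co; have [d d0 ->] := hcoord_toP (y0 t).
  by rewrite dotpZl mulf_neq0 // (pos_neq0r (yl t l)).
Qed.

Lemma chamberP ch : is_chamber C ch -> exists x, (forall l, co x l != 0) /\
  forall z, ch z <-> same_chamber x z.
Proof.
move=> [x Ux ->]; have nx := (off_sides x).1 Ux; exists x; split=> // z.
split=> [[B [Bx BU cB] Bz]|xz].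
  by apply: (connected_same_chamber cB Bx Bz) => y l /BU/off_sides.
have [B [cB Bx Bz nB]] := same_chamber_connected nx xz.
exists B => //; split=> // y By; apply/off_sides => l; exact: nB.
Qed.

End Chambers.

Lemma mulr_gt0_eq (F : realDomainType) (a b : F) : a != 0 -> b != 0 ->
  (0 < a * b) = ((0 < a) == (0 < b)).
Proof.
case: (ltrgt0P a) => // ha _; case: (ltrgt0P b) => // hb _.
- by rewrite mulr_gt0.
- by apply/negbTE; rewrite -leNgt ltW // pmulr_rlt0.
- by apply/negbTE; rewrite -leNgt ltW // pmulr_llt0.
- by rewrite nmulr_rgt0.
Qed.

Lemma ord3P (P : 'I_3 -> Prop) : P 0 -> P 1 -> P 2 -> forall i, P i.
Proof.
move=> P0 P1 P2 [[|[|[|//]]] hi].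
- by rewrite (_ : Ordinal hi = 0) //; exact: val_inj.
- by rewrite (_ : Ordinal hi = 1) //; exact: val_inj.
- by rewrite (_ : Ordinal hi = 2) //; exact: val_inj.
Qed.

Section ChamberWeight.
Variables (R : realType) (m : nat) (C : configuration R 3 m).
Variable T : inner_cyclic R (conf_size C).
Hypothesis hC : planar C.
Hypothesis hT : associated T.
Let s (k : 'I_(conf_size C)) := hcoord (conf_S C k).
Let vv (i : 'I_3) := hcoord (conf_V C i).
Let e := dual_basis vv.
Let f k i := dotp (s k) (e i).

(** The sign depends only on the ratio of the two values, which is constant on the classes of
    [same_line]. *)
Lemma sgn_prod_eq1 i j (b : bool) : i != j ->
  \prod_(k | (0 < f k i * f k j) == b) ic_mer T (inr k) = 1.
Proof.
move=> ij; have hoff := S_off_vertices hC.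
apply: (prod_classes (same_line_equiv hoff i j)) => [k l /eqP|k].
  rewrite -/(f k j) -/(f l i) -/(f k i) -/(f l j) => E.
  have ki : 0 < f k i * f k i by rewrite -expr2 exprn_even_gt0 // hoff.
  have li : 0 < f l i * f l i by rewrite -expr2 exprn_even_gt0 // hoff.
  rewrite -(pmulr_rgt0 _ li) -[X in _ = (X == _)](pmulr_rgt0 _ ki).
  rewrite (_ : f l i * f l i * _ = f l i * f k i * (f k j * f l i)); last by ring.
  by rewrite E; congr (0 < _ == _); ring.
exact: class_prod hC hT _ _ k ij.
Qed.

Lemma f_mul_gt0 k i j : (0 < f k i * f k j) = ((0 < f k i) == (0 < f k j)).
Proof. by rewrite mulr_gt0_eq //; exact: S_off_vertices hC _ k. Qed.

(** The union of two chambers is the locus where one product of two coordinates has a given sign, so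
    by [sgn_prod_eq1] their values multiply to 1. Comparing such pairs shows that the four values
    agree. *)
Lemma pattern_prod (b c : bool) :
  \prod_(k | ((0 < f k 0 * f k 1) == b) && ((0 < f k 1 * f k 2) == c)) ic_mer T (inr k) =
  \prod_(k | (0 < f k 0 * f k 1) && (0 < f k 1 * f k 2)) ic_mer T (inr k).
Proof.
pose Z b c := \prod_(k | ((0 < f k 0 * f k 1) == b) && ((0 < f k 1 * f k 2) == c))
  ic_mer T (inr k).
have -> : \prod_(k | (0 < f k 0 * f k 1) && (0 < f k 1 * f k 2)) ic_mer T (inr k) =
    Z true true by apply: eq_bigl => k; rewrite !eqb_id.
rewrite -/(Z b c).
have Z1 b' : Z b' true * Z b' false = 1.
  rewrite -(@sgn_prod_eq1 0 1 b') // (bigID (fun k => 0 < f k 1 * f k 2)) /=.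
  by congr (_ * _); apply: eq_bigl => k; rewrite ?eqb_id ?eqbF_neg.
have Z2 c' : Z true c' * Z false c' = 1.
  rewrite -(@sgn_prod_eq1 1 2 c') // (bigID (fun k => 0 < f k 0 * f k 1)) /=.
  by congr (_ * _); apply: eq_bigl => k; rewrite ?eqb_id ?eqbF_neg andbC.
have Z3 : Z true true * Z false false = 1.
  rewrite -(@sgn_prod_eq1 0 2 true) // (bigID (fun k => 0 < f k 0 * f k 1)) /=.
  by congr (_ * _); apply: eq_bigl => k; rewrite eqb_id !f_mul_gt0;
    case: (0 < f k 0); case: (0 < f k 1); case: (0 < f k 2).
clearbody Z.
have n0 : Z true true != 0 by apply: contra_eq_neq Z3 => ->; rewrite mul0r eq_sym oner_neq0.
have n1 : Z false true != 0.
  by apply: contra_eq_neq (Z1 false) => ->; rewrite mul0r eq_sym oner_neq0.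
have e1 : Z true false = Z false true by apply: (mulfI n0); rewrite Z1 Z2.
have e2 : Z false false = Z false true by apply: (mulfI n0); rewrite Z3 Z2.
have e3 : Z true true = Z false true.
  by apply: (mulIf n1); rewrite Z2 -{2}e2 Z1.
by case: b; case: c; rewrite ?e1 ?e2 ?e3.
Qed.

Lemma zeta_chamber_weight ch : is_chamber C ch -> zeta R (chamber_weight C ch) =
  \prod_(k | (0 < f k 0 * f k 1) && (0 < f k 1 * f k 2)) ic_mer T (inr k).
Proof.
move=> /(chamberP hC)[x [nx chE]]; have [_ _ _ hS] := hT.
pose g i := dotp (hcoord x) (e i).
have g0 i : g i != 0 by exact: nx.
rewrite -(pattern_prod (0 < g 0 * g 1) (0 < g 1 * g 2)) /chamber_weight zeta_sum.
under [RHS]eq_bigr do rewrite hS.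
apply: eq_bigl => k.
have n0 i : f k i != 0 by exact: S_off_vertices hC i k.
have g_mul_gt0 i j : (0 < g i * g j) = ((0 < g i) == (0 < g j)).
  by rewrite mulr_gt0_eq.
have chamberE i j : (0 < (f k i * f k j) * (g i * g j)) =
    (((0 < f k i) == (0 < f k j)) == ((0 < g i) == (0 < g j))).
  by rewrite mulr_gt0_eq ?mulf_neq0 // f_mul_gt0 g_mul_gt0.
rewrite !f_mul_gt0 !g_mul_gt0; apply/idP/idP => [/set_mem/chE h|/andP[h01 h12]].
  by rewrite -!chamberE; apply/andP; split; exact: h.
apply/mem_set/chE => i j; rewrite -/(f k i) -/(f k j) -/(g i) -/(g j) chamberE.
move: h01 h12; elim/ord3P: i; elim/ord3P: j;
  by case: (0 < f k 0); case: (0 < f k 1); case: (0 < f k 2);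
     case: (0 < g 0); case: (0 < g 1); case: (0 < g 2).
Qed.

End ChamberWeight.

Theorem theorem6p9 (R : realType) (m : nat) (C : configuration R 3 m)
  (hC : planar C)
  (T : inner_cyclic R (conf_size C)) (hT : associated T)
  (xt : character R (arr_compl (ic_rest T))) (hxt : induced_character xt)
  (ch : set (P2 R)) (hch : is_chamber C ch) :
  I_invariant xt = expi (- (2 * pi / m.+1%:R) * (chamber_weight C ch)%:R).
Proof.
rewrite (I_invariantE hC hT hxt) expiN_zeta (zeta_chamber_weight hC hT hch).
exact: prodfV.
Qed.
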